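(* Let $i\in\{1,2\}$. Assume: (X1) $\mathbb{X}$ is a compact subset of $\mathbb{R}^d$; (X2) there is $c>0$ such that $|B(x,r)\cap\mathbb{X}|\ge c|B(x,r)|$ for all $x\in\mathbb{X}$ and $0\le r\le\operatorname{diam}(\mathbb{X})$; (X3) $P$ and $Q$ are absolutely continuous with respect to Lebesgue measure on $\mathbb{R}^d$ with densities $p,q$, and there are $\underline p,\bar q>0$ with $p(x)\ge\underline p$ and $q(x)\le\bar q$ for all $x\in\mathbb{X}$; (X4) $g$ is Lipschitz-continuous on $\mathbb{X}$; (X5) $p$ is Lipschitz-continuous on $\mathbb{X}$; (A) $\sup_{L>0}\left\{L^{1/d}\int_{\mathbb{X}}\exp(-L\,\delta(x)^d)\,\mathrm dQ(x)\right\}<\infty$. Let $U$ be an open, convex and bounded set containing $\mathbb{X}$. If $i=1$, assume moreover that for every $x\in\mathbb{X}$ the map $\Delta(x,\cdot)$ is the restriction to $\mathbb{X}$ of a map $U\to\mathbb{R}$, still denoted $\Delta(x,\cdot)$, twice continuously differentiable on $U$, with $$\sup_{(x,y)\in\mathbb{X}\times\mathrm{co}(\mathbb{X})}\left\{\|\nabla_2\Delta(x,y)\|+\|\nabla_2^2\Delta(x,y)\|\right\}<\infty.$$ If $i=2$, assume moreover that $g$ is the restriction to $\mathbb{X}$ of a twice continuously differentiable map $U\to\mathbb{R}$. Then there exists a constant $C_{i,d,P,Q,h}$ (depending only on $i,d,P,Q,h$) such that for all $n\ge1$ and $1\le k\le n$, $$\mathbb{E}[B_{i,n}^2]\le C_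{i,d,P,Q,h}\left(\frac{k}{n+1}\right)^{\min\{4/d,\,3\}}.$$
   Context: $\|\cdot\|$ is the Euclidean norm on $\mathbb{R}^d$ (and the induced operator norm on $d\times d$ matrices), $|B|$ the Lebesgue measure of a Borel set $B$, $B(x,r)$ the closed ball of centre $x$ and radius $r$, $\mathrm{co}(\mathbb{X})$ the convex hull of $\mathbb{X}$, and $\delta(x)$ the distance from $x$ to the complement $\mathbb{X}^c=\mathbb{R}^d\setminus\mathbb{X}$. Setting: $\mathbb{X}\subset\mathbb{R}^d$ is measurable. $(X_i,Y_i)$, $1\le i\le n$, are i.i.d. copies of $(X,Y)$ in $\mathbb{X}\times\mathbb{R}$ with $X\sim P$; $X_j^*$, $1\le j\le m$, are i.i.d. copies of $X^*\sim Q$ with values in $\mathbb{X}$, independent of the $(X_i,Y_i)$'s. $(X^*,Y^* )$ is a pair such that the conditional distribution of $Y^*$ given $X^*=x$ equals that of $Y$ given $X=x$. $h:\mathbb{X}\times\mathbb{R}\to\mathbb{R}$ is measurable and such that the expectations below are well defined. Put $g(x)=\mathbb{E}[h(X,Y)\mid X=x]$, $\Delta(x,u)=\mathbb{E}[h(x,Y_1)\mid X_1=u]$ (so $\Delta(x,x)=g(x)$), and $e(h)=\mathbb{E}[h(X^*,Y^* )]=\int_{\mathbb{X}}g\,\mathrm dQ$. $\nabla_2\Delta(x,y)$ and $\nabla_2^2\Delta(x,y)$ denote the gradient and Hessian at $y$ of $z\mapsto\Delta(x,z)$. For $1\le k\le n$, $\hat\tau_k(x)$ is the $k$th order statistic of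 $(\|X_i-x\|)_{1\le i\le n}$ and $\hat i_\ell(x)$ is the index of the $\ell$th nearest neighbour of $x$ among $X_1,\dots,X_n$. Estimators: $\hat e_1(h)=\frac1m\sum_{j=1}^m h(X_j^*,\hat Y_j^* )$, where conditionally on $\mathcal F_{m,n}=\sigma(X_i,Y_i,X_j^*;\,1\le i\le n,\,1\le j\le m)$ the $\hat Y_j^*$ are independent and $\hat Y_j^*$ equals $Y_i$ with probability $k^{-1}\mathbf 1(\|X_i-X_j^*\|\le\hat\tau_k(X_j^* ))$ (i.e. $\hat Y_j^*$ is the label of a uniformly chosen one of the $k$ nearest neighbours of $X_j^*$); and $\hat e_2(h)=\frac1n\sum_{i=1}^n\frac{nM_k^*(X_i)}{mk}h(X_i,Y_i)$ with $M_k^*(x)=\sum_{j=1}^m\mathbf 1(\|x-X_j^*\|\le\hat\tau_k(X_j^* ))$. The conditional bias is $B_{i,n}=\mathbb{E}[\hat e_i(h)\mid X_1,\dots,X_n]-e(h)$; explicitly $B_{1,n}=\frac1k\sum_{\ell=1}^k\int_{\mathbb{X}}[\Delta(x,X_{\hat i_\ell(x)})-g(x)]\,\mathrm dQ(x)$ and $B_{2,n}=\frac1k\sum_{\ell=1}^k\int_{\mathbb{X}}[g(X_{\hat i_\ell(x)})-g(x)]\,\mathrm dQ(x)$. *)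

(* Defs.v *)
From HB Require Import structures.
From mathcomp Require Import all_boot all_order all_algebra.
From mathcomp Require Import all_classical all_reals all_analysis.
From mathcomp Require Import interval_inference measurable_realfun.

Set Implicit Arguments.
Unset Strict Implicit.
Unset Printing Implicit Defensive.
Import Order.TTheory GRing.Theory Num.Theory.
Import numFieldNormedType.Exports.

Local Open Scope classical_set_scope.
Local Open Scope ring_scope.

(* 'rV[R]_d carries the sigma-algebra generated by the coordinates, which is
   the Borel one by measurable_rVE below. *)
Definition rV_display : measure_display. Proof. exact. Qed.

Section measurable_rV.
Context {R : realType} {d : nat}.

Let coor (i : 'I_d) (x : 'rV[R]_d) : R := x ord0 i.

Let rV_set0 : g_sigma_preimage coor set0.
Proof. exact: sigma_algebra0. Qed.

Let rV_setC A : g_sigma_preimage coor A -> g_sigma_preimage coor (~` A).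
Proof. exact: sigma_algebraC. Qed.

Let rV_bigcup (F : (set 'rV[R]_d)^nat) :
  (forall i, g_sigma_preimage coor (F i)) ->
  g_sigma_preimage coor (\bigcup_i (F i)).
Proof. exact: sigma_algebra_bigcup. Qed.

HB.instance Definition _ := @isMeasurable.Build rV_display
  'rV[R]_d (g_sigma_preimage coor) rV_set0 rV_setC rV_bigcup.

Lemma measurable_coor (i : 'I_d) :
  measurable_fun [set: 'rV[R]_d] (fun x => x ord0 i).
Proof.
move=> _ B mB; rewrite setTI; apply: sub_sigma_algebra.
by rewrite (bigD1 i)//=; left; exists B => //; rewrite setTI.
Qed.

Lemma measurable_fun_rV (d1 : measure_display) (T : measurableType d1)
    (f : T -> 'rV[R]_d) :
  (forall i, measurable_fun [set: T] (fun t => f t ord0 i)) ->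
  measurable_fun [set: T] f.
Proof.
move=> mf; apply: (measurability (\big[setU/set0]_(i < d)
  preimage_set_system setT (coor i) measurable)) => //.
move=> _ [B + <-]; elim/big_ind : _ => //.
- by move=> A1 A2 h1 h2 [/h1|/h2].
- by move=> i _ [C mC <-]; rewrite setTI; exact: mf.
Qed.

End measurable_rV.

Section lebesgue_step.
Context {R : realType} {d : nat}.

Definition rV_cons (xv : R * 'rV[R]_d) : 'rV[R]_d.+1 :=
  \row_i if unlift ord0 i is Some j then xv.2 ord0 j else xv.1.

Lemma rV_cons0 xv : rV_cons xv ord0 ord0 = xv.1.
Proof. by rewrite mxE unlift_none. Qed.

Lemma rV_consS xv (i : 'I_d) : rV_cons xv ord0 (lift ord0 i) = xv.2 ord0 i.
Proof. by rewrite mxE liftK. Qed.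

Lemma measurable_rV_cons : measurable_fun [set: R * 'rV[R]_d] rV_cons.
Proof.
apply: measurable_fun_rV => i; case: (unliftP ord0 i) => [j|] ->.
- rewrite (_ : (fun t => _) = (fun x : 'rV[R]_d => x ord0 j) \o snd).
    exact: measurableT_comp (measurable_coor j) _.
  by apply/funext => t; rewrite rV_consS.
- rewrite (_ : (fun t => _) = fst); first exact: measurable_fst.
  by apply/funext => t; rewrite rV_cons0.
Qed.

Definition rV_uncons (x : 'rV[R]_d.+1) : R * 'rV[R]_d :=
  (x ord0 ord0, \row_i x ord0 (lift ord0 i)).

Lemma rV_consK : cancel rV_cons rV_uncons.
Proof.
move=> [x v]; rewrite /rV_uncons rV_cons0; congr pair.
by apply/rowP => i; rewrite mxE rV_consS.
Qed.

Lemma rV_unconsK : cancel rV_uncons rV_cons.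
Proof.
move=> x; apply/rowP => i; case: (unliftP ord0 i) => [j|] ->.
- by rewrite rV_consS mxE.
- by rewrite rV_cons0.
Qed.

Lemma measurable_rV_uncons : measurable_fun [set: 'rV[R]_d.+1] rV_uncons.
Proof.
apply/measurable_fun_pairP; split; first exact: measurable_coor.
apply: measurable_fun_rV => i; rewrite (_ : (fun t => _) = (fun x : 'rV[R]_d.+1 => x ord0 (lift ord0 i))).
  exact: measurable_coor.
by apply/funext => t; rewrite mxE.
Qed.

Definition lebesgue_step (m : {sigma_finite_measure set 'rV[R]_d -> \bar R}) :
  set 'rV[R]_d.+1 -> \bar R :=
  pushforward (@lebesgue_measure R \x m)%E rV_cons.

Variable m : {sigma_finite_measure set 'rV[R]_d -> \bar R}.

Let step0 : lebesgue_step m set0 = 0%E.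
Proof. by rewrite /lebesgue_step /pushforward preimage_set0 measure0. Qed.

Let step_ge0 A : (0 <= lebesgue_step m A)%E.
Proof. by apply: integral_ge0 => x _; exact: measure_ge0. Qed.

Let step_sigma_additive : semi_sigma_additive (lebesgue_step m).
Proof.
move=> F mF tF mUF; rewrite /lebesgue_step /pushforward preimage_bigcup.
apply: measure_semi_sigma_additive.
- by move=> n; rewrite -[X in measurable X]setTI; exact: measurable_rV_cons.
- apply/trivIsetP => /= i j _ _ ij; rewrite -preimage_setI.
  by move/trivIsetP : tF => /(_ _ _ _ _ ij) ->//; rewrite preimage_set0.
- rewrite -preimage_bigcup -[X in measurable X]setTI.
  exact: measurable_rV_cons.
Qed.

HB.instance Definition _ := isMeasure.Build _ _ _ (lebesgue_step m)
  step0 step_ge0 step_sigma_additive.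

Let step_sigma_finite : sigma_finite setT (lebesgue_step m).
Proof.
have /sigma_finiteP[F [TF ndF Foo]] := sigma_finiteT (@lebesgue_measure R).
have /sigma_finiteP[G [TG ndG Goo]] := sigma_finiteT m.
exists (fun n => rV_uncons @^-1` (F n `*` G n)).
  rewrite -preimage_bigcup -[LHS](preimage_setT rV_uncons); congr (_ @^-1` _).
  rewrite -setXTT TF TG predeqE => -[x y]; split.
    move=> [/= [n _ Fnx] [k _ Gky]]; exists (maxn n k) => //; split.
    - by move: x Fnx; exact/subsetPset/ndF/leq_maxl.
    - by move: y Gky; exact/subsetPset/ndG/leq_maxr.
  by move=> [n _ []/= ? ?]; split; exists n.
move=> n; have [mF Fn] := Foo n; have [mG Gn] := Goo n; split.
  rewrite -[X in measurable X]setTI; apply: measurable_rV_uncons => //.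
  exact: measurableX.
rewrite /= /lebesgue_step /pushforward -comp_preimage.
rewrite (_ : rV_uncons \o rV_cons = id); last first.
  by apply/funext => x /=; rewrite rV_consK.
rewrite preimage_id product_measure1E//.
by rewrite lte_mul_pinfty// ge0_fin_numE.
Qed.

HB.instance Definition _ := Measure_isSigmaFinite.Build _ _ _ (lebesgue_step m)
  step_sigma_finite.

End lebesgue_step.

(* Lebesgue measure on R^d, as the d-fold product of the one on R; see
   lebesgue_rV_box. *)
Fixpoint lebesgue_rV (R : realType) (d : nat) :
    {sigma_finite_measure set 'rV[R]_d -> \bar R} :=
  match d return {sigma_finite_measure set 'rV[R]_d -> \bar R} with
  | 0 => \d_ (0 : 'rV[R]_0)
  | d'.+1 => lebesgue_step (lebesgue_rV R d')
  end.

Lemma lebesgue_rV_box (R : realType) (d : nat) (A : 'I_d -> set R) :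
  (forall i, measurable (A i)) ->
  lebesgue_rV R d [set x | forall i, A i (x ord0 i)] =
  (\prod_(i < d) lebesgue_measure (A i))%E.
Proof.
elim: d A => [|d IHd] A mA.
  by rewrite big_ord0 /= diracE mem_set// => -[].
rewrite big_ord_recl -(IHd (fun i => A (lift ord0 i)))//.
have mB : measurable [set x : 'rV[R]_d | forall i, A (lift ord0 i) (x ord0 i)].
  rewrite (_ : [set x | _] = \bigcap_(i in [set: 'I_d])
     ((fun x : 'rV[R]_d => x ord0 i) @^-1` A (lift ord0 i))); last first.
    by apply/seteqP; split => x /= h i; [move=> _|]; exact: h.
  apply: fin_bigcap_measurable => // i _.
  by rewrite -[X in measurable X]setTI; exact: measurable_coor.
rewrite /= /lebesgue_step /pushforward -product_measure1E//; last exact: (mA ord0).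
congr (product_measure1 _ _ _); apply/seteqP; split => -[x v] /=.
- move=> h; split; first by have := h ord0; rewrite rV_cons0.
  by move=> i; have := h (lift ord0 i); rewrite rV_consS.
- move=> [h0 hS] i; case: (unliftP ord0 i) => [j|] ->.
  + by rewrite rV_consS; exact: hS.
  + by rewrite rV_cons0.
Qed.


Lemma measurable_rVE (R : realType) (d : nat) :
  @measurable _ 'rV[R]_d = <<s @open 'rV[R]_d >>.
Proof.
apply/seteqP; split.
- apply: smallest_sub.
    split => [|A|F].
    + exact: sigma_algebra0.
    + exact: sigma_algebraCD.
    + exact: sigma_algebra_bigcup.
  move=> A; elim/big_ind : _ => // [A1 A2 h1 h2 [/h1|/h2]//|i _ [B mB <-]].
  have : measurable_fun [set: g_sigma_algebraType (@open 'rV[R]_d)]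
      (fun x : 'rV[R]_d => x ord0 i).
    apply: (measurability _ (RGenOInfty.measurableE R)).
    move=> _ [_ [r ->] <-]; rewrite setTI.
    apply: sub_sigma_algebra; apply: open_comp; last exact: interval_open.
    by move=> x _; exact: coord_continuous.
  by move=> /(_ measurableT _ mB).
- apply: smallest_sub; first exact: sigma_algebra_measurable.
  move=> U oU.
  pose q2r (q : 'rV[rat]_d) : 'rV[R]_d := map_mx ratr q.
  pose B (qn : 'rV[rat]_d * nat) : set 'rV[R]_d := ball (q2r qn.1) qn.2.+1%:R^-1.
  have mB qn : measurable (B qn).
    rewrite (_ : B qn = \bigcap_(i in [set: 'I_d])
       ((fun x : 'rV[R]_d => x ord0 i) @^-1`
          ball (q2r qn.1 ord0 i) qn.2.+1%:R^-1)).
      apply: fin_bigcap_measurable => // i _.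
      rewrite -[X in measurable X]setTI; apply: measurable_coor => //.
      exact: measurable_ball.
    apply/seteqP; split => x /=.
      by move=> [_ h] i _; exact: h.
    by move=> h; split => // i j; rewrite (ord1 i); exact: h.
  rewrite (_ : U = \bigcup_qn
      (if `[< B qn `<=` U >] then B qn else set0)).
    apply: countable_bigcupT_measurable => // qn.
    by case: ifPn.
  apply/seteqP; split => [x Ux|x [qn _]]; last by case: asboolP => // BU /BU.
  have /nbhs_ballP[e /= e0 eU] : nbhs x U by exact: open_nbhs_nbhs.
  have [n ne] : exists n, n.+1%:R^-1 < e / 2 :> R.
    have [n _ /(_ n (leqnn n))] :=
      near_infty_natSinv_lt (PosNum (divr_gt0 e0 (ltr0n R 2))).
    by exists n.
  have hq i : exists q : rat, ball (x ord0 i) n.+1%:R^-1 (ratr q).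
    suff : ball (x ord0 i) n.+1%:R^-1 `&` range ratr !=set0.
      by move=> [/= _ []] /[swap] -[y _ <-]; exists y.
    apply: dense_rat; last exact: ball_open.
    by exists (x ord0 i); exact: ballxx.
  have [f hf] := choice hq.
  exists (\row_i f i, n) => //; rewrite asboolT.
    split => // i j; rewrite (ord1 i) !mxE; apply: ball_sym; exact: hf.
  have xq : ball x n.+1%:R^-1 (q2r (\row_i f i)).
    by split => // i j; rewrite (ord1 i) !mxE; exact: hf.
  move=> y /= qy; apply: eU; rewrite (splitr e).
  apply: (@ball_triangle _ _ (q2r (\row_i f i))).
  - exact: le_ball (ltW ne) _ xq.
  - exact: le_ball (ltW ne) _ qy.
Qed.

Section euclidean.
Context {R : realType} {d : nat}.
Implicit Types (x y : 'rV[R]_d) (S U : set 'rV[R]_d) (f : 'rV[R]_d -> R).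

(* The library norm on 'rV[R]_d is the sup norm; it induces the same topology,
   open sets and bounded sets as the Euclidean one below. *)
Definition enorm x : R := Num.sqrt (\sum_(i < d) x ord0 i ^+ 2).

Definition ecball x (r : R) : set 'rV[R]_d := [set y | enorm (y - x) <= r].

Definition ediam S : R := sup [set enorm (x - y) | x in S & y in S].

Definition dist_compl S x : R := inf [set enorm (x - y) | y in ~` S].

Definition opnorm (A : 'M[R]_d) : R :=
  sup [set enorm (v *m A) | v in [set v | enorm v <= 1]].

Definition elipschitz_on S f :=
  exists K : R, forall x y, S x -> S y -> `|f x - f y| <= K * enorm (x - y).

Definition partial f (i : 'I_d) x : R := 'D_(delta_mx ord0 i) f x.

Definition gradient f x : 'rV[R]_d := \row_i partial f i x.

Definition hessian f x : 'M[R]_d := \matrix_(i, j) partial (partial f i) j x.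

(* U is meant to be open, so that pointwise continuity at the points of U is
   continuity on U. *)
Definition C2_on U f := forall x, U x ->
  [/\ differentiable f x,
      forall i, differentiable (partial f i) x
    & {for x, continuous (hessian f)}].

Definition conv_hull S : set 'rV[R]_d :=
  smallest (@convex_set R 'rV[R]_d) S.

Definition has_density (P : set 'rV[R]_d -> \bar R) (p : 'rV[R]_d -> R) :=
  [/\ measurable_fun [set: 'rV[R]_d] p,
      forall x, 0 <= p x
    & forall A, measurable A ->
        P A = (\int[lebesgue_rV R d]_(x in A) (p x)%:E)%E].

End euclidean.

(* Law of a pair whose first component has law mu and whose second component
   has conditional law nu x given that the first one is x. *)
Section joint_law.
Local Open Scope ereal_scope.
Context d1 d2 (T1 : measurableType d1) (T2 : measurableType d2) (R : realType).

Definition joint_law (mu : set T1 -> \bar R)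
    (nu : T1 -> {measure set T2 -> \bar R}) : set (T1 * T2) -> \bar R :=
  fun A => \int[mu]_x nu x (xsection A x).

Variables (mu : probability T1 R) (nu : R.-pker T1 ~> T2).

Let joint_law0 : joint_law mu nu set0 = 0.
Proof. by apply: integral0_eq => x _; rewrite xsection0 measure0. Qed.

Let joint_law_ge0 A : 0 <= joint_law mu nu A.
Proof. by apply: integral_ge0 => x _; exact: measure_ge0. Qed.

Let joint_law_sigma_additive : semi_sigma_additive (joint_law mu nu).
Proof.
move=> F mF tF mUF.
rewrite [X in _ --> X](_ : _ = \sum_(n <oo) joint_law mu nu (F n)).
  by apply/cvg_closeP; split; [exact: is_cvg_nneseries|rewrite closeE].
rewrite /joint_law -integral_nneseries//; last first.
  by move=> n; apply: measurable_fun_xsection_finite_kernel; rewrite inE.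
apply: eq_integral => x _; apply/esym/cvg_lim => //=; rewrite xsection_bigcup.
apply: (measure_sigma_additive _ (trivIset_xsection tF)) => ?.
exact: measurable_xsection.
Qed.

HB.instance Definition _ := isMeasure.Build _ _ _ (joint_law mu nu)
  joint_law0 joint_law_ge0 joint_law_sigma_additive.

Let joint_law_setT : joint_law mu nu setT = 1.
Proof.
rewrite /joint_law (eq_integral (cst 1)).
  by rewrite integral_cst// mul1e; exact: probability_setT.
move=> x _ /=; rewrite -(@prob_kernel _ _ _ _ _ nu x); congr (nu x _).
by apply/seteqP; split => // y _; rewrite xsectionE.
Qed.

HB.instance Definition _ := Measure_isProbability.Build _ _ _ (joint_law mu nu)
  joint_law_setT.

End joint_law.

Section probability_notions.
Context (dT : measure_display) (T : measurableType dT) (R : realType).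
Variable Pr : probability T R.

(* W is a version of the conditional expectation of Z given the sigma-algebra
   G. *)
Definition is_cond_expectation (G : set (set T)) (Z W : T -> R) :=
  [/\ Pr.-integrable [set: T] (EFin \o Z),
      Pr.-integrable [set: T] (EFin \o W),
      forall B : set R, measurable B -> G (W @^-1` B)
    & forall A, G A ->
        (\int[Pr]_(w in A) (W w)%:E = \int[Pr]_(w in A) (Z w)%:E)%E].

(* Independence of finitely many sigma-algebras: since each contains [set: T],
   the product rule for the full family yields it for every subfamily. *)
Definition mutually_independent (I : finType) (G : I -> set (set T)) :=
  forall E : I -> set T, (forall i, G i (E i)) ->
    Pr (\bigcap_i E i) = (\prod_i Pr (E i))%E.

End probability_notions.

Section regression.
Context {R : realType} {d : nat}.
Variables (nu : 'rV[R]_d -> {measure set R -> \bar R}).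
Variables (h : 'rV[R]_d * R -> R).

(* E[h(x, Y) | X = u] and E[h(X, Y) | X = x], nu being the conditional law of Y
   given X *)
Definition Delta (x u : 'rV[R]_d) : R := \int[nu u]_y h (x, y).

Definition regression (x : 'rV[R]_d) : R := Delta x x.

End regression.

Section estimators.
Context {R : realType} {d n m : nat}.
Variables (k : nat) (h : 'rV[R]_d * R -> R).
Implicit Types (x : 'I_n -> 'rV[R]_d) (y : 'I_n -> R).
Implicit Types (xs : 'I_m -> 'rV[R]_d) (ys : 'I_m -> R).

(* k-th order statistic (k >= 1) of the distances from z to the points x_i *)
Definition knn_radius x (z : 'rV[R]_d) : R :=
  nth 0 (sort <=%R (codom (fun i => enorm (x i - z)))) k.-1.

Definition knn_weight x (z : 'rV[R]_d) (i : 'I_n) : R :=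
  k%:R^-1 * (enorm (x i - z) <= knn_radius x z)%R%:R.

Definition knn_count x xs (z : 'rV[R]_d) : nat :=
  (\sum_(j < m) (enorm (z - xs j) <= knn_radius x (xs j))%R)%N.

Definition estimator1 xs ys : R := m%:R^-1 * \sum_(j < m) h (xs j, ys j).

Definition estimator2 x y xs : R :=
  n%:R^-1 * \sum_(i < n)
    n%:R * (knn_count x xs (x i))%:R / (m%:R * k%:R) * h (x i, y i).

End estimators.

Section sampling.
Context (dT : measure_display) (T : measurableType dT) (R : realType).
Context (d n m : nat) (Pr : probability T R).
Variables (P Q : probability 'rV[R]_d R) (nu : R.-pker 'rV[R]_d ~> R).
Variables (X : 'I_n -> {RV Pr >-> 'rV[R]_d}) (Y : 'I_n -> {RV Pr >-> R}).
Variables (Xs : 'I_m -> {RV Pr >-> 'rV[R]_d}) (Ys : 'I_m -> {RV Pr >-> R}).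

(* (X_i, Y_i), i < n, i.i.d. with law joint_law P nu, and Xs_j, j < m, i.i.d.
   with law Q and independent of the (X_i, Y_i). *)
Definition is_sample :=
  [/\ forall i A, measurable A ->
        Pr [set w | A (X i w, Y i w)] = joint_law P nu A,
      forall j A, measurable A -> Pr [set w | A (Xs j w)] = Q A
    & mutually_independent Pr (fun s : 'I_n + 'I_m =>
        match s with
        | inl i => preimage_set_system setT (fun w => (X i w, Y i w)) measurable
        | inr j => preimage_set_system setT (Xs j) measurable
        end)].

Definition sigma_X : set (set T) := g_sigma_preimage (fun i => X i : T -> _).

Definition sigma_sample : set (set T) :=
  <<s g_sigma_preimage (fun i => X i : T -> _)
      `|` g_sigma_preimage (fun i => Y i : T -> _)
      `|` g_sigma_preimage (fun j => Xs j : T -> _) >>.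

(* Given the sample, the Ys_j are independent and Ys_j has the law
   \sum_i knn_weight(i) \d_(Y_i), which is a probability whenever the distances
   from Xs_j to the X_i are pairwise distinct. *)
Definition resampled_labels (k : nat) :=
  forall B : 'I_m -> set R, (forall j, measurable (B j)) ->
    is_cond_expectation Pr sigma_sample
      (\1_(\bigcap_j (Ys j @^-1` B j)))
      (fun w => \prod_(j < m) \sum_(i < n)
         knn_weight k (X ^~ w) (Xs j w) i * \1_(B j) (Y i w)).

End sampling.

(* Main.v *)
From HB Require Import structures.
Require Import Defs.
From mathcomp Require Import all_boot all_order all_algebra.
From mathcomp Require Import all_classical all_reals all_analysis.
From mathcomp Require Import interval_inference measurable_realfun ring lra zify.

(** Given the covariates [X_1, ..., X_n], labels and query points can be
    integrated out.  Let [H] be the integrand of the estimator: [h] at the query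
    point with the label of a neighbour for the first estimator, [h] at the
    neighbour for the second ([query_integrand], [sample_integrand]).  Let
    [D (x, u)] be its mean over the label attached to [u], so that
    [D (x, x) = g x], and let [F (x, u) = D (x, u) - D (x, x)].  Then the
    conditional bias is almost surely [knn_err Q F k X], the integral over
    query points [x], with respect to [Q], of the average [knn_avg] of
    [F (x, .)] over the [k] nearest neighbours of [x].  This identification
    ([cond_second_moment]) uses the law of the sample ([sample_law],
    [label_law]), the absence of ties ([generic_ae]) and the uniqueness of
    conditional expectations ([cond_expectation_unique]).

    Let [l = (k / (n + 1)) ^ (1 / d)], the order of the distance from a point to
    its neighbours.  By the Efron-Stein inequality ([efron_stein]), the second
    moment of [knn_err] is at most the square of its mean plus the sum over [j]
    of the mean squares of the changes caused by deleting [X_j].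

    The mean is [O(l ^ 2)].  By Chernoff's bound ([few_near_exp]) the
    probability that a sample point at [u] is a neighbour of [x] decays like
    [exp (- a (|u - x| / l) ^ d)], and it depends on [|u - x|] only.  Hence on
    the largest ball around [x] contained in [S] the reflection
    [u |-> 2 x - u] preserves this weight; since [F (x, .)] is twice
    differentiable and vanishes at [x], and the density is Lipschitz, the
    symmetrized integrand is of order [|u - x| ^ 2] and contributes [l ^ 2].
    The complement of the ball costs at most
    [l exp (- a' (dist_compl S x / l) ^ d)] ([knn_bias_at]), whose integral
    over [x] is [O(l ^ 2)] by the assumption on the distance to the complement
    ([boundary_layer]).

    The sum of squares is [O(l ^ (d + 2))].  Deleting [X_j] changes the average
    at [x] only if [X_j] is a neighbour of [x], and then by at most a constant
    times [1 / k] times the radius of the neighbourhood ([knn_avg_diff]).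
    Expanding the squares, only pairs of query points sharing a neighbour
    contribute; these are within twice the larger radius
    ([shared_neighbours]), an event whose [Q]-probability is of the order of
    the power [d] of that radius, so that the moment of order [d + 2] of the
    radius remains, which is [O(l ^ (d + 2))] ([knn_radius_moment]).

    Finally [l ^ 4] and [l ^ (d + 2)] are the powers [4 / d] and [1 + 2 / d] of
    [k / (n + 1)], and the latter exponent is at least [min (4 / d, 3)]
    ([rate_le]). *)

Set Implicit Arguments.
Unset Strict Implicit.
Unset Printing Implicit Defensive.
Import Order.TTheory GRing.Theory Num.Theory.
Import numFieldNormedType.Exports.

Local Open Scope classical_set_scope.
Local Open Scope ring_scope.

(** * Euclidean norm *)

Section enorm.
Context {R : realType} {d : nat}.
Implicit Types (x y v w : 'rV[R]_d).

Lemma enorm_ge0 x : 0 <= enorm x. Proof. exact: sqrtr_ge0. Qed.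

Lemma sumsq_ge0 x : 0 <= \sum_(i < d) x ord0 i ^+ 2.
Proof. by apply: sumr_ge0 => i _; exact: sqr_ge0. Qed.

Lemma enorm_sqr x : enorm x ^+ 2 = \sum_(i < d) x ord0 i ^+ 2.
Proof. by rewrite sqr_sqrtr// sumsq_ge0. Qed.

Lemma enorm0 : enorm (0 : 'rV[R]_d) = 0.
Proof.
by rewrite /enorm big1 ?sqrtr0// => i _; rewrite mxE expr0n.
Qed.

Lemma enormN x : enorm (- x) = enorm x.
Proof. by congr Num.sqrt; apply: eq_bigr => i _; rewrite mxE sqrrN. Qed.

Lemma enormB x y : enorm (x - y) = enorm (y - x).
Proof. by rewrite -opprB enormN. Qed.

Lemma enormZ a x : enorm (a *: x) = `|a| * enorm x.
Proof.
rewrite /enorm -sqrtr_sqr -sqrtrM ?sqr_ge0//; congr Num.sqrt.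
by rewrite mulr_sumr; apply: eq_bigr => i _; rewrite mxE exprMn.
Qed.

Lemma coord_le_enorm x i : `|x ord0 i| <= enorm x.
Proof.
rewrite -sqrtr_sqr ler_sqrt ?sumsq_ge0// (bigD1 i)//= lerDl.
by apply: sumr_ge0 => j _; exact: sqr_ge0.
Qed.

Lemma enorm_le_sum x : enorm x <= \sum_(i < d) `|x ord0 i|.
Proof.
have s0 : 0 <= \sum_(i < d) `|x ord0 i| by apply: sumr_ge0.
rewrite -[leRHS]ger0_norm// -sqrtr_sqr ler_sqrt ?sqr_ge0// expr2 mulr_suml.
apply: ler_sum => i _; rewrite -real_normK ?num_real// expr2 ler_wpM2l//.
by rewrite (bigD1 i)//= lerDl sumr_ge0.
Qed.

Lemma enorm_le_coord x (r : R) : (forall i, `|x ord0 i| <= r) ->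
  enorm x <= d%:R * r.
Proof.
move=> xr; apply: le_trans (enorm_le_sum x) _.
rewrite -[d in leRHS]card_ord mulr_natl -sumr_const.
by apply: ler_sum => i _; exact: xr.
Qed.

(** With [s] the inner product, [a] and [b] the squared norms of [v] and [w],
    the squares of [b v_i - s w_i] sum to [b (b a - s ^ 2)], which is therefore
    nonnegative. *)
Lemma cauchy_schwarz v w :
  `|\sum_(i < d) v ord0 i * w ord0 i| <= enorm v * enorm w.
Proof.
set s := \sum_i _.
rewrite -sqrtrM ?sumsq_ge0// -sqrtr_sqr ler_sqrt; last first.
  by rewrite mulr_ge0 ?sumsq_ge0.
set a := \sum_(i < d) v ord0 i ^+ 2; set b := \sum_(i < d) w ord0 i ^+ 2.
have b0 : 0 <= b by exact: sumsq_ge0.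
have H : 0 <= b * (b * a - s ^+ 2).
  have -> : b * (b * a - s ^+ 2) =
     \sum_(i < d) (b * v ord0 i - s * w ord0 i) ^+ 2.
    under eq_bigr do rewrite sqrrB !exprMn.
    rewrite big_split sumrB/= -!mulr_sumr -/a -/b.
    rewrite (_ : \sum_(i < d) (b * v ord0 i * (s * w ord0 i) *+ 2) =
       b * s * s *+ 2); first by ring.
    rewrite sumrMnl; congr (_ *+ 2); rewrite /s mulr_sumr.
    by apply: eq_bigr => i _; rewrite mulrACA.
  by apply: sumr_ge0 => i _; exact: sqr_ge0.
have [b00|bn0] := eqVneq b 0.
  have w0 i : w ord0 i = 0.
    apply/eqP; rewrite -sqrf_eq0; apply/eqP.
    by move/eqP: b00; rewrite psumr_eq0 => [/allP/(_ i)|j _];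
      [rewrite mem_index_enum => /(_ isT)/eqP|exact: sqr_ge0].
  by rewrite /s big1 ?expr0n ?mulr_ge0 ?sumsq_ge0// => i _; rewrite w0 mulr0.
have bp : 0 < b by rewrite lt_neqAle eq_sym bn0.
by move: H; rewrite pmulr_rge0// subr_ge0 mulrC.
Qed.

Lemma enormD v w : enorm (v + w) <= enorm v + enorm w.
Proof.
rewrite -(@ler_pXn2r _ 2)// ?nnegrE ?addr_ge0 ?enorm_ge0//.
rewrite enorm_sqr sqrrD !enorm_sqr.
under eq_bigr do rewrite mxE sqrrD.
rewrite !big_split/= lerD2r lerD2l -mulr2n lerMn2r/=.
exact: le_trans (ler_norm _) (cauchy_schwarz v w).
Qed.

Lemma enorm_triangle x y z : enorm (x - z) <= enorm (x - y) + enorm (y - z).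
Proof. by rewrite -[x - z](subrKA y) enormD. Qed.

Lemma measurable_enorm : measurable_fun [set: 'rV[R]_d] (@enorm R d).
Proof.
have ms : measurable_fun [set: R] (@Num.sqrt R).
  by apply: continuous_measurable_fun; exact: sqrt_continuous.
apply: measurableT_comp ms _.
apply: measurable_sum => i; apply: measurable_funX.
exact: measurable_coor.
Qed.

Lemma measurable_rVB d1 (T : measurableType d1) (f g : T -> 'rV[R]_d) :
  measurable_fun [set: T] f -> measurable_fun [set: T] g ->
  measurable_fun [set: T] (fun t => f t - g t).
Proof.
move=> mf mg; apply: measurable_fun_rV => i.
under eq_fun do rewrite !mxE.
by apply: measurable_funB; exact: measurableT_comp (measurable_coor i) _.
Qed.

Lemma measurable_edist d1 (T : measurableType d1) (f g : T -> 'rV[R]_d) :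
  measurable_fun [set: T] f -> measurable_fun [set: T] g ->
  measurable_fun [set: T] (fun t => enorm (f t - g t)).
Proof.
by move=> mf mg; apply: measurableT_comp measurable_enorm _; exact: measurable_rVB.
Qed.

Lemma measurable_ecball x (r : R) : measurable (ecball x r).
Proof.
rewrite -[ecball x r]setTI.
have /(_ measurableT `]-oo, r]%classic (measurable_itv _)) :=
  measurable_edist (@measurable_id _ _ setT) (measurable_cst x).
by congr (measurable (_ `&` _)); apply/seteqP; split => y/=; rewrite /ecball/= in_itv.
Qed.

End enorm.

(** * Rectangles and the geometry of Lebesgue measure *)

Section rectangles.
Context d (E : measurableType d) (T : pointedType) n (f : 'I_n -> T -> E).

Definition rectangle (A : 'I_n -> set E) : set T :=
  [set t | forall i, A i (f i t)].

Definition rectangles : set (set T) :=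
  [set rectangle A | A in [set A | forall i, measurable (A i)]].

Lemma g_sigma_preimage_rectangles : g_sigma_preimage f = <<s rectangles >>.
Proof.
apply/seteqP; split.
- apply: smallest_sub; first exact: smallest_sigma_algebra.
  move=> A; elim/big_ind : _ => // [A1 A2 h1 h2 [/h1|/h2]//|i _ [B mB <-]].
  apply: sub_sigma_algebra.
  exists (fun j => if j == i then B else setT).
    by move=> j /=; case: ifP.
  rewrite setTI; apply/seteqP; split => t /=.
    by move=> /(_ i) /=; rewrite eqxx.
  by move=> Bt j /=; case: eqP => [->|].
- apply: smallest_sub; first exact: smallest_sigma_algebra.
  move=> _ [A mA <-].
  rewrite (_ : rectangle A = \bigcap_(i in [set: 'I_n]) (f i @^-1` A i)); last first.
    by apply/seteqP; split => t /= h i; [move=> _|]; exact: h.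
  have H : @sigma_algebra T setT (g_sigma_preimage f).
    exact: smallest_sigma_algebra.
  have K i : g_sigma_preimage f (f i @^-1` A i).
    apply: sub_sigma_algebra; rewrite (bigD1 i)//=; left.
    by exists (A i) => //; rewrite setTI.
  have mT : (@measurable _ (g_sigma_algebraType (\big[setU/set0]_(i < n)
      preimage_set_system setT (f i) measurable))) (\bigcap_(i in [set: 'I_n]) (f i @^-1` A i)).
    by apply: fin_bigcap_measurable => // i _; exact: K.
  exact: mT.
Qed.

Lemma rectangles_setI : setI_closed rectangles.
Proof.
move=> _ _ [A mA <-] [B mB <-]; exists (fun i => A i `&` B i).
  by move=> i; apply: measurableI; [exact: mA|exact: mB].
apply/seteqP; split => t /=.
  by move=> h; split => i; case: (h i).
by move=> [hA hB] i; split; [exact: hA|exact: hB].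
Qed.

Lemma rectangles_setT : rectangles setT.
Proof. by exists (fun=> setT) => //; apply/seteqP; split. Qed.

End rectangles.

Section lebesgue_rV_geometry.
Context {R : realType}.
Local Notation leb d := (lebesgue_rV R d).

Let coor d (i : 'I_d) (x : 'rV[R]_d) : R := x ord0 i.

Lemma measurable_rV_box d (A : 'I_d -> set R) : (forall i, measurable (A i)) ->
  measurable (rectangle (@coor d) A).
Proof.
move=> mA; have /seteqP[_] := g_sigma_preimage_rectangles (@coor d).
by apply; apply: sub_sigma_algebra; exists A.
Qed.

Lemma rV_measure_unique d (m : {measure set 'rV[R]_d -> \bar R}) :
  (forall A : 'I_d -> set R, (forall i, measurable (A i)) ->
     m [set x | forall i, A i (x ord0 i)] =
     (\prod_(i < d) lebesgue_measure (A i))%E) ->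
  forall A, measurable A -> leb d A = m A.
Proof.
move=> mE A mA.
apply: (@measure_unique _ R _ (rectangles (@coor d))
  (fun k => rectangle (@coor d) (fun=> `[- k%:R, k%:R]%classic))) => //.
- exact: g_sigma_preimage_rectangles.
- exact: rectangles_setI.
- by move=> k; exists (fun=> `[- k%:R, k%:R]%classic).
- apply/seteqP; split => // x _.
  exists (Num.bound (enorm x)) => // i.
  rewrite /coor/= in_itv/= -ler_norml.
  apply: le_trans (coord_le_enorm x i) _.
  exact/ltW/archi_boundP/enorm_ge0.
- by move=> _ [B mB <-]; rewrite mE//; exact: lebesgue_rV_box.
- move=> k; rewrite [X in (X < _)%E](lebesgue_rV_box (fun=> measurable_itv _)).
  rewrite big_const; set c := lebesgue_measure _.
  have cfin : c \is a fin_num.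
    by rewrite /c lebesgue_measure_itv/=; case: ifP.
  elim: #|_| => [|j ih] /=; first by rewrite ltry.
  by apply: lte_mul_pinfty; rewrite ?measure_ge0.
Qed.

Lemma lebesgue_ecball_le d (x : 'rV[R]_d) (r : R) : 0 <= r ->
  (leb d (ecball x r) <= ((2 * r) ^+ d)%:E)%E.
Proof.
move=> r0.
have mB : forall i : 'I_d, measurable `[x ord0 i - r, x ord0 i + r]%classic by [].
apply: (@le_trans _ _ (leb d (rectangle (@coor d)
   (fun i => `[x ord0 i - r, x ord0 i + r]%classic)))).
  apply: le_measure; rewrite ?inE; first exact: measurable_ecball.
    exact: measurable_rV_box.
  move=> y yr i /=; rewrite in_itv/= /coor.
  have := le_trans (coord_le_enorm (y - x) i) yr.
  by rewrite !mxE ler_norml => /andP[? ?]; apply/andP; split; lra.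
rewrite lebesgue_rV_box//.
rewrite (eq_bigr (fun=> (2 * r)%:E)).
  by rewrite prodEFin big_const_ord iter_mulr_1.
move=> i _; rewrite lebesgue_measure_itv/= lte_fin.
have [|] := ltP (x ord0 i - r) (x ord0 i + r).
  by rewrite -EFinB => _; congr EFin; ring.
by move=> ?; congr EFin; lra.
Qed.

(** The cube of half-side [r / d] is inscribed in the ball: a coarse bound, but
    only the order [r ^ d] matters. *)
Lemma lebesgue_ecball_ge d (x : 'rV[R]_d) (r : R) : (0 < d)%N -> 0 <= r ->
  (((2 * (r / d%:R)) ^+ d)%:E <= leb d (ecball x r))%E.
Proof.
move=> d0 r0; set s := r / d%:R.
have s0 : 0 <= s by rewrite divr_ge0.
have mB : forall i : 'I_d, measurable `[x ord0 i - s, x ord0 i + s]%classic by [].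
apply: (@le_trans _ _ (leb d (rectangle (@coor d)
   (fun i => `[x ord0 i - s, x ord0 i + s]%classic)))); last first.
  apply: le_measure; rewrite ?inE; last 2 first.
  - exact: measurable_ecball.
  - move=> y ys; rewrite /ecball/=.
    apply: (@le_trans _ _ (d%:R * s)); last first.
      by rewrite /s mulrC divfK// pnatr_eq0 -lt0n.
    apply: enorm_le_coord => i; have := ys i; rewrite /coor/= in_itv/= !mxE.
    by move=> /andP[? ?]; rewrite ler_norml; apply/andP; split; lra.
  exact: measurable_rV_box.
rewrite lebesgue_rV_box//.
rewrite (eq_bigr (fun=> (2 * s)%:E)).
  by rewrite prodEFin big_const_ord iter_mulr_1.
move=> i _; rewrite lebesgue_measure_itv/= lte_fin.
have [|] := ltP (x ord0 i - s) (x ord0 i + s).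
  by rewrite -EFinB => _; congr EFin; ring.
by move=> ?; congr EFin; lra.
Qed.

(** Points of a sphere with all coordinates but the first prescribed are at
    most two, so that Fubini's theorem applies. *)
Lemma lebesgue_sphere d (x : 'rV[R]_d) (r : R) : (0 < d)%N ->
  leb d [set y | enorm (y - x) = r] = 0%E.
Proof.
case: d x => // d x _; rewrite /= /lebesgue_step /pushforward.
set A := _ @^-1` _.
have mA : measurable A.
  rewrite -[A]setTI; apply: measurable_rV_cons => //.
  rewrite -[X in measurable X]setTI.
  by have := measurable_edist (@measurable_id _ _ setT) (measurable_cst x)
    measurableT (measurable_set1 r).
rewrite (@product_measure_unique _ _ _ _ _ _ _ (lebesgue_measure \x^ leb d)%E)//; last first.
  by move=> B C mB mC; exact: product_measure2E.
rewrite /product_measure2; apply: integral0_eq => v _ /=.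
pose c := \sum_(i < d) (v ord0 i - x ord0 (lift ord0 i)) ^+ 2.
pose a := Num.sqrt (r ^+ 2 - c).
apply: (@subset_measure0 _ _ _ (@lebesgue_measure R) (ysection A v)
  ([set x ord0 ord0 + a; x ord0 ord0 - a] : set (measurableTypeR R))).
- exact: measurable_ysection.
- by apply: measurableU; exact: measurable_set1.
- move=> t; rewrite /ysection/= inE /A/= => tr.
  have : (t - x ord0 ord0) ^+ 2 = a ^+ 2.
    have := enorm_sqr (rV_cons (t, v) - x); rewrite tr big_ord_recl.
    rewrite !mxE unlift_none/=.
    rewrite (eq_bigr (fun i => (v ord0 i - x ord0 (lift ord0 i)) ^+ 2)); last first.
      by move=> i _; rewrite !mxE liftK.
    rewrite -/c => e; have : (t - x ord0 ord0) ^+ 2 = r ^+ 2 - c by rewrite e addrK.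
    by move=> e'; rewrite /a sqr_sqrtr// -e'; exact: sqr_ge0.
  move/eqP; rewrite eqf_sqr => /orP[] /eqP e; [left|right];
    by rewrite /= -e; ring.
- have := @countable_lebesgue_measure0 R [set x ord0 ord0 + a; x ord0 ord0 - a].
  by apply; apply: finite_set_countable; exact: finite_set2.
Qed.

(** A reflection acts coordinatewise, which reduces the claim to intervals. *)
Lemma lebesgue_rV_reflection d (x : 'rV[R]_d) (A : set 'rV[R]_d) :
  measurable A ->
  leb d ((fun u => x - u) @^-1` A) = leb d A.
Proof.
move=> mA.
have mf : measurable_fun [set: 'rV[R]_d] (fun u => x - u).
  exact: measurable_rVB.
rewrite [RHS](@rV_measure_unique d
  (pushforward (leb d) (mfun_Sub (mem_set mf))))// => B mB.
transitivity (leb d [set u | forall i, [set t | B i (x ord0 i - t)] (u ord0 i)]).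
  congr (leb d _); apply/seteqP.
  by split => u /= h i; have := h i; rewrite !mxE.
have H i : measurable [set t | B i (x ord0 i - t)] /\
    lebesgue_measure [set t | B i (x ord0 i - t)] = lebesgue_measure (B i).
  have mg : measurable_fun [set: R] (fun t => x ord0 i - t) by exact: measurable_funB.
  split; first by rewrite -[X in measurable X]setTI; exact: mg.
  have mg' : measurable_fun [set: measurableTypeR R]
      (fun t : measurableTypeR R => x ord0 i - t : measurableTypeR R) by [].
  pose phi : {mfun (measurableTypeR R) >-> (measurableTypeR R)} :=
    @mfun_Sub _ _ (measurableTypeR R) (measurableTypeR R) _ (mem_set mg').
  have /(_ mg') phiU := @lebesgue_measure_unique R
    (pushforward lebesgue_measure phi).
  apply/esym; apply: (phiU _ (B i) (mB i)) => _ [[a b]] _ <-.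
  transitivity (lebesgue_measure `[x ord0 i - b, x ord0 i - a[%classic).
    rewrite !lebesgue_measure_itv/= !lte_fin ltrD2l ltrN2; case: ifP => // _.
    by rewrite -!EFinB; congr EFin; ring.
  congr lebesgue_measure; apply/seteqP; split => t /=; rewrite !in_itv/=.
    by move=> /andP[? ?]; apply/andP; split; lra.
  by move=> /andP[? ?]; apply/andP; split; lra.
have mB' i : measurable [set t | B i (x ord0 i - t)] by case: (H i).
by rewrite [LHS](lebesgue_rV_box mB'); apply: eq_bigr => i _; case: (H i).
Qed.

Lemma integral_reflection d (x : 'rV[R]_d) (f : 'rV[R]_d -> \bar R) :
  (leb d).-integrable [set: 'rV[R]_d] f ->
  (\int[leb d]_u f u = \int[leb d]_u f (x - u)%R)%E.
Proof.
move=> intf.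
have mr : measurable_fun [set: 'rV[R]_d] (fun u => x - u).
  exact: measurable_rVB.
pose phi : {mfun 'rV[R]_d >-> 'rV[R]_d} := mfun_Sub (mem_set mr).
have E A : measurable A -> A `<=` setT -> leb d A = pushforward (leb d) phi A.
  by move=> mA _; rewrite /pushforward [RHS]lebesgue_rV_reflection.
rewrite (eq_measure_integral _ E) integral_pushforward//.
  exact: measurable_int intf.
have /integrableP[mf foo] := intf.
apply/integrableP; split; first exact: (measurableT_comp mf).
apply: le_lt_trans foo; rewrite [leRHS](eq_measure_integral _ E).
rewrite ge0_integral_pushforward//; exact: measurableT_comp.
Qed.

End lebesgue_rV_geometry.

(** * Powers against stretched exponentials *)

Section exponential_bounds.
Context {R : realType}.

(** Raise [b z <= exp (b z)], with [b = c / (j + 1)], to the power [j]. *)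
Lemma pow_le_expR (c : R) j : 0 < c ->
  exists2 C : R, 0 < C & forall z, 0 <= z -> z ^+ j <= C * expR (c * z).
Proof.
move=> c0; set b := c / j.+1%:R.
have b0 : 0 < b by rewrite divr_gt0.
exists (b^-1 ^+ j) => [|z z0]; first by rewrite exprn_gt0// invr_gt0.
have bz : b * z <= expR (b * z).
  by apply: le_trans (expR_ge1Dx _); rewrite lerDr.
have : (b * z) ^+ j <= expR (c * z).
  apply: (@le_trans _ _ (expR (b * z) ^+ j)).
    by rewrite lerXn2r// nnegrE ?expR_ge0// mulr_ge0// ltW.
  rewrite -expRM_natl ler_expR mulrA ler_wpM2r// /b mulrCA -[leRHS]mulr1.
  by rewrite ler_wpM2l ?(ltW c0)// ler_pdivrMr// mul1r ler_nat.
move=> h; rewrite -(@ler_pM2l _ (b ^+ j)) ?exprn_gt0// -exprMn.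
by rewrite mulrA -exprMn divff ?gt_eqF// expr1n mul1r.
Qed.

Lemma le1DX (z : R) d : (0 < d)%N -> 0 <= z -> z <= 1 + z ^+ d.
Proof.
move=> d0 z0; have [z1|z1] := leP z 1.
  by rewrite (le_trans z1)// lerDl exprn_ge0.
apply: (@le_trans _ _ (z ^+ d)); last by rewrite lerDr.
by rewrite -[leLHS]expr1 ler_weXn2l// ltW.
Qed.

(** [z <= 1 + z ^ d] turns a bound in [z] into one in [z ^ d]. *)
Lemma pow_le_expR_pow (a : R) j d : 0 < a -> (0 < d)%N ->
  exists2 C : R, 0 < C & forall z, 0 <= z -> z ^+ j <= C * expR (a * z ^+ d).
Proof.
move=> a0 d0; have [C C0 CP] := pow_le_expR j a0.
exists (C * expR a) => [|z z0]; first by rewrite mulr_gt0// expR_gt0.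
apply: (@le_trans _ _ ((1 + z ^+ d) ^+ j)).
  by rewrite lerXn2r ?nnegrE ?addr_ge0 ?exprn_ge0// le1DX.
apply: le_trans (CP _ _) _; first by rewrite addr_ge0 ?exprn_ge0.
by rewrite -mulrA -expRD mulrDr mulr1.
Qed.

Lemma geometric_nneseries_le (q C : R) : 0 <= q -> q < 1 -> 0 <= C ->
  (\sum_(k <oo) (C * q ^+ k)%:E <= (C / (1 - q))%:E)%E.
Proof.
move=> q0 q1 C0; apply: lime_le.
  by apply: is_cvg_nneseries => k _ _; rewrite lee_fin mulr_ge0// exprn_ge0.
apply: nearW => N; rewrite sumEFin lee_fin -mulr_sumr ler_wpM2l//.
rewrite -[leRHS]mul1r ler_pdivlMr ?subr_gt0//.
rewrite (_ : _ * _ = 1 - q ^+ N); first by rewrite gerBl exprn_ge0.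
elim: N => [|N ih]; first by rewrite big_geq// mul0r expr0 subrr.
by rewrite big_nat_recr//= mulrDl ih exprS; ring.
Qed.

End exponential_bounds.

Section exponential_integral.
Context {R : realType} (d : nat) (d0 : (0 < d)%N).
Local Notation leb := (lebesgue_rV R d).

Lemma measurable_exp_dist (a : R) (l : R) (x : 'rV[R]_d) :
  measurable_fun [set: 'rV[R]_d]
    (fun u => expR (- (a * (enorm (u - x) / l) ^+ d))).
Proof.
apply: measurableT_comp => //; apply: measurableT_comp => //.
apply: measurable_funM => //; apply: measurable_funX.
by apply: measurable_funM => //; exact: measurable_edist.
Qed.

(** Layer-cake bound: on the shell where the exponent lies in [[k, k+1[] the
    integrand is at most [exp (- k)], and the shell sits in a ball of radius
    [O(l (k + 1))]. *)
Lemma integral_exp_dist_le (a : R) : 0 < a ->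
  exists2 C : R, 0 < C & forall (l : R) (x : 'rV[R]_d), 0 < l ->
    (\int[leb]_u (expR (- (a * (enorm (u - x) / l) ^+ d)))%:E
      <= (C * l ^+ d)%:E)%E.
Proof.
move=> a0.
(* the [k]-th shell sits in a ball of volume at most [(A l (k + 1)) ^ d], and
   half of the exponential absorbs the power of [k + 1] *)
pose A : R := 2 * (1 + a^-1).
have A0 : 0 < A by rewrite mulr_gt0// addr_gt0// invr_gt0.
have [C C0 CP] := @pow_le_expR R (2^-1) d ltac:(by []).
pose q : R := expR (- 2^-1).
have q1 : q < 1 by rewrite expR_lt1 oppr_lt0 invr_gt0.
pose K : R := A ^+ d * C * expR (2^-1).
have K0 : 0 < K by rewrite !mulr_gt0 ?exprn_gt0 ?expR_gt0.
exists (K / (1 - q)) => [|l x l0]; first by rewrite divr_gt0// subr_gt0.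
pose rho (k : nat) : R := l * (1 + k.+1%:R / a).
have rho0 k : 0 <= rho k.
  by rewrite mulr_ge0 ?ltW// addr_gt0// divr_gt0.
pose f (k : nat) (u : 'rV[R]_d) : \bar R :=
  ((expR (- k%:R))%:E * (\1_(ecball x (rho k)) u)%:E)%E.
have f0 k u : (0 <= f k u)%E by rewrite mule_ge0 ?lee_fin ?expR_ge0.
have mf k : measurable_fun [set: 'rV[R]_d] (f k).
  apply: emeasurable_funM => //; apply/measurable_EFinP.
  by apply: measurable_indic; exact: measurable_ecball.
apply: (@le_trans _ _ (\int[leb]_u (\sum_(k <oo) f k u))%E).
  apply: ge0_le_integral => //.
  - apply/measurable_EFinP; exact: measurable_exp_dist.
  - exact: ge0_emeasurable_sum.
  move=> u _; set z := enorm (u - x) / l.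
  have z0 : 0 <= z by rewrite divr_ge0 ?enorm_ge0 ?ltW.
  have y0 : 0 <= a * z ^+ d by rewrite mulr_ge0 ?exprn_ge0// ltW.
  pose k := Num.truncn (a * z ^+ d).
  have /andP[k1 k2] := truncn_itv y0.
  apply: (@le_trans _ _ (f k u)).
    rewrite /f indicE mem_set ?mule1 ?lee_fin ?ler_expR ?lerN2//.
    rewrite /ecball/= -ler_pdivrMl// mulrC -/z.
    apply: le_trans (le1DX d0 z0) _; rewrite lerD2l ler_pdivlMr// mulrC.
    exact: ltW.
  rewrite (@nneseriesD1 _ (fun j => f j u) k xpredT)//.
  by rewrite leeDl//; apply: nneseries_ge0 => *; exact: f0.
rewrite integral_nneseries//.
apply: le_trans (_ : (\sum_(k <oo) (K * l ^+ d * q ^+ k)%:E <= _)%E); last first.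
  rewrite [leRHS](_ : _ = (K * l ^+ d / (1 - q))%:E); last by congr EFin; ring.
  by apply: geometric_nneseries_le => //; [exact: expR_ge0|rewrite mulr_ge0 ?exprn_ge0 ?ltW].
apply: lee_nneseries; first by move=> *; apply: integral_ge0 => u _; exact: f0.
move=> k _.
rewrite /f ge0_integralZl ?lee_fin ?expR_ge0//; last first.
  apply/measurable_EFinP.
  by apply: measurable_indic; exact: measurable_ecball.
rewrite integral_indic ?setIT; [|by []|exact: measurable_ecball].
apply: (@le_trans _ _ ((expR (- k%:R))%:E * ((2 * rho k) ^+ d)%:E)%E).
  by rewrite lee_wpmul2l ?lee_fin ?expR_ge0//; exact: lebesgue_ecball_le.
rewrite -EFinM lee_fin.
have -> : q ^+ k = expR (- k%:R) * expR (k%:R / 2).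
  by rewrite /q -expRM_natl -expRD; congr expR; lra.
rewrite [leRHS]mulrC -mulrA ler_wpM2l ?expR_ge0//.
have h1 : (2 * rho k) ^+ d <= l ^+ d * (A ^+ d * k.+1%:R ^+ d).
  have r2 : 0 <= 2 * rho k by rewrite mulr_ge0.
  have lA : 0 <= l * (A * k.+1%:R).
    by apply: mulr_ge0; [exact: ltW|apply: mulr_ge0 => //; exact: ltW].
  rewrite -!exprMn lerXn2r ?nnegrE//.
  rewrite /rho [leLHS]mulrCA ler_wpM2l ?(ltW l0)//.
  rewrite /A -mulrA ler_wpM2l//.
  rewrite mulrDl mul1r [k.+1%:R / a]mulrC lerD2r.
  by rewrite ler1n.
apply: (le_trans h1).
have := CP k.+1%:R (ler0n _ _) => h2.
have -> : expR (k%:R / 2) * (K * l ^+ d) = l ^+ d * (A ^+ d * (C * expR (2^-1 * k.+1%:R))).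
  have -> : 2^-1 * k.+1%:R = k%:R / 2 + 2^-1 :> R.
    by rewrite -[k.+1%:R]natr1 mulrDr mulr1 mulrC.
  by rewrite expRD /K; ring.
rewrite ler_wpM2l ?exprn_ge0 ?(ltW l0)//.
by rewrite ler_wpM2l ?exprn_ge0 ?(ltW A0).
Qed.

(** Half of the exponential absorbs the power [j] of the distance. *)
Lemma integral_pow_exp_dist_le (a : R) j : 0 < a ->
  exists2 C : R, 0 < C & forall (l : R) (x : 'rV[R]_d), 0 < l ->
    (\int[leb]_u (enorm (u - x) ^+ j *
       expR (- (a * (enorm (u - x) / l) ^+ d)))%:E
      <= (C * l ^+ (j + d))%:E)%E.
Proof.
move=> a0; have a20 : 0 < a / 2 by rewrite divr_gt0.
have [C C0 CP] := pow_le_expR_pow j a20 d0.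
have [C' C'0 C'P] := integral_exp_dist_le a20.
exists (C * C') => [|l x l0]; first by rewrite mulr_gt0.
have -> : (C * C' * l ^+ (j + d))%:E = ((C * l ^+ j)%:E * (C' * l ^+ d)%:E)%E.
  by rewrite -EFinM exprD; congr EFin; ring.
apply: le_trans (lee_wpmul2l _ (C'P l x l0)); last first.
  by rewrite lee_fin mulr_ge0 ?exprn_ge0 ?ltW.
rewrite -ge0_integralZl//; last 2 first.
- apply/measurable_EFinP; exact: measurable_exp_dist.
- by rewrite lee_fin mulr_ge0 ?exprn_ge0 ?ltW.
apply: ge0_le_integral => //.
- by move=> u _; rewrite lee_fin mulr_ge0 ?exprn_ge0 ?expR_ge0 ?enorm_ge0.
- apply/measurable_EFinP/measurable_funM; last exact: measurable_exp_dist.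
  by apply: measurable_funX; exact: measurable_edist.
- by apply: emeasurable_funM => //; apply/measurable_EFinP; exact: measurable_exp_dist.
move=> u _; rewrite -EFinM lee_fin; set r := enorm _.
set z := r / l; have z0 : 0 <= z by rewrite divr_ge0 ?enorm_ge0 ?ltW.
set e := a / 2 * z ^+ d.
have -> : a * z ^+ d = e + e by rewrite /e; lra.
have -> : r = l * z by rewrite /z mulrC divfK// gt_eqF.
rewrite opprD expRD exprMn [C * _]mulrC mulrA ler_wpM2r ?expR_ge0//.
rewrite -mulrA ler_wpM2l ?exprn_ge0 ?(ltW l0)//.
rewrite expRN ler_pdivrMr ?expR_gt0//; exact: CP.
Qed.

End exponential_integral.

(** * Bounded measurable functions *)

Section bounded_measurable.
Context {R : realType}.

Definition bmeas d (T : measurableType d) (f : T -> R) :=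
  measurable_fun [set: T] f /\ exists M, forall x, `|f x| <= M.

Section closure.
Context d (T : measurableType d).
Implicit Types f g : T -> R.

Lemma bmeas_cst c : bmeas (fun _ : T => c).
Proof. by split => //; exists `|c|. Qed.

Lemma bmeasD f g : bmeas f -> bmeas g -> bmeas (fun x => f x + g x).
Proof.
move=> [mf [M fM]] [mg [N gN]]; split; first exact: measurable_funD.
by exists (M + N) => x; rewrite (le_trans (ler_normD _ _))// lerD.
Qed.

Lemma bmeasM f g : bmeas f -> bmeas g -> bmeas (fun x => f x * g x).
Proof.
move=> [mf [M fM]] [mg [N gN]]; split; first exact: measurable_funM.
by exists (M * N) => x; rewrite normrM ler_pM.
Qed.

Lemma bmeasZ c f : bmeas f -> bmeas (fun x => c * f x).
Proof. by move=> bf; apply: bmeasM => //; exact: bmeas_cst. Qed.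

Lemma bmeasB f g : bmeas f -> bmeas g -> bmeas (fun x => f x - g x).
Proof.
move=> bf bg; have := bmeasD bf (bmeasZ (- 1) bg).
by under eq_fun do rewrite mulN1r.
Qed.

Lemma bmeasX f k : bmeas f -> bmeas (fun x => f x ^+ k).
Proof.
move=> bf; elim: k => [|k ih]; first exact: (bmeas_cst 1).
by under eq_fun do rewrite exprS; exact: bmeasM.
Qed.

Lemma bmeas_sum I (s : seq I) (P : pred I) (f : I -> T -> R) :
  (forall i, bmeas (f i)) -> bmeas (fun x => \sum_(i <- s | P i) f i x).
Proof.
move=> bf; elim: s => [|a s ih].
  by under eq_fun do rewrite big_nil; exact: bmeas_cst.
under eq_fun do rewrite big_cons.
by case: (P a) => //; exact: bmeasD.
Qed.

Lemma bmeas_comp d' (T' : measurableType d') (phi : T' -> T) f :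
  measurable_fun [set: T'] phi -> bmeas f -> bmeas (f \o phi).
Proof.
move=> mphi [mf [M fM]]; split; first exact: measurableT_comp.
by exists M => x; exact: fM.
Qed.

Lemma bmeas_bool (b : T -> bool) : measurable_fun [set: T] b ->
  bmeas (fun x => (b x)%:R).
Proof.
move=> mb; split; last by exists 1 => x; case: (b x); rewrite ?normr1 ?normr0.
by apply: (@measurableT_comp _ _ _ _ _ _ (fun b : bool => b%:R : R)).
Qed.

Lemma bmeas_indic (A : set T) : measurable A -> bmeas (\1_A : T -> R).
Proof.
move=> mA; split; first exact: measurable_indic.
by exists 1 => x; rewrite indicE; case: (_ \in _); rewrite ?normr1 ?normr0.
Qed.

Lemma bmeas_integrable (P : probability T R) f : bmeas f ->
  P.-integrable [set: T] (EFin \o f).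
Proof.
move=> [mf [M fM]]; apply: measurable_bounded_integrable => //.
  exact: le_lt_trans (probability_le1 P measurableT) (ltry _).
exists M; split; first exact: num_real.
by move=> N MN x _; exact: le_trans (fM x) (ltW MN).
Qed.

Lemma bmeas_EFin (P : probability T R) f : bmeas f ->
  (\int[P]_x f x)%:E = (\int[P]_x (f x)%:E)%E.
Proof.
by move=> bf; rewrite fineK//; apply: integrable_fin_num => //; exact: bmeas_integrable.
Qed.

Lemma Rintegral_probability_cst (P : probability T R) (c : R) : \int[P]_x c = c.
Proof. by rewrite Rintegral_cst// [X in fine X](@probability_setT _ _ _ _) mulr1. Qed.

Lemma bmeas_le_cst (P : probability T R) f c : bmeas f ->
  (forall x, `|f x| <= c) -> `|\int[P]_x f x| <= c.
Proof.
move=> bf fc; apply: le_trans (le_normr_Rintegral _ (bmeas_integrable P bf)) _ => //.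
rewrite -[leRHS](Rintegral_probability_cst P); apply: le_Rintegral => //.
  have -> : EFin \o (fun x => `|f x|) = abse \o (EFin \o f) by [].
  exact/integrable_abse/bmeas_integrable.
exact: bmeas_integrable (bmeas_cst c).
Qed.

End closure.

Lemma bmeas_slice1 d1 d2 (T1 : measurableType d1) (T2 : measurableType d2)
  (f : T1 * T2 -> R) x : bmeas f -> bmeas (fun y => f (x, y)).
Proof. by move=> bf; apply: (bmeas_comp _ bf); exact: measurable_pair1. Qed.

Lemma bmeas_slice2 d1 d2 (T1 : measurableType d1) (T2 : measurableType d2)
  (f : T1 * T2 -> R) y : bmeas f -> bmeas (fun x => f (x, y)).
Proof. by move=> bf; apply: (bmeas_comp _ bf); exact: measurable_pair2. Qed.

Lemma bmeas_swap d1 d2 (T1 : measurableType d1) (T2 : measurableType d2)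
  (f : T1 * T2 -> R) : bmeas f -> bmeas (fun z => f (z.2, z.1)).
Proof.
by move=> bf; apply: (bmeas_comp _ bf); exact: measurable_fun_pair.
Qed.

Lemma bmeas_fubini d1 d2 (T1 : measurableType d1) (T2 : measurableType d2)
    (P : probability T2 R) (f : T1 * T2 -> R) :
  bmeas f -> bmeas (fun x => \int[P]_y f (x, y)).
Proof.
move=> bf; have bfx x := bmeas_slice1 x bf.
split; last first.
  have [_ [M fM]] := bf; exists M => x.
  by apply: bmeas_le_cst => // y; exact: fM.
apply/measurable_EFinP.
have := @measurable_fubini_F _ _ _ _ _ (dirac point : probability T1 R) P
  (EFin \o f) (bmeas_integrable ((dirac point : probability T1 R) \x P)%E bf).
rewrite /fubini_F; congr (measurable_fun _ _).
by apply/funext => x /=; rewrite bmeas_EFin.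
Qed.

Lemma Rintegral_fubini d1 d2 (T1 : measurableType d1) (T2 : measurableType d2)
    (P1 : probability T1 R) (P2 : probability T2 R) (f : T1 * T2 -> R) :
  bmeas f ->
  \int[P1]_x \int[P2]_y f (x, y) = \int[P2]_y \int[P1]_x f (x, y).
Proof.
move=> bf; have bfx x := bmeas_slice1 x bf; have bfy y := bmeas_slice2 y bf.
congr fine.
under eq_integral do rewrite bmeas_EFin//.
under [RHS]eq_integral do rewrite bmeas_EFin//.
exact: (@Fubini _ _ _ _ _ P1 P2 (EFin \o f) (bmeas_integrable (P1 \x P2)%E bf)).
Qed.

(** The left side minus the right side is minus the square of the difference
    between the mean of [f] and [c]. *)
Lemma second_moment_le d (T : measurableType d) (P : probability T R)
    (f : T -> R) c : bmeas f ->
  \int[P]_x (f x ^+ 2) <= (\int[P]_x f x) ^+ 2 + \int[P]_x ((f x - c) ^+ 2).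
Proof.
move=> bf; have bI g : bmeas g -> P.-integrable setT (EFin \o g).
  exact: bmeas_integrable.
set m := \int[P]_x f x.
have -> : \int[P]_x ((f x - c) ^+ 2) =
    \int[P]_x (f x ^+ 2) + (- 2 * c) * m + c ^+ 2.
  have E x : (f x - c) ^+ 2 = f x ^+ 2 + (- 2 * c) * f x + c ^+ 2 by ring.
  under eq_Rintegral do rewrite E.
  rewrite RintegralD//; last 2 first.
  - by apply: bI; apply: bmeasD; [exact: bmeasX|exact: bmeasZ].
  - by apply: (bI (fun=> c ^+ 2)); exact: bmeas_cst.
  rewrite RintegralD//; last 2 first.
  - by apply: bI; exact: bmeasX.
  - by apply: bI; exact: bmeasZ.
  rewrite RintegralZl//; last exact: bI.
  by rewrite Rintegral_probability_cst.
have : 0 <= (m - c) ^+ 2 by exact: sqr_ge0.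
by rewrite sqrrB; lra.
Qed.

Lemma sqr_Rintegral_le d (T : measurableType d) (P : probability T R)
    (f : T -> R) : bmeas f ->
  (\int[P]_x f x) ^+ 2 <= \int[P]_x (f x ^+ 2).
Proof.
move=> bf; have bI g : bmeas g -> P.-integrable setT (EFin \o g).
  exact: bmeas_integrable.
set m := \int[P]_x f x.
have : 0 <= \int[P]_x ((f x - m) ^+ 2).
  by apply: Rintegral_ge0 => x _; exact: sqr_ge0.
have E x : (f x - m) ^+ 2 = f x ^+ 2 + (- 2 * m) * f x + m ^+ 2 by ring.
under eq_Rintegral do rewrite E.
rewrite RintegralD//; last 2 first.
- by apply: bI; apply: bmeasD; [exact: bmeasX|exact: bmeasZ].
- by apply: (bI (fun=> m ^+ 2)); exact: bmeas_cst.
rewrite RintegralD//; last 2 first.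
- by apply: bI; exact: bmeasX.
- by apply: bI; exact: bmeasZ.
rewrite RintegralZl//; last exact: bI.
by rewrite Rintegral_probability_cst -/m; lra.
Qed.

End bounded_measurable.

(** * Resampling coordinates and the Efron-Stein inequality *)

Section tuple_update.
Context d (E : measurableType d) (n : nat).
Implicit Types (x : n.-tuple E) (i : 'I_n) (u : E).

Definition upd x i u : n.-tuple E :=
  [tuple (if l == i then u else tnth x l) | l < n].

Lemma tnth_upd x i u l : tnth (upd x i u) l = if l == i then u else tnth x l.
Proof. by rewrite tnth_mktuple. Qed.

Lemma upd_upd x i u v : upd (upd x i u) i v = upd x i v.
Proof. by apply/eq_from_tnth => l; rewrite !tnth_upd; case: eqP. Qed.

Lemma updC x i j u v : i != j -> upd (upd x i u) j v = upd (upd x j v) i u.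
Proof.
move=> ij; apply/eq_from_tnth => l; rewrite !tnth_upd.
by case: eqP => [->|//]; rewrite eq_sym (negbTE ij).
Qed.

Lemma measurable_upd i :
  measurable_fun [set: n.-tuple E * E] (fun z => upd z.1 i z.2).
Proof.
apply/measurable_fun_tnthP => l /=; rewrite /comp/=.
under eq_fun do rewrite tnth_upd.
case: eqP => _; first exact: measurable_snd.
exact: (measurableT_comp (measurable_tnth l) measurable_fst).
Qed.

(** A function that ignores every coordinate is constant: move from one tuple
    to the other one coordinate at a time. *)
Lemma upd_invariant_constant (T : Type) (h : n.-tuple E -> T) :
  (forall x i u, h (upd x i u) = h x) -> forall x y, h x = h y.
Proof.
move=> hU x y.
pose z (s : seq 'I_n) := foldr (fun i w => upd w i (tnth y i)) x s.
have hz s : h (z s) = h x by elim: s => [//|i s ih] /=; rewrite hU.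
have zE s l : tnth (z s) l = if l \in s then tnth y l else tnth x l.
  elim: s => [//|i s ih] /=.
  by rewrite tnth_upd in_cons ih; case: eqP => [->|].
rewrite -(hz (enum 'I_n)); congr h; apply/eq_from_tnth => l.
by rewrite zE mem_enum.
Qed.

End tuple_update.

Section efron_stein.
Context {R : realType} d (E : measurableType d) (n : nat).
Variables (mu : probability (n.-tuple E) R) (P : probability E R).

(** This characterizes the [n]-fold product of [P]: each coordinate has law
    [P] given the others. *)
Definition resamplable := forall i A, measurable A ->
  mu A = (mu \x P)%E ((fun z => upd z.1 i z.2) @^-1` A).

Hypothesis muP : resamplable.

Let updf i : {mfun (n.-tuple E * E)%type >-> n.-tuple E} :=
  mfun_Sub (mem_set (measurable_upd i)).

Lemma bmeas_upd i (f : n.-tuple E -> R) :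
  bmeas f -> bmeas (fun z : n.-tuple E * E => f (upd z.1 i z.2)).
Proof. by move=> bf; apply: (bmeas_comp _ bf); exact: measurable_upd. Qed.

Lemma bmeas_upd2 x i (f : n.-tuple E -> R) : bmeas f -> bmeas (fun u => f (upd x i u)).
Proof. by move=> bf; exact: (bmeas_slice1 x (bmeas_upd i bf)). Qed.

(** Conditional expectation given all the coordinates but the [i]-th. *)
Definition resample i (f : n.-tuple E -> R) x := \int[P]_u f (upd x i u).

Lemma bmeas_resample i f : bmeas f -> bmeas (resample i f).
Proof.
by move=> bf; apply: (@bmeas_fubini _ _ _ _ _ P (fun z => f (upd z.1 i z.2)));
  exact: bmeas_upd.
Qed.

Lemma Rintegral_resample i f : bmeas f ->
  \int[mu]_x resample i f x = \int[mu]_x f x.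
Proof.
move=> bf; have bfu := bmeas_upd i bf.
have muE A : measurable A -> A `<=` setT ->
    mu A = pushforward (mu \x P)%E (updf i) A by move=> mA _; exact: muP.
congr fine; rewrite [RHS](eq_measure_integral _ muE).
rewrite integral_pushforward//=; last 2 first.
- by apply/measurable_EFinP; case: bf.
- by rewrite preimage_setT; exact: (bmeas_integrable (mu \x P)%E bfu).
  rewrite preimage_setT -(integral12_prod_meas1 (bmeas_integrable (mu \x P)%E bfu)).
  apply: eq_integral => x _; rewrite /resample bmeas_EFin//.
  exact: bmeas_upd2.
exact: measurable_upd.
Qed.

Definition ignores i (f : n.-tuple E -> R) := forall x u, f (upd x i u) = f x.

Lemma resample_ignores i f : ignores i (resample i f).
Proof. by move=> x u; apply: eq_Rintegral => v _; rewrite upd_upd. Qed.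

Lemma ignores_resample i j f : ignores i f -> ignores i (resample j f).
Proof.
move=> fi x u; have [->|ij] := eqVneq i j; first exact: resample_ignores.
by apply: eq_Rintegral => v _; rewrite updC.
Qed.

Let iter_resample (s : seq 'I_n) f := foldl (fun h i => resample i h) f s.

Let Rintegral_iter s f : bmeas f ->
  \int[mu]_x iter_resample s f x = \int[mu]_x f x.
Proof.
elim: s f => [//|i s ih] f bf /=; rewrite ih ?Rintegral_resample//.
exact: bmeas_resample.
Qed.

Let ignores_iter s f i : ignores i f \/ i \in s -> ignores i (iter_resample s f).
Proof.
elim: s f => [|j s ih] f /=; first by case.
rewrite in_cons => -[fi|/orP[/eqP ij|si]]; apply: ih.
- by left; exact: ignores_resample.
- by left; rewrite ij; exact: resample_ignores.
- by right.
Qed.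

Let efron_stein_iter s f (g : 'I_n -> n.-tuple E -> R) : bmeas f ->
  (forall i, bmeas (g i)) -> (forall i, ignores i (g i)) ->
  \int[mu]_x (f x ^+ 2) <= \int[mu]_x (iter_resample s f x ^+ 2) +
     \sum_(i <- s) \int[mu]_x ((f x - g i x) ^+ 2).
Proof.
elim: s f g => [|i s ih] f g bf bg gi; first by rewrite big_nil addr0.
rewrite big_cons addrCA /=.
have bI h : bmeas h -> mu.-integrable setT (EFin \o h) by exact: bmeas_integrable.
have bfg : bmeas (fun x => (f x - g i x) ^+ 2) by apply: bmeasX; exact: bmeasB.
have bRf := bmeas_resample i bf.
have step : \int[mu]_x (f x ^+ 2) <=
    \int[mu]_x (resample i f x ^+ 2) + \int[mu]_x ((f x - g i x) ^+ 2).
  rewrite -(Rintegral_resample i (bmeasX 2 bf)) -(Rintegral_resample i bfg).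
  rewrite -RintegralD//; last 2 first.
  - by apply: bI; exact: bmeasX.
  - by apply: bI; exact: bmeas_resample.
  apply: le_Rintegral => //.
  - by apply: bI; apply: bmeas_resample; exact: bmeasX.
  - by apply: bI; apply: bmeasD; [exact: bmeasX|exact: bmeas_resample].
  move=> x _; apply: le_trans (second_moment_le _ (g i x) _) _.
    exact: bmeas_upd2.
  rewrite /resample lerD2l le_eqVlt; apply/orP; left; apply/eqP.
  by apply: eq_Rintegral => u _; rewrite gi.
apply: (le_trans step); rewrite [leLHS]addrC lerD2l.
apply: le_trans (ih _ (fun l => resample i (g l)) _ _ _) _ => //.
- by move=> l; exact: bmeas_resample.
- by move=> l; exact: ignores_resample.
rewrite lerD2l; apply: ler_sum => l _.
have bfl : bmeas (fun x => f x - g l x) by exact: bmeasB.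
have bfl2 := bmeasX 2 bfl.
rewrite -(Rintegral_resample i bfl2); apply: le_Rintegral => //.
- by apply: bI; apply: bmeasX; apply: bmeasB; exact: bmeas_resample.
- by apply: bI; exact: bmeas_resample.
move=> x _; apply: le_trans (sqr_Rintegral_le _ _); last exact: bmeas_upd2 bfl.
rewrite /resample RintegralB//.
- by apply: bmeas_integrable; exact: bmeas_upd2.
- by apply: bmeas_integrable; exact: bmeas_upd2.
Qed.

(** Coordinates are resampled one after another. Each step replaces [f] by its
    mean in one coordinate and costs, by [second_moment_le] in that coordinate,
    at most the mean of [(f - g i) ^ 2]; Jensen's inequality carries the later
    costs from the averaged functions back to [f]. The last function is
    constant, equal to the mean of [f]. *)
Theorem efron_stein f (g : 'I_n -> n.-tuple E -> R) : bmeas f ->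
  (forall i, bmeas (g i)) -> (forall i, ignores i (g i)) ->
  \int[mu]_x (f x ^+ 2) <= (\int[mu]_x f x) ^+ 2 +
     \sum_(i < n) \int[mu]_x ((f x - g i x) ^+ 2).
Proof.
move=> bf bg gi.
apply: le_trans (efron_stein_iter (enum 'I_n) bf bg gi) _.
rewrite big_enum/= lerD2r.
have hc : forall x y, iter_resample (enum 'I_n) f x = iter_resample (enum 'I_n) f y.
  apply: upd_invariant_constant => x i u.
  by apply: ignores_iter; right; rewrite mem_enum.
rewrite -(Rintegral_iter (enum 'I_n) bf).
set h := iter_resample _ f in hc *; pose c := h point.
rewrite (@eq_Rintegral _ _ _ mu setT (fun=> c ^+ 2) (fun x => h x ^+ 2)); last first.
  by move=> x _; rewrite (hc x point).
rewrite (@eq_Rintegral _ _ _ mu setT (fun=> c) h); last first.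
  by move=> x _ /=; exact: hc.
by rewrite !Rintegral_probability_cst.
Qed.

End efron_stein.

(** * Ranks and leave-one-out sums *)

Section rank.
Context {R : realType} {n : nat}.
Implicit Types (a : 'I_n -> R) (i j : 'I_n).

Definition rank a i : nat := (\sum_(l < n) (a l < a i)%R)%N.

Lemma rank_ltn a i : (rank a i < n)%N.
Proof.
rewrite /rank (bigD1 i)//= ltxx add0n.
have n0 : (0 < n)%N by case: n i => // -[].
apply: (@leq_ltn_trans (\sum_(l < n | l != i) 1)%N).
  by apply: leq_sum => l _; case: (_ < _)%R.
by rewrite sum1_card cardC1 card_ord; case: n n0.
Qed.

Lemma rank_mono a i j : (a i < a j)%R -> (rank a i < rank a j)%N.
Proof.
move=> ij; rewrite /rank (bigD1 i)//= [X in (_ < X)%N](bigD1 i)//= ltxx ij.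
rewrite add0n add1n ltnS; apply: leq_sum => l _.
by case: (ltP (a l) (a i)) => // li; rewrite (lt_trans li ij).
Qed.

Lemma ltn_rank a i j : (rank a i < rank a j)%N -> (a i < a j)%R.
Proof.
apply: contraTT; rewrite -leNgt -leqNgt => ji; apply: leq_sum => l _.
by case: (ltP (a l) (a j)) => // lj; rewrite (lt_le_trans lj ji).
Qed.

Lemma rank_inj a : injective a -> injective (rank a).
Proof.
move=> ainj i j rij; apply: ainj; apply/eqP; rewrite eq_le !leNgt.
by apply/andP; split; apply/negP => /rank_mono; rewrite rij ltnn.
Qed.

(** Without ties, ranking is a permutation of the indices. *)
Lemma sum_rank (V : nmodType) a (f : nat -> V) : injective a ->
  \sum_(i < n) f (rank a i) = \sum_(i < n) f i.
Proof.
move=> ainj; pose r i := Ordinal (rank_ltn a i).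
have rinj : injective r by move=> i j [] /(rank_inj ainj).
by rewrite [RHS](reindex r)//; apply: onW_bij; exact: injF_bij.
Qed.

Lemma card_rank_lt a K : injective a -> (K <= n)%N ->
  (\sum_(i < n) (rank a i < K))%N = K.
Proof.
move=> ainj Kn.
have -> : (\sum_(i < n) (rank a i < K))%N = (\sum_(i < n) (i < K))%N.
  exact: (@sum_rank nat a (fun r => (r < K)%N : nat)).
rewrite -(big_mkord xpredT (fun m => (m < K)%N : nat)).
rewrite (big_cat_nat (n := K))//= [X in (X + _)%N]big_nat.
rewrite (eq_bigr (fun=> 1%N)); last by move=> m /andP[_ ->].
rewrite -big_nat sum_nat_const_nat subn0 muln1 big_nat big1 ?addn0//.
by move=> m /andP[Km _]; rewrite ltnNge Km.
Qed.

Lemma rank_surj a r : injective a -> (r < n)%N -> exists i, rank a i = r.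
Proof.
move=> ainj rn; pose f i := Ordinal (rank_ltn a i).
have finj : injective f by move=> i j [] /(rank_inj ainj).
have [g _ gK] := injF_bij finj.
by exists (g (Ordinal rn)); have := gK (Ordinal rn) => /(congr1 val).
Qed.

(** The order statistic is the value of the element of rank [k.-1] when there
    are no ties, but the equivalence survives ties: an entry exceeds the [k]-th
    smallest one exactly when at least [k] entries are below it. *)
Lemma le_order_statistic a i k : (0 < k <= n)%N ->
  (a i <= nth 0 (sort <=%R (codom a)) k.-1)%R = (rank a i < k)%N.
Proof.
move=> /andP[k0 kn]; set s := sort _ _.
have ss : sorted <=%R s by exact: sort_le_sorted.
have sz : size s = n by rewrite size_sort size_codom card_ord.
have rE : rank a i = count (< a i)%R s.
  rewrite (permP (permEl (perm_sort _ _))) /codom /image_mem count_map.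
  by rewrite -sum1_count big_mkcond big_enum/=; apply: eq_bigr => l _; case: (_ < _)%R.
have k1 : (k.-1 < size s)%N by rewrite sz prednK.
rewrite rE; apply/idP/idP => [h|h].
  rewrite ltnNge; apply/negP => kc.
  have : (nth 0 s k.-1 < a i)%R.
    by apply: nth_count_lt => //; rewrite prednK.
  by rewrite ltNge h.
apply: nth_count_ge => //; apply/andP; split => //.
by rewrite -ltnS prednK.
Qed.

End rank.

Section leave_one_out.
Context {R : realType} {n : nat}.
Implicit Types (a f : 'I_n -> R) (i j : 'I_n).

Definition rank_but a j i : nat := (\sum_(l < n | l != j) (a l < a i)%R)%N.

Lemma rank_butE a j i : rank a i = ((a j < a i)%R + rank_but a j i)%N.
Proof. by rewrite /rank (bigD1 j). Qed.

(** Removing the entry [j] changes the sum over the [k] smallest entries only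
    if [j] is one of them, and then it replaces [j] by the entry of rank
    [k]. *)
Lemma leave_one_out a f k j : injective a ->
  \sum_(i < n) (rank a i < k)%:R * f i -
  \sum_(i < n | i != j) (rank_but a j i < k)%:R * f i =
  (rank a j < k)%:R * (f j - \sum_(i < n) (rank a i == k)%:R * f i).
Proof.
move=> ainj; rewrite (bigD1 j)//= -addrA -sumrB mulrBr; congr (_ + _).
rewrite mulr_sumr -sumrN [RHS](bigD1 j)//=.
have -> : (rank a j < k)%:R * ((rank a j == k)%:R * f j) = 0.
  by case: ltngtP; rewrite ?mul0r ?mulr0.
rewrite oppr0 add0r; apply: eq_bigr => i ij.
have := rank_butE a j i; case: (ltP (a j) (a i)) => [ji|ij'].
  rewrite add1n => ri; have := rank_mono ji.
  rewrite !ri => h.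
  have [rk|rk] := ltnP (rank_but a j i).+1 k.
    by rewrite (ltnW rk) (ltn_eqF rk) !mul0r mulr0 mul1r subrr oppr0.
  have [e|ne] := eqVneq (rank_but a j i).+1 k.
    by rewrite -e ltnS leqnn h !mul0r !mul1r sub0r.
  have -> : (rank_but a j i < k)%N = false by lia.
  by rewrite !mul0r mulr0 subrr oppr0.
rewrite add0n => ri; rewrite ri subrr.
have lt : (a i < a j)%R.
  by rewrite lt_neqAle ij' andbT; apply: contra_neq ij => /ainj.
have := rank_mono lt; rewrite ri => h.
case: (eqVneq (rank_but a j i) k) => [e|_]; last by rewrite mul0r mulr0 oppr0.
have -> : (rank a j < k)%N = false by lia.
by rewrite mul0r oppr0.
Qed.

End leave_one_out.

(** * Nearest neighbours of a fixed point *)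

Section nearest_neighbours.
Context {R : realType} {d n : nat}.
Local Notation E := 'rV[R]_d.
Implicit Types (X : n.-tuple E) (z u : E) (i j : 'I_n) (K : nat).

Definition dists X z i : R := enorm (tnth X i - z).

Definition near_count X z i (r : R) : nat :=
  (\sum_(l < n | l != i) (dists X z l < r)%R)%N.

Lemma dists_upd X z i u l :
  dists (upd X i u) z l = if l == i then enorm (u - z) else dists X z l.
Proof. by rewrite /dists tnth_upd; case: eqP. Qed.

Lemma rank_upd X z i u :
  rank (dists (upd X i u) z) i = near_count X z i (enorm (u - z)).
Proof.
rewrite /rank (bigD1 i)//= ltxx add0n; apply: eq_bigr => l li.
by rewrite !dists_upd (negbTE li) eqxx.
Qed.

Lemma measurable_dists d1 (T : measurableType d1) (X : T -> n.-tuple E) (z : T -> E) i :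
  measurable_fun [set: T] X -> measurable_fun [set: T] z ->
  measurable_fun [set: T] (fun t => dists (X t) (z t) i).
Proof.
move=> mX mz; apply: measurable_edist => //.
exact: measurableT_comp (measurable_tnth i) mX.
Qed.

Lemma measurable_count d1 (T : measurableType d1) (I : finType) (P : pred I)
    (b : I -> T -> bool) (p : pred nat) :
  (forall l, measurable_fun [set: T] (b l)) ->
  measurable_fun [set: T] (fun t => p (\sum_(l | P l) b l t)%N).
Proof.
move=> mb.
have mN (s : seq I) : measurable_fun [set: T] (fun t => (\sum_(l <- s | P l) b l t)%N).
  elim: s => [|l s ih]; first by under eq_fun do rewrite big_nil; exact: measurable_cst.
  under eq_fun do rewrite big_cons.
  by case: (P l) => //; apply: measurable_fun_addn => //; apply: (measurableT_comp _ (mb l)).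
by apply: (measurableT_comp _ (mN _)).
Qed.

Lemma measurable_rank d1 (T : measurableType d1) (X : T -> n.-tuple E) (z : T -> E)
    i (p : pred nat) :
  measurable_fun [set: T] X -> measurable_fun [set: T] z ->
  measurable_fun [set: T] (fun t => p (rank (dists (X t) (z t)) i)).
Proof.
move=> mX mz; apply: measurable_count => l.
by apply: measurable_fun_ltr; exact: measurable_dists.
Qed.

Lemma measurable_rank_but d1 (T : measurableType d1) (X : T -> n.-tuple E) (z : T -> E)
    j i (p : pred nat) :
  measurable_fun [set: T] X -> measurable_fun [set: T] z ->
  measurable_fun [set: T] (fun t => p (rank_but (dists (X t) (z t)) j i)).
Proof.
move=> mX mz; apply: measurable_count => l.
by apply: measurable_fun_ltr; exact: measurable_dists.
Qed.

Lemma measurable_near_count d1 (T : measurableType d1) (X : T -> n.-tuple E)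
    (z : T -> E) i (r : T -> R) (p : pred nat) :
  measurable_fun [set: T] X -> measurable_fun [set: T] z ->
  measurable_fun [set: T] r ->
  measurable_fun [set: T] (fun t => p (near_count (X t) (z t) i (r t))).
Proof.
move=> mX mz mr; apply: measurable_count => l.
by apply: measurable_fun_ltr => //; exact: measurable_dists.
Qed.

Variables (mu : probability (n.-tuple E) R) (P : probability E R).
Hypothesis muP : resamplable mu P.

(** Independence of the coordinates, which are integrated out one at a time. *)
Lemma Rintegral_prod_tnth (s : seq 'I_n) (a : E -> R) : uniq s -> bmeas a ->
  \int[mu]_X (\prod_(l <- s) a (tnth X l)) = (\int[P]_u a u) ^+ size s.
Proof.
move=> us ba.
have bp (s' : seq 'I_n) : bmeas (fun X : n.-tuple E => \prod_(l <- s') a (tnth X l)).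
  elim: s' => [|l s' ih].
    by under eq_fun do rewrite big_nil; exact: bmeas_cst.
  under eq_fun do rewrite big_cons.
  by apply: bmeasM => //; apply: (bmeas_comp _ ba); exact: measurable_tnth.
elim: s us => [|i s ih] /= => [_|/andP[si us]].
  under eq_Rintegral do rewrite big_nil.
  exact: Rintegral_probability_cst.
rewrite -(Rintegral_resample muP i (bp (i :: s))) exprS -(ih us).
rewrite -RintegralZl//; last exact: bmeas_integrable.
apply: eq_Rintegral => X _; rewrite /resample -RintegralZr//; last first.
  exact: bmeas_integrable.
apply: eq_Rintegral => u _; rewrite big_cons tnth_upd eqxx; congr (_ * _).
apply: eq_big_seq => l ls; rewrite tnth_upd.
by case: eqP => // li; rewrite -li ls in si.
Qed.

(** Given that [X_i] is at distance [r] from [z], the probability that it is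
    among the [K] nearest neighbours of [z]. *)
Definition few_near z i K (r : R) : R := \int[mu]_X ((near_count X z i r < K)%N%:R).

Lemma few_near_ge0 z i K r : 0 <= few_near z i K r.
Proof. by apply: Rintegral_ge0 => X _; exact: ler0n. Qed.

Lemma bmeas_few_near z i K : bmeas (fun u => few_near z i K (enorm (u - z))).
Proof.
apply: (@bmeas_fubini _ _ _ _ _ mu
  (fun w : E * n.-tuple E => (near_count w.2 z i (enorm (w.1 - z)) < K)%N%:R)).
apply: bmeas_bool; apply: (@measurable_near_count _ _ _ _ i _ (fun c => (c < K)%N)) => //.
by apply: measurable_edist.
Qed.

Definition ball_mass z (r : R) : R := fine (P [set v | enorm (v - z) < r]).

(** Chernoff's method: [b ^ near_count], with [b = K / (K + 1)], is at least
    [exp (- 1)] when fewer than [K] points are near, and its mean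
    factorizes. *)
Lemma few_near_le z i K (r : R) : (0 < K)%N ->
  few_near z i K r <= expR (2 - n%:R * (ball_mass z r / K.+1%:R)).
Proof.
move=> K0; pose b : R := K%:R / K.+1%:R.
have K1 : 0 < K.+1%:R :> R by [].
have b0 : 0 < b by rewrite divr_gt0// ltr0n.
have b1 : b <= 1 by rewrite ler_pdivrMr// mul1r ler_nat.
have bE : 1 - b = K.+1%:R^-1.
  by rewrite /b -[K.+1%:R]natr1; field; rewrite natr1 pnatr_eq0.
have Kn0 : K%:R != 0 :> R by rewrite pnatr_eq0 -lt0n.
(* that is, [(1 + 1 / K) ^ (K - 1) <= e] *)
have bK : expR (- 1) <= b ^+ K.-1.
  have bexp : expR (- K%:R^-1) <= b.
    have -> : b = (1 + K%:R^-1)^-1.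
      by rewrite /b -[K.+1%:R]natr1; field; rewrite natr1 Kn0 pnatr_eq0.
    rewrite expRN lef_pV2 ?posrE ?expR_gt0 ?addr_gt0 ?invr_gt0 ?ltr0n//.
    exact: expR_ge1Dx.
  apply: (@le_trans _ _ (expR (- K%:R^-1) ^+ K.-1)); last first.
    by rewrite lerXn2r// nnegrE ?expR_ge0// ltW.
  rewrite -expRM_natl ler_expR mulrN lerN2 ler_pdivrMr ?ltr0n// mul1r.
  by rewrite ler_nat leq_pred.
pose a (v : E) : R := b ^+ (enorm (v - z) < r)%R.
have mlt : measurable_fun [set: E] (fun v => enorm (v - z) < r).
  by apply: measurable_fun_ltr => //; exact: measurable_edist.
have mball : measurable [set v : E | enorm (v - z) < r].
  by rewrite -[X in measurable X]setTI; exact: (mlt measurableT [set true]).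
have bind : bmeas (fun v : E => (enorm (v - z) < r)%R%:R : R) by exact: bmeas_bool.
have aE v : a v = 1 - K.+1%:R^-1 * (enorm (v - z) < r)%R%:R.
  rewrite /a; case: (_ < _); rewrite ?mulr1 ?mulr0 ?subr0//.
  by rewrite expr1 -bE opprB addrCA subrr addr0.
have ba : bmeas a.
  rewrite (_ : a = fun v => 1 - K.+1%:R^-1 * (enorm (v - z) < r)%R%:R).
    by apply: bmeasB; [exact: bmeas_cst|exact: bmeasZ].
  exact/funext.
pose s := [seq l <- enum 'I_n | l != i].
have near_prod X : b ^+ near_count X z i r = \prod_(l <- s) a (tnth X l).
  by rewrite /s big_filter big_enum_cond/= -prodrXr.
have n0 : (0 < n)%N by exact: leq_ltn_trans (ltn_ord i).
have ss : size s = n.-1.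
  have := count_predC (pred1 i) (enum 'I_n).
  rewrite count_uniq_mem ?enum_uniq// mem_enum size_enum_ord /s size_filter.
  by rewrite add1n => /(congr1 predn)/=.
have us : uniq s by rewrite filter_uniq// enum_uniq.
have int_a : \int[P]_v a v = 1 - ball_mass z r / K.+1%:R.
  under eq_Rintegral do rewrite aE.
  rewrite RintegralB//; last 2 first.
  - by apply: (bmeas_integrable P (f := fun=> 1)); exact: bmeas_cst.
  - by apply: bmeas_integrable; exact: bmeasZ.
  rewrite Rintegral_probability_cst.
  rewrite RintegralZl//; last exact: bmeas_integrable.
  congr (_ - _); rewrite mulrC; congr (_ * _); congr fine.
  rewrite -[X in P X]setIT -integral_indic//; apply: eq_integral => v _.
  by rewrite indicE; congr ((nat_of_bool _)%:R%:E); apply/idP/idP; rewrite inE.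
have rho1 : 0 <= ball_mass z r <= 1.
  apply/andP; split; first by rewrite fine_ge0.
  rewrite -lee_fin fineK; first exact: probability_le1.
  exact: fin_num_measure.
have bnear : bmeas (fun X : n.-tuple E => (near_count X z i r < K)%N%:R : R).
  by apply: bmeas_bool; exact: (@measurable_near_count _ _ _ _ i _ (fun c => (c < K)%N)).
have bprod : bmeas (fun X : n.-tuple E => \prod_(l <- s) a (tnth X l)).
  elim: s {near_prod ss us} => [|l s' ih].
    by under eq_fun do rewrite big_nil; exact: bmeas_cst.
  under eq_fun do rewrite big_cons.
  by apply: bmeasM => //; apply: (bmeas_comp _ ba); exact: measurable_tnth.
apply: (@le_trans _ _ (\int[mu]_X (expR 1 * \prod_(l <- s) a (tnth X l)))).
  apply: le_Rintegral => //.
  - exact: bmeas_integrable.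
  - by apply: bmeas_integrable; exact: bmeasZ.
  move=> X _; rewrite -near_prod; case: ltnP => [NK|_]; last first.
    by rewrite mulr_ge0 ?expR_ge0 ?exprn_ge0 ?ltW.
  rewrite -ler_pdivrMl ?expR_gt0// mulr1 -expRN; apply: (le_trans bK).
  by apply: ler_wiXn2l; rewrite ?(ltW b0)// -ltnS prednK.
rewrite RintegralZl//; last exact: bmeas_integrable.
rewrite Rintegral_prod_tnth// ss int_a.
set t := ball_mass z r / K.+1%:R.
have /andP[r0 r1] := rho1.
have t0 : 0 <= t by rewrite divr_ge0.
have t1 : t <= 1.
  by rewrite ler_pdivrMr// mul1r (le_trans r1)// ler1n.
apply: (@le_trans _ _ (expR 1 * expR (- t) ^+ n.-1)).
  rewrite ler_wpM2l ?expR_ge0// lerXn2r ?nnegrE ?subr_ge0 ?expR_ge0//.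
  exact: expR_ge1Dx.
rewrite -expRM_natl -expRD ler_expR mulrN.
have -> : n%:R = n.-1%:R + 1 :> R by rewrite natr1 prednK.
by rewrite mulrDl mul1r; lra.
Qed.

(** Condition on the position [u] of [X_i]: its rank is then the number of
    other points closer to [z]. *)
Lemma knn_mean z i K (G : E -> R) : bmeas G ->
  \int[mu]_X ((rank (dists X z) i < K)%N%:R * G (tnth X i)) =
  \int[P]_u (few_near z i K (enorm (u - z)) * G u).
Proof.
move=> bG.
have bf : bmeas (fun X => (rank (dists X z) i < K)%N%:R * G (tnth X i)).
  apply: bmeasM; last by apply: (bmeas_comp _ bG); exact: measurable_tnth.
  by apply: bmeas_bool; exact: (measurable_rank i (fun c => (c < K)%N)).
rewrite -(Rintegral_resample muP i bf) /resample.
under eq_Rintegral do under eq_Rintegral do rewrite rank_upd tnth_upd eqxx.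
pose f (w : n.-tuple E * E) : R :=
  (near_count w.1 z i (enorm (w.2 - z)) < K)%N%:R * G w.2.
have bfw : bmeas f.
  apply: bmeasM; last by apply: (bmeas_comp _ bG); exact: measurable_snd.
  apply: bmeas_bool; apply: (@measurable_near_count _ _ _ _ i _ (fun c => (c < K)%N)) => //.
  by apply: measurable_edist.
rewrite (Rintegral_fubini mu P bfw); apply: eq_Rintegral => u _.
rewrite /f/= RintegralZr//; apply: bmeas_integrable; apply: bmeas_bool.
exact: (@measurable_near_count _ _ _ _ i _ (fun c => (c < K)%N)).
Qed.

End nearest_neighbours.

(** * Functionals determined by their values on indicators *)

Section integral_functionals.
Import HBNNSimple.
Local Open Scope ereal_scope.
Context {R : realType} d (T : measurableType d).
Implicit Types (Phi Psi : (T -> \bar R) -> \bar R) (f g : T -> \bar R).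

Let nonneg f := measurable_fun [set: T] f /\ forall x, 0 <= f x.

(** The properties of [f |-> \int f] on nonnegative measurable functions from
    which its values on indicators determine it. *)
Definition integral_like Phi :=
  [/\ forall f g, nonneg f -> nonneg g -> Phi (fun x => f x + g x) = Phi f + Phi g,
      forall (c : R) f, (0 <= c)%R -> nonneg f -> Phi (fun x => c%:E * f x) = c%:E * Phi f
    & forall (f : nat -> T -> \bar R), (forall n, nonneg (f n)) ->
        (forall x, nondecreasing_seq (f ^~ x)) ->
        Phi (fun x => limn (f ^~ x)) = limn (fun n => Phi (f n))].

(** A nonnegative measurable function is an increasing limit of simple
    functions, which are combinations of indicators. *)
Lemma integral_like_ext Phi Psi : integral_like Phi -> integral_like Psi ->
  (forall A, measurable A -> Phi (fun x => (\1_A x)%:E) = Psi (fun x => (\1_A x)%:E)) ->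
  forall f, measurable_fun [set: T] f -> (forall x, 0 <= f x) -> Phi f = Psi f.
Proof.
move=> [addP scP cvP] [addQ scQ cvQ] PQ f mf f0.
pose h := nnsfun_approx measurableT mf.
have hcvg x : limn (fun n => (h n x)%:E) = f x.
  by apply/cvg_lim => //; exact: cvg_nnsfun_approx.
have hn n : nonneg (EFin \o h n).
  by split => [|x]; [exact/measurable_EFinP|rewrite /= lee_fin].
have hnd x : nondecreasing_seq (fun n => (EFin \o h n) x).
  by move=> a b ab; rewrite /= lee_fin; exact/lefP/nd_nnsfun_approx.
rewrite (_ : f = fun x => limn (fun n => (EFin \o h n) x)); last first.
  by apply/funext => x; rewrite /= hcvg.
rewrite cvP// cvQ//; congr (limn _); apply/funext => n.
move: (h n) => {hcvg hn hnd} g.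
have [s s0 gE] : exists2 s : seq R, (forall y, y \in s -> (0 <= y)%R) &
    EFin \o g = fun x => \sum_(y <- s) y%:E * (\1_(g @^-1` [set y]) x)%:E.
  exists (finmap.enum_fset (fset_set (range g))).
    by move=> y; rewrite in_fset_set// inE => -[x _ <-].
  apply/funext => x /=; rewrite [in LHS]fimfunE fsbig_finite//= -sumEFin.
  by apply: eq_bigr => y _; rewrite EFinM.
rewrite {}gE.
have nn0 : nonneg (fun=> 0) by [].
have P0 : Phi (fun=> 0) = 0.
  transitivity (Phi (fun=> 0%:E * 0)).
    by congr Phi; apply/funext => x; rewrite mul0e.
  by rewrite (scP 0%R (fun=> 0) (lexx _) nn0) [LHS]mul0e.
have Q0 : Psi (fun=> 0) = 0.
  transitivity (Psi (fun=> 0%:E * 0)).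
    by congr Psi; apply/funext => x; rewrite mul0e.
  by rewrite (scQ 0%R (fun=> 0) (lexx _) nn0) [LHS]mul0e.
have nI y : nonneg (fun x => (\1_(g @^-1` [set y]) x)%:E).
  split => [|x]; last by rewrite lee_fin.
  by apply/measurable_EFinP; exact: measurable_indic.
have nM (y : R) : (0 <= y)%R -> nonneg (fun x => y%:E * (\1_(g @^-1` [set y]) x)%:E).
  move=> y0; split => [|x]; last by rewrite mule_ge0 ?lee_fin.
  by apply: emeasurable_funM => //; case: (nI y).
elim: s s0 => [_|y s ih ys].
  under eq_fun do rewrite big_nil.
  by rewrite P0 Q0.
have y0 : (0 <= y)%R by apply: ys; rewrite mem_head.
have s0 : forall z, z \in s -> (0 <= z)%R by move=> z zs; apply: ys; rewrite in_cons zs orbT.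
have nS : nonneg (fun x => \sum_(y <- s) y%:E * (\1_(g @^-1` [set y]) x)%:E).
  split => [|x]; last first.
    by rewrite big_seq; apply: sume_ge0 => z zs; have [] := nM z (s0 z zs).
  apply: emeasurable_sum => z; apply: emeasurable_funM => //.
  by case: (nI z).
under eq_fun do rewrite big_cons.
rewrite addP ?addQ ?(ih s0)//; [|exact: nM|exact: nM].
by rewrite scP ?scQ// PQ.
Qed.

Lemma integral_like_integral (mu : {measure set T -> \bar R}) :
  integral_like (fun f => \int[mu]_x f x).
Proof.
split.
- by move=> f g [mf f0] [mg g0]; rewrite ge0_integralD.
- by move=> c f c0 [mf f0]; rewrite ge0_integralZl.
- move=> f nf ndf; rewrite monotone_convergence//.
  + by move=> n; case: (nf n).
  + by move=> n x _; case: (nf n).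
Qed.

End integral_functionals.

Section density.
Context {R : realType} d (T : measurableType d).
Variables (mu : {measure set T -> \bar R}) (P : probability T R) (p : T -> R).
Hypothesis mp : measurable_fun [set: T] p.
Hypothesis p0 : forall x, 0 <= p x.
Hypothesis Pp : forall A, measurable A -> P A = (\int[mu]_(x in A) (p x)%:E)%E.

(** Both sides are functionals of [f] that agree on indicators. *)
Lemma ge0_integral_density (f : T -> \bar R) : measurable_fun [set: T] f ->
  (forall x, 0 <= f x)%E ->
  (\int[P]_x f x = \int[mu]_x (f x * (p x)%:E))%E.
Proof.
move: f; apply: (@integral_like_ext _ _ _ (fun f => \int[P]_x f x)%E
  (fun f => \int[mu]_x (f x * (p x)%:E))%E).
- exact: integral_like_integral.
- have mpE : measurable_fun [set: T] (EFin \o p) by exact/measurable_EFinP.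
  split.
  + move=> f g [mf f0] [mg g0].
    under eq_integral do rewrite ge0_muleDl//.
    rewrite ge0_integralD//.
    * by move=> x _; rewrite mule_ge0 ?lee_fin.
    * exact: emeasurable_funM.
    * by move=> x _; rewrite mule_ge0 ?lee_fin.
    * exact: emeasurable_funM.
  + move=> c f c0 [mf f0].
    under eq_integral do rewrite -muleA.
    rewrite ge0_integralZl//; first exact: emeasurable_funM.
    by move=> x _; rewrite mule_ge0 ?lee_fin.
  + move=> f nf ndf.
    rewrite -monotone_convergence//.
    * apply: eq_integral => x _; rewrite muleC -limeMl//.
        by congr (limn _); apply/funext => n; rewrite muleC.
      by apply: ereal_nondecreasing_is_cvgn; exact: ndf.
    * by move=> n; apply: emeasurable_funM => //; case: (nf n).
    * by move=> n x _; rewrite mule_ge0 ?lee_fin//; case: (nf n).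
    * by move=> x _ a b ab; rewrite lee_wpmul2r ?lee_fin//; exact: ndf.
- move=> A mA; transitivity (P A); first by rewrite integral_indic// setIT.
  rewrite Pp// integral_mkcond.
  apply: eq_integral => x _; rewrite patchE indicE.
  by case: ifP => _; rewrite ?mul1e ?mul0e.
Qed.

Lemma Rintegral_density (f : T -> R) : bmeas f ->
  mu.-integrable [set: T] (fun x => (f x * p x)%:E) /\
  (\int[P]_x f x)%:E = (\int[mu]_x (f x * p x)%:E)%E.
Proof.
move=> bf; have [mf _] := bf.
have mE : measurable_fun [set: T] (EFin \o f) by exact/measurable_EFinP.
have mfp : measurable_fun [set: T] (fun x => (f x * p x)%:E).
  by apply/measurable_EFinP; exact: measurable_funM.
have pos (g : T -> R) : measurable_fun [set: T] g -> (forall x, 0 <= g x) ->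
    (\int[P]_x (g x)%:E = \int[mu]_x (g x * p x)%:E)%E.
  move=> mg g0; rewrite ge0_integral_density//; last exact/measurable_EFinP.
have /integrableP[_ foo] := bmeas_integrable P bf.
have int : mu.-integrable [set: T] (fun x => (f x * p x)%:E).
  apply/integrableP; split => //; apply: le_lt_trans foo.
  rewrite (pos (fun x => `|f x|))//; last exact: measurableT_comp.
  apply: ge0_le_integral => //; first exact: measurableT_comp.
    apply/measurable_EFinP; apply: measurable_funM => //.
    exact: measurableT_comp.
  by move=> x _; rewrite lee_fin normrM (ger0_norm (p0 x)).
split => //; rewrite bmeas_EFin// [LHS]integralE [RHS]integralE.
congr (_ - _)%E.
- transitivity (\int[P]_x (f^\+ x)%:E)%E.
    by apply: eq_integral => x _; rewrite funeposE /funrpos EFin_max.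
  rewrite pos//; last exact: measurable_funrpos.
  apply: eq_integral => x _; rewrite funeposE /funrpos -EFin_max; congr EFin.
  by rewrite maxr_pMl// mul0r.
- transitivity (\int[P]_x (f^\- x)%:E)%E.
    by apply: eq_integral => x _; rewrite funenegE /funrneg EFin_max.
  rewrite pos//; last exact: measurable_funrneg.
  apply: eq_integral => x _; rewrite funenegE /funrneg -EFinN -EFin_max; congr EFin.
  by rewrite maxr_pMl// mul0r mulNr.
Qed.

End density.

Section joint_law_integral.
Local Open Scope ereal_scope.
Context d1 d2 (T1 : measurableType d1) (T2 : measurableType d2) {R : realType}.
Variables (mu : probability T1 R) (nu : R.-pker T1 ~> T2).

Lemma integral_joint_law (f : T1 * T2 -> \bar R) :
  measurable_fun [set: T1 * T2] f -> (forall z, 0 <= f z) ->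
  \int[joint_law mu nu]_z f z = \int[mu]_x \int[nu x]_y f (x, y).
Proof.
move: f; apply: (@integral_like_ext _ _ _ (fun f => \int[joint_law mu nu]_z f z)
  (fun f => \int[mu]_x \int[nu x]_y f (x, y))).
- exact: integral_like_integral.
- have mx (f : T1 * T2 -> \bar R) x : measurable_fun [set: T1 * T2] f ->
      measurable_fun [set: T2] (fun y => f (x, y)).
    by move=> mf; apply: (measurableT_comp mf); exact: measurable_pair1.
  have mi (f : T1 * T2 -> \bar R) : measurable_fun [set: T1 * T2] f ->
      (forall z, 0 <= f z) -> measurable_fun [set: T1] (fun x => \int[nu x]_y f (x, y)).
    by move=> mf f0; exact: measurable_fun_integral_finite_kernel.
  split.
  + move=> f g [mf f0] [mg g0].
    rewrite -ge0_integralD//; last 4 first.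
    * by move=> x _; exact: integral_ge0.
    * exact: mi.
    * by move=> x _; exact: integral_ge0.
    * exact: mi.
    by apply: eq_integral => x _; rewrite ge0_integralD//; exact: mx.
  + move=> c f c0 [mf f0].
    rewrite -ge0_integralZl//; last 2 first.
    * exact: mi.
    * by move=> x _; exact: integral_ge0.
    by apply: eq_integral => x _; rewrite ge0_integralZl//; exact: mx.
  + move=> f nf ndf.
    rewrite -monotone_convergence//.
    * apply: eq_integral => x _; rewrite monotone_convergence//.
      - by move=> n; apply: mx; case: (nf n).
      - by move=> n y _; case: (nf n).
    * by move=> n; case: (nf n) => mf f0; exact: mi.
    * by move=> n x _; apply: integral_ge0 => y _; case: (nf n).
    * move=> x _ a b ab; apply: ge0_le_integral => //.
      - by move=> y _; case: (nf a).
      - by apply: mx; case: (nf a).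
      - by apply: mx; case: (nf b).
      - by move=> y _; exact: ndf.
- move=> A mA; rewrite integral_indic// setIT; apply: eq_integral => x _.
  rewrite -[RHS]/(\int[nu x]_y ((\1_A (x, y))%:E)).
  transitivity (\int[nu x]_y (\1_(xsection A x) y)%:E : \bar R).
    by rewrite integral_indic ?setIT//; exact: measurable_xsection.
  by apply: eq_integral => y _; rewrite !indicE mem_xsection.
Qed.

End joint_law_integral.

(** * Distance to the complement *)

Section distance_to_complement.
Context {R : realType} {d : nat}.
Implicit Types (S : set 'rV[R]_d) (x u : 'rV[R]_d).

Lemma dist_compl_ge0 S x : 0 <= dist_compl S x.
Proof.
have [S0|/set0P[y Sy]] := eqVneq (~` S) set0.
  by rewrite /dist_compl S0 image_set0 inf0.
apply: lb_le_inf; first by exists (enorm (x - y)); exists y.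
by move=> _ [z _ <-]; exact: enorm_ge0.
Qed.

Lemma lt_dist_compl S x u : enorm (u - x) < dist_compl S x -> S u.
Proof.
move=> ux; apply: contrapT => nSu; move: ux; apply/negP; rewrite -leNgt.
rewrite enormB; apply: inf_lbound; last by exists u.
by exists 0 => _ [y _ <-]; exact: enorm_ge0.
Qed.

Lemma open_eball y (r : R) : open [set x : 'rV[R]_d | enorm (x - y) < r].
Proof.
rewrite openE => x /= xr; rewrite /interior; apply/nbhs_ballP.
pose e := (r - enorm (x - y)) / d.+1%:R.
have e0 : 0 < e by rewrite divr_gt0// subr_gt0.
exists e => // z [_ xz] /=.
apply: le_lt_trans (enorm_triangle z x y) _; rewrite -ltrBrDr.
apply: (@le_lt_trans _ _ (d%:R * e)).
  apply: enorm_le_coord => i; rewrite !mxE distrC.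
  by have := xz ord0 i => /ltW.
by rewrite /e mulrA ltr_pdivrMr// mulrC ltr_pM2l ?subr_gt0// ltr_nat.
Qed.

Lemma measurable_eball y (r : R) : measurable [set x : 'rV[R]_d | enorm (x - y) < r].
Proof. by rewrite measurable_rVE; apply: sub_sigma_algebra; exact: open_eball. Qed.

(** The strict sublevel sets are unions of open balls centred in the
    complement. *)
Lemma measurable_dist_compl S : measurable_fun [set: 'rV[R]_d] (dist_compl S).
Proof.
have [S0|/set0P[y0 Sy0]] := eqVneq (~` S) set0.
  rewrite (_ : dist_compl S = fun=> 0)//; apply/funext => x.
  by rewrite /dist_compl S0 image_set0 inf0.
apply: (measurability _ (RGenInftyO.measurableE R)) => //.
move=> _ [_ [r ->] <-]; rewrite setTI measurable_rVE; apply: sub_sigma_algebra.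
rewrite (_ : _ @^-1` _ = \bigcup_(y in ~` S) [set x | enorm (x - y) < r]).
  by apply: bigcup_open => y _; exact: open_eball.
apply/seteqP; split => x /=; rewrite in_itv/=.
  move/inf_lt => []; last by move=> _ [y Sy <-] xy; exists y.
  by exists (enorm (x - y0)); exists y0.
move=> [y Sy /= xy]; apply: le_lt_trans xy.
apply: inf_lbound; last by exists y.
by exists 0 => _ [z _ <-]; exact: enorm_ge0.
Qed.

End distance_to_complement.

(** * Real-valued integrable functions *)

Section real_integrable.
Context {R : realType} d (T : measurableType d) (mu : {measure set T -> \bar R}).
Implicit Types f g : T -> R.

Lemma integrableZ_EFin c f : mu.-integrable [set: T] (EFin \o f) ->
  mu.-integrable [set: T] (EFin \o (fun x => c * f x)).
Proof. by move=> intf; exact: (integrableZl measurableT c intf). Qed.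

Lemma integrableD_EFin f g : mu.-integrable [set: T] (EFin \o f) ->
  mu.-integrable [set: T] (EFin \o g) ->
  mu.-integrable [set: T] (EFin \o (fun x => f x + g x)).
Proof. by move=> intf intg; exact: (integrableD measurableT intf intg). Qed.

Lemma integrableB_EFin f g : mu.-integrable [set: T] (EFin \o f) ->
  mu.-integrable [set: T] (EFin \o g) ->
  mu.-integrable [set: T] (EFin \o (fun x => f x - g x)).
Proof. by move=> intf intg; exact: (integrableB measurableT intf intg). Qed.

Lemma integrable_le_EFin f g : measurable_fun [set: T] f ->
  (forall x, `|f x| <= g x) -> mu.-integrable [set: T] (EFin \o g) ->
  mu.-integrable [set: T] (EFin \o f).
Proof.
move=> mf fg; apply: le_integrable => //; first exact/measurable_EFinP.
move=> x _ /=; rewrite lee_fin (le_trans (fg x))//; exact: ler_norm.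
Qed.

Lemma norm_Rintegral_le f g : mu.-integrable [set: T] (EFin \o f) ->
  mu.-integrable [set: T] (EFin \o g) -> (forall x, `|f x| <= g x) ->
  `|\int[mu]_x f x| <= \int[mu]_x g x.
Proof.
move=> intf intg fg; apply: le_trans (le_normr_Rintegral _ intf) _ => //.
by apply: le_Rintegral => //; exact: integrable_norm intf.
Qed.

End real_integrable.

(** * Bias of the neighbour average at a query point *)

Section pow_exp_dist.
Context {R : realType} (d : nat) (d0 : (0 < d)%N).
Local Notation leb := (lebesgue_rV R d).

(** Up to a constant, a bound for the weight of a neighbour of [x] at [u],
    times a power of its distance. *)
Definition pow_exp_dist (j : nat) (a l : R) (x u : 'rV[R]_d) : R :=
  enorm (u - x) ^+ j * expR (- (a * (enorm (u - x) / l) ^+ d)).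

Lemma pow_exp_dist_ge0 j a l x u : 0 <= pow_exp_dist j a l x u.
Proof. by rewrite mulr_ge0 ?exprn_ge0 ?enorm_ge0 ?expR_ge0. Qed.

Lemma measurable_pow_exp_dist j a l x :
  measurable_fun [set: 'rV[R]_d] (pow_exp_dist j a l x).
Proof.
apply: measurable_funM; last exact: measurable_exp_dist.
by apply: measurable_funX; exact: measurable_edist.
Qed.

Lemma Rintegral_pow_exp_dist j (a : R) : 0 < a ->
  exists2 C : R, 0 < C & forall l x, 0 < l ->
    leb.-integrable [set: 'rV[R]_d] (EFin \o pow_exp_dist j a l x) /\
    \int[leb]_u pow_exp_dist j a l x u <= C * l ^+ (j + d).
Proof.
move=> a0; have [C C0 CP] := integral_pow_exp_dist_le d0 j a0.
exists C => // l x l0; have := CP l x l0 => le.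
have int : leb.-integrable [set: 'rV[R]_d] (EFin \o pow_exp_dist j a l x).
  apply/integrableP; split.
    by apply/measurable_EFinP; exact: measurable_pow_exp_dist.
  apply: le_lt_trans (ltry (C * l ^+ (j + d))); apply: le_trans le.
  rewrite le_eqVlt; apply/orP; left; apply/eqP; apply: eq_integral => u _ /=.
  by rewrite ger0_norm// pow_exp_dist_ge0.
split => //; rewrite -lee_fin fineK//.
exact: integrable_fin_num int.
Qed.

End pow_exp_dist.

(** [l] is the order of magnitude of the distance from a point to its [k]-th
    nearest neighbour in a sample of size [n]. *)
Definition scale_of {R : realType} (d n k : nat) (l : R) :=
  [/\ (0 < k <= n)%N, 0 < l & l ^+ d = k%:R / n.+1%:R].

Section bias.
Context {R : realType} {d : nat} (d0 : (0 < d)%N).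
Local Notation E := 'rV[R]_d.
Local Notation leb := (lebesgue_rV R d).
Variables (S : set E) (P : probability E R) (p : E -> R) (pmax Lp c : R).
Hypothesis mS : measurable S.
Hypothesis Pp : has_density P p.
Hypothesis pmax0 : 0 <= pmax.
Hypothesis p_le : forall x, S x -> p x <= pmax.
Hypothesis Lp0 : 0 <= Lp.
Hypothesis p_lip : forall x y, S x -> S y -> `|p x - p y| <= Lp * enorm (x - y).
Hypothesis c0 : 0 < c.
Hypothesis ball_ge : forall x u, S x -> S u ->
  c * enorm (u - x) ^+ d <= ball_mass P x (enorm (u - x)).

(** The Chernoff exponent is at least [n c r ^ d / (K + 1)] with [r] the
    distance, and [n / (K + 1) >= (n + 1) / (8 k)], where
    [(n + 1) / k = l ^ (- d)]. *)
Lemma few_near_exp n k l (mu : probability (n.-tuple E) R) i K x u :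
  resamplable mu P -> scale_of d n k l -> (0 < K)%N -> (K.+1 <= 4 * k)%N ->
  S x -> S u ->
  few_near mu x i K (enorm (u - x)) <=
    expR 2 * pow_exp_dist 0 (c / 8) l x u.
Proof.
move=> muP [/andP[k0 kn] l0 lE] K0 Kk Sx Su.
apply: le_trans (few_near_le muP _ _ _ K0) _.
rewrite /pow_exp_dist expr0 mul1r -expRD ler_expR lerD2l lerN2.
set r := enorm (u - x).
apply: (@le_trans _ _ (n%:R * (c * r ^+ d / K.+1%:R))); last first.
  rewrite ler_wpM2l// ler_wpM2r ?invr_ge0//; exact: ball_ge.
rewrite expr_div_n lE.
have r0 : 0 <= r ^+ d by rewrite exprn_ge0 ?enorm_ge0.
have h : (8 * k%:R)^-1 * n.+1%:R <= n%:R / K.+1%:R :> R.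
  rewrite mulrC ler_pdivlMr// mulrAC ler_pdivrMr ?mulr_gt0 ?ltr0n//.
  rewrite -!natrM ler_nat.
  by nia.
rewrite [leRHS](_ : _ = c * r ^+ d * (n%:R / K.+1%:R)); last by ring.
rewrite [leLHS](_ : _ = c * r ^+ d * ((8 * k%:R)^-1 * n.+1%:R)); last first.
  by field; rewrite ?pnatr_eq0 -?lt0n ?k0 /=.
by rewrite ler_wpM2l// mulr_ge0// ltW.
Qed.

Lemma Rintegral_P (f : E -> R) : bmeas f ->
  leb.-integrable [set: E] (EFin \o (fun u => f u * p u)) /\
  \int[P]_u f u = \int[leb]_u (f u * p u).
Proof.
have [mp p0 PE] := Pp; move=> bf.
have [int eq] := Rintegral_density mp p0 PE bf; split; first exact: int.
by apply: EFin_inj; rewrite eq fineK//; exact: integrable_fin_num int.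
Qed.

(** [l ^ j] is the size of the [j]-th power of the distance to a neighbour, and
    [l ^ d] that of the probability for [X_i] to be a neighbour. *)
Lemma knn_moment j : exists2 C : R, 0 < C &
  forall n k l (mu : probability (n.-tuple E) R) i K x (G : E -> R) M,
  resamplable mu P -> scale_of d n k l -> (0 < K)%N -> (K.+1 <= 4 * k)%N -> S x ->
  bmeas G -> 0 <= M -> (forall u, S u -> `|G u| <= M * enorm (u - x) ^+ j) ->
  (forall u, ~ S u -> G u = 0) ->
  `|\int[P]_u (few_near mu x i K (enorm (u - x)) * G u)| <= M * C * l ^+ (j + d).
Proof.
have c80 : 0 < c / 8 by rewrite divr_gt0.
have [C C0 CP] := Rintegral_pow_exp_dist d0 j c80.
exists (expR 2 * pmax * C + 1).
  by rewrite ltr_wpDl// !mulr_ge0 ?expR_ge0// ltW.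
move=> n k l mu i K x G M muP sc K0 Kk Sx bG M0 GM G0.
have [_ l0 _] := sc.
have [_ p0 _] := Pp.
have bf : bmeas (fun u : E => few_near mu x i K (enorm (u - x)) * G u).
  by apply: bmeasM => //; exact: bmeas_few_near.
have [int ->] := Rintegral_P bf.
have [intp leC] := CP l x l0.
have intN : leb.-integrable [set: E] (EFin \o (fun u => `|few_near mu x i K (enorm (u - x)) * G u * p u|)).
  exact: integrable_norm int.
apply: le_trans (le_normr_Rintegral _ int) _ => //.
apply: (@le_trans _ _ (\int[leb]_u (M * expR 2 * pmax * pow_exp_dist j (c / 8) l x u))).
  apply: le_Rintegral => //; first exact: integrableZ_EFin.
  move=> u _; rewrite !normrM (ger0_norm (p0 u)) (ger0_norm (few_near_ge0 _ _ _ _ _)).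
  have [Su|/G0 ->] := pselect (S u); last first.
    rewrite normr0 mulr0 mul0r; apply: mulr_ge0; last exact: pow_exp_dist_ge0.
    by rewrite !mulr_ge0 ?expR_ge0.
  apply: (@le_trans _ _ (expR 2 * pow_exp_dist 0 (c / 8) l x u *
      (M * enorm (u - x) ^+ j) * pmax)).
    apply: ler_pM; rewrite ?mulr_ge0 ?few_near_ge0//; last exact: p_le.
    by apply: ler_pM; rewrite ?few_near_ge0 ?GM//; exact: (few_near_exp i muP sc).
  by rewrite le_eqVlt /pow_exp_dist expr0; apply/orP; left; apply/eqP; ring.
rewrite RintegralZl//.
apply: (@le_trans _ _ (M * expR 2 * pmax * (C * l ^+ (j + d)))).
  by rewrite ler_wpM2l// !mulr_ge0 ?expR_ge0.
rewrite mulrA ler_wpM2r ?exprn_ge0 ?(ltW l0)//.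
by rewrite -!mulrA ler_wpM2l// mulrA lerDl.
Qed.

Variables (F : E * E -> R) (KF : R).
Hypothesis bF : bmeas F.
Hypothesis KF0 : 0 <= KF.
Hypothesis F_S : forall x u, ~ (S x /\ S u) -> F (x, u) = 0.
Hypothesis F_lip : forall x u, S x -> S u -> `|F (x, u)| <= KF * enorm (u - x).
Hypothesis F_sym : forall x u, S x -> S u -> S (x + x - u) ->
  `|F (x, u) + F (x, x + x - u)| <= KF * enorm (u - x) ^+ 2.

Lemma bmeasF x : bmeas (fun u => F (x, u)).
Proof. exact: bmeas_slice1 bF. Qed.

(** Inside the largest ball centred at [x] contained in [S], the symmetry
    [u |-> 2 x - u] cancels the first-order part of [F (x, u) p(x)], and
    replacing [p(u)] by [p(x)] costs a factor [|u - x|]: both contribute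
    [l ^ 2]. Outside that ball [F] is only of order [|u - x|], but distances
    exceed [dist_compl S x], and half of the exponential decay yields the last
    factor. *)
Lemma knn_bias_at : exists2 C : R, 0 < C &
  forall n k l (mu : probability (n.-tuple E) R) i x,
  resamplable mu P -> scale_of d n k l -> S x ->
  `|\int[P]_u (few_near mu x i k (enorm (u - x)) * F (x, u))| <=
     C * l ^+ d * (l ^+ 2 + l * expR (- (c / 16 * (dist_compl S x / l) ^+ d))).
Proof.
have c80 : 0 < c / 8 by rewrite divr_gt0.
have c160 : 0 < c / 16 by rewrite divr_gt0.
have [C2 C20 C2P] := Rintegral_pow_exp_dist d0 2 c80.
have [C1 C10 C1P] := Rintegral_pow_exp_dist d0 1 c160.
have [mp p0 _] := Pp.
pose e2 : R := expR 2.
have e20 : 0 <= e2 by exact: expR_ge0.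
pose M2 := e2 * KF * Lp; pose M2' := e2 * KF * pmax.
have M20 : 0 <= M2 by rewrite !mulr_ge0.
have M2'0 : 0 <= M2' by rewrite !mulr_ge0.
exists ((M2 + M2') * C2 + M2' * C1 + 1).
  rewrite ltr_wpDl// addr_ge0// mulr_ge0 ?addr_ge0//; exact: ltW.
move=> n k l mu i x muP sc Sx.
have [/andP[k0 kn] l0 lE] := sc.
have kk : (k.+1 <= 4 * k)%N by clear -k0; lia.
pose psi u := few_near mu x i k (enorm (u - x)).
have psi0 u : 0 <= psi u by exact: few_near_ge0.
have psi_le u : S u -> psi u <= e2 * pow_exp_dist 0 (c / 8) l x u.
  by move=> Su; apply: (@few_near_exp n k l mu i k x u).
have bpsi : bmeas psi by exact: bmeas_few_near.
set dl := dist_compl S x.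
pose A : set E := [set u | enorm (u - x) < dl].
have AS u : A u -> S u by exact: lt_dist_compl.
have mA : measurable A by exact: measurable_eball.
pose H u := psi u * F (x, u) * p u.
(* [phi] is [H] on the largest ball inside [S], with the density frozen at
   [x] *)
pose phi u := \1_A u * psi u * F (x, u) * p x.
have [int2 le2] := C2P l x l0.
have [int1 le1] := C1P l x l0.
have bH : bmeas (fun u => psi u * F (x, u)) by apply: bmeasM => //; exact: bmeasF.
have [intH ->] := Rintegral_P bH.
have bphi : bmeas phi.
  apply: bmeasM; last exact: bmeas_cst.
  by apply: bmeasM; [apply: bmeasM => //; exact: bmeas_indic|exact: bmeasF].
have rphi u : phi u = if u \in A then psi u * F (x, u) * p x else 0.
  by rewrite /phi indicE; case: (u \in A); rewrite ?mul1r ?mul0r.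
have exp_le u : expR (- (c / 8 * (enorm (u - x) / l) ^+ d)) <=
    expR (- (c / 16 * (enorm (u - x) / l) ^+ d)).
  rewrite ler_expR lerN2 ler_wpM2r ?exprn_ge0 ?divr_ge0 ?enorm_ge0 ?(ltW l0)//.
  by have := c0; lra.
have phi_le u : `|phi u| <= M2' * pow_exp_dist 1 (c / 16) l x u.
  rewrite rphi; case: ifPn => [|_]; last first.
    by rewrite normr0 mulr_ge0// pow_exp_dist_ge0.
  rewrite inE => Au; have Su := AS u Au.
  rewrite !normrM (ger0_norm (p0 x)) (ger0_norm (psi0 u)).
  apply: (@le_trans _ _ (e2 * expR (- (c / 16 * (enorm (u - x) / l) ^+ d)) *
      (KF * enorm (u - x)) * pmax)).
    apply: ler_pM; rewrite ?mulr_ge0//; last exact: p_le.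
    apply: ler_pM => //; last exact: F_lip.
    apply: le_trans (psi_le u Su) _; rewrite ler_wpM2l//.
    by rewrite /pow_exp_dist expr0 mul1r.
  by rewrite le_eqVlt /pow_exp_dist expr1 /M2'; apply/orP; left; apply/eqP; ring.
have intphi : leb.-integrable [set: E] (EFin \o phi).
  apply: (integrable_le_EFin _ phi_le); first by case: bphi.
  exact: integrableZ_EFin.
pose phi' u := phi (x + x - u).
have refl u : x + x - u - x = - (u - x) by rewrite opprB addrAC addrK addrC.
have phi'_le u : `|phi' u| <= M2' * pow_exp_dist 1 (c / 16) l x u.
  apply: le_trans (phi_le (x + x - u)) _.
  by rewrite /pow_exp_dist refl enormN.
have intphi' : leb.-integrable [set: E] (EFin \o phi').
  apply: (integrable_le_EFin _ phi'_le); last exact: integrableZ_EFin.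
  case: bphi => mphi _; apply: (measurableT_comp mphi).
  exact: measurable_rVB.
have phiE : \int[leb]_u phi u = \int[leb]_u phi' u.
  by congr fine; exact: (integral_reflection (x + x) intphi).
have psi_refl u : psi (x + x - u) = psi u by rewrite /psi refl enormN.
have A_refl u : (x + x - u \in A) = (u \in A).
  by apply/idP/idP; rewrite !inE /A/= refl enormN.
(* [u] and [2 x - u] have the same weight, and the sum of their values of [F]
   is of second order *)
have sum_le u : `|phi u + phi' u| <= M2' * pow_exp_dist 2 (c / 8) l x u.
  rewrite /phi' !rphi A_refl; case: ifPn => [|_]; last first.
    by rewrite addr0 normr0 mulr_ge0// pow_exp_dist_ge0.
  move=> Au'; have := Au'; rewrite inE => Au; have Su := AS u Au.
  have Su' : S (x + x - u) by apply: AS; apply/set_mem; rewrite A_refl.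
  rewrite psi_refl -!mulrDl -mulrDr !normrM (ger0_norm (p0 x)) (ger0_norm (psi0 u)).
  apply: (@le_trans _ _ (e2 * expR (- (c / 8 * (enorm (u - x) / l) ^+ d)) *
      (KF * enorm (u - x) ^+ 2) * pmax)).
    apply: ler_pM; rewrite ?mulr_ge0//; last exact: p_le.
    apply: ler_pM => //; last exact: F_sym.
    by apply: le_trans (psi_le u Su) _; rewrite /pow_exp_dist expr0 mul1r.
  by rewrite le_eqVlt /pow_exp_dist /M2'; apply/orP; left; apply/eqP; ring.
have sym_le : `|\int[leb]_u phi u| <= M2' * (C2 * l ^+ (2 + d)).
  have -> : \int[leb]_u phi u = 2^-1 * \int[leb]_u (phi u + phi' u).
    by rewrite RintegralD// -phiE; lra.
  rewrite normrM ger0_norm// ler_pdivrMl//.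
  apply: (@le_trans _ _ (M2' * (C2 * l ^+ (2 + d)))); last first.
    rewrite ler_peMl ?ler1n// mulr_ge0// mulr_ge0 ?exprn_ge0//; exact: ltW.
  apply: (@le_trans _ _ (\int[leb]_u (M2' * pow_exp_dist 2 (c / 8) l x u))).
    apply: norm_Rintegral_le => //; first exact: integrableD_EFin.
    exact: integrableZ_EFin.
  by rewrite RintegralZl// ler_wpM2l.
pose ex := expR (- (c / 16 * (dl / l) ^+ d)).
have ex0 : 0 <= ex by exact: expR_ge0.
have diff_le u : `|H u - phi u| <= M2 * pow_exp_dist 2 (c / 8) l x u +
    M2' * ex * pow_exp_dist 1 (c / 16) l x u.
  have g2 : 0 <= M2 * pow_exp_dist 2 (c / 8) l x u.
    by rewrite mulr_ge0 ?pow_exp_dist_ge0.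
  have g1 : 0 <= M2' * ex * pow_exp_dist 1 (c / 16) l x u.
    by apply: mulr_ge0; [exact: mulr_ge0|exact: pow_exp_dist_ge0].
  have [Su|nSu] := pselect (S u); last first.
    rewrite /H rphi F_S; last by case.
    by rewrite !mulr0 !mul0r if_same subrr normr0 addr_ge0.
  have psi_le' : psi u <= e2 * expR (- (c / 8 * (enorm (u - x) / l) ^+ d)).
    by apply: le_trans (psi_le u Su) _; rewrite /pow_exp_dist expr0 mul1r.
  rewrite /H rphi; case: ifPn => [_|].
    rewrite -mulrBr -[leLHS]addr0; apply: lerD => //.
    rewrite !normrM (ger0_norm (psi0 u)).
    apply: (@le_trans _ _ (e2 * expR (- (c / 8 * (enorm (u - x) / l) ^+ d)) *
        (KF * enorm (u - x)) * (Lp * enorm (u - x)))).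
      apply: ler_pM; rewrite ?mulr_ge0//; last exact: p_lip.
      by apply: ler_pM => //; exact: F_lip.
    by rewrite le_eqVlt /pow_exp_dist /M2; apply/orP; left; apply/eqP; ring.
  rewrite notin_setE /A/= => /negP; rewrite -leNgt => dlu.
  rewrite subr0 -[leLHS]add0r; apply: lerD => //.
  rewrite !normrM (ger0_norm (psi0 u)) (ger0_norm (p0 u)).
  have exu : expR (- (c / 8 * (enorm (u - x) / l) ^+ d)) <=
      ex * expR (- (c / 16 * (enorm (u - x) / l) ^+ d)).
    rewrite -expRD ler_expR.
    have : (dl / l) ^+ d <= (enorm (u - x) / l) ^+ d.
      rewrite lerXn2r ?nnegrE ?divr_ge0 ?dist_compl_ge0 ?enorm_ge0 ?(ltW l0)//.
      by rewrite ler_pM2r ?invr_gt0.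
    by have := c0; set z := (dl / l) ^+ d; set w := _ ^+ d; nra.
  apply: (@le_trans _ _ (e2 * (ex * expR (- (c / 16 * (enorm (u - x) / l) ^+ d))) *
      (KF * enorm (u - x)) * pmax)).
    apply: ler_pM; rewrite ?mulr_ge0//; last exact: p_le.
    apply: ler_pM => //; last exact: F_lip.
    by apply: (le_trans psi_le'); rewrite ler_wpM2l.
  by rewrite le_eqVlt /pow_exp_dist expr1 /M2'; apply/orP; left; apply/eqP; ring.
(* on the ball only the variation of the density is left, off the ball
   everything *)
have rest_le : `|\int[leb]_u (H u - phi u)| <=
    M2 * (C2 * l ^+ (2 + d)) + M2' * ex * (C1 * l ^+ (1 + d)).
  apply: (@le_trans _ _ (\int[leb]_u (M2 * pow_exp_dist 2 (c / 8) l x u +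
      M2' * ex * pow_exp_dist 1 (c / 16) l x u))).
    apply: norm_Rintegral_le => //; first exact: integrableB_EFin.
    by apply: integrableD_EFin; exact: integrableZ_EFin.
  rewrite RintegralD//; [|exact: integrableZ_EFin|exact: integrableZ_EFin].
  by rewrite !RintegralZl//; apply: lerD; rewrite ler_wpM2l// mulr_ge0.
have -> : \int[leb]_u (psi u * F (x, u) * p u) =
    \int[leb]_u (H u - phi u) + \int[leb]_u phi u.
  by rewrite RintegralB// subrK.
apply: le_trans (ler_normD _ _) _; apply: le_trans (lerD rest_le sym_le) _.
rewrite -/ex !exprD expr1.
have ld0 : 0 <= l ^+ d by rewrite exprn_ge0 ?(ltW l0).
set X := l ^+ d in ld0 *.
have lX : 0 <= l ^+ 2 by rewrite exprn_ge0 ?(ltW l0).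
have h1 : 0 <= X * l ^+ 2 by rewrite mulr_ge0.
have h2 : 0 <= X * (l * ex) by rewrite mulr_ge0// mulr_ge0// ltW.
set D2 := (M2 + M2') * C2; set D1 := M2' * C1.
have D20 : 0 <= D2 by rewrite mulr_ge0 ?addr_ge0// ltW.
have D10 : 0 <= D1 by rewrite mulr_ge0// ltW.
rewrite [leLHS](_ : _ = D2 * (X * l ^+ 2) + D1 * (X * (l * ex))); last first.
  by rewrite /D2 /D1; ring.
rewrite [leRHS](_ : _ = (D2 + D1 + 1) * (X * l ^+ 2) +
  (D2 + D1 + 1) * (X * (l * ex))); last by ring.
apply: lerD.
  by rewrite ler_wpM2r//; lra.
by rewrite ler_wpM2r//; lra.
Qed.

End bias.

(** * Almost sure comparison and symmetrized double integrals *)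

Section almost_everywhere_bounds.
Context {R : realType} d (T : measurableType d) (mu : probability T R).

Lemma Rintegral_bmeas_sum (I : Type) (s : seq I) (f : I -> T -> R) :
  (forall i, bmeas (f i)) ->
  \int[mu]_x (\sum_(i <- s) f i x) = \sum_(i <- s) \int[mu]_x f i x.
Proof.
move=> bf; elim: s => [|i s ih].
  under eq_Rintegral do rewrite big_nil.
  by rewrite big_nil Rintegral_probability_cst.
under eq_Rintegral do rewrite big_cons.
rewrite big_cons -ih RintegralD//; apply: bmeas_integrable => //.
exact: bmeas_sum.
Qed.

Lemma bmeas_max (f g : T -> R) : bmeas f -> bmeas g -> bmeas (fun x => Num.max (f x) (g x)).
Proof.
move=> [mf [M fM]] [mg [N gN]]; split; first exact: measurable_maxr.
exists (Num.max M N) => x; rewrite /Num.max; case: ifP => _.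
  by rewrite (le_trans (gN x))// le_max lexx orbT.
by rewrite (le_trans (fM x))// le_max lexx.
Qed.

Lemma ae_le_Rintegral (f g : T -> R) : bmeas f -> bmeas g ->
  {ae mu, forall x, f x <= g x} -> \int[mu]_x f x <= \int[mu]_x g x.
Proof.
move=> bf bg fg; have bm := bmeas_max bf bg.
have -> : \int[mu]_x g x = \int[mu]_x (Num.max (f x) (g x)).
  congr fine; apply: ae_eq_integral => //.
  - by apply/measurable_EFinP; case: bg.
  - by apply/measurable_EFinP; case: bm.
  by apply: filterS fg => x fgx _; congr EFin; apply/esym/max_idPr.
apply: le_Rintegral => //; try exact: bmeas_integrable.
by move=> x _; rewrite le_max lexx.
Qed.

End almost_everywhere_bounds.

Section symmetrized.
Context {R : realType} d (T : measurableType d) (Q : probability T R).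

Lemma bmeas_symmetrized (a : R) (w : T * T -> R) : bmeas w ->
  bmeas (fun z : T * T => a * (w (z.1, z.2) + w (z.2, z.1))).
Proof.
move=> bw.
have bw1 : bmeas (fun z : T * T => w (z.1, z.2)) by under eq_fun do rewrite -surjective_pairing.
by apply: bmeasZ; apply: bmeasD; [exact: bw1|exact: bmeas_swap].
Qed.

(** By Fubini's theorem both orders of the arguments have the same double
    integral. *)
Lemma Rintegral_symmetrized_le (a c : R) (w : T * T -> R) : 0 <= a -> bmeas w ->
  (forall x, \int[Q]_x' w (x, x') <= c) ->
  \int[Q]_x \int[Q]_x' (a * (w (x, x') + w (x', x))) <= a * (2 * c).
Proof.
move=> a0 bw wc; have bw' := bmeas_swap bw.
have intsum x : \int[Q]_x' (a * (w (x, x') + w (x', x))) =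
    a * (\int[Q]_x' w (x, x') + \int[Q]_x' w (x', x)).
  have b1 := bmeas_slice1 x bw; have b2 := bmeas_slice1 x bw'.
  rewrite RintegralZl//; last by apply: bmeas_integrable; exact: (bmeasD b1 b2).
  by rewrite RintegralD//; apply: bmeas_integrable; [exact: b1|exact: b2].
under eq_Rintegral do rewrite intsum.
have b1 : bmeas (fun x => \int[Q]_x' w (x, x')) by exact: (bmeas_fubini Q bw).
have b2 : bmeas (fun x => \int[Q]_x' w (x', x)) by exact: (bmeas_fubini Q bw').
rewrite RintegralZl//; last by apply: bmeas_integrable; exact: (bmeasD b1 b2).
rewrite ler_wpM2l// RintegralD//; [|exact: bmeas_integrable|exact: bmeas_integrable].
rewrite -(Rintegral_fubini Q Q bw)/= -mulr2n -[leLHS]mulr_natl ler_wpM2l//.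
rewrite -[leRHS](Rintegral_probability_cst Q); apply: le_Rintegral => //.
- exact: bmeas_integrable.
- by apply: (bmeas_integrable Q (f := fun=> c)); exact: bmeas_cst.
Qed.

End symmetrized.

(** * Samples without ties *)

Section generic_sample.
Context {R : realType} {d n : nat} (d0 : (0 < d)%N).
Local Notation E := 'rV[R]_d.
Variables (S : set E) (P : probability E R) (p : E -> R).
Hypotheses (mS : measurable S) (PS : P S = 1%E) (Pp : has_density P p).

Lemma sphere_null x (r : R) : P [set u | enorm (u - x) = r] = 0%E.
Proof.
have [mp p0 PE] := Pp.
have mA : measurable [set u : E | enorm (u - x) = r].
  have := measurable_edist (@measurable_id _ _ setT) (measurable_cst x)
    measurableT (measurable_set1 r).
  by rewrite setTI.
rewrite PE//; apply: null_set_integral => //.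
  by apply/measurable_EFinP; exact: measurable_funTS.
exact: lebesgue_sphere.
Qed.

Definition generic_at (x : E) (X : n.-tuple E) :=
  (forall i, S (tnth X i)) /\ injective (dists X x).

(** A tie puts one point on a sphere determined by another one, and spheres are
    null sets. *)
Lemma generic_ae (mu : probability (n.-tuple E) R) x : resamplable mu P ->
  {ae mu, forall X, generic_at x X}.
Proof.
move=> muP.
have aeS : {ae mu, forall X, forall i, S (tnth X i)}.
  apply: filter_forall => i; exists [set X | ~ S (tnth X i)].
  have mA : measurable [set X : n.-tuple E | ~ S (tnth X i)].
    rewrite (_ : mkset _ = (fun X => tnth X i) @^-1` (~` S))//.
    rewrite -[X in measurable X]setTI; apply: measurable_tnth => //.
    exact: measurableC.
  split => //.
  rewrite (muP i)//.
  rewrite (_ : _ @^-1` _ = setT `*` ~` S); last first.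
    by apply/seteqP; split => -[X u] /=; rewrite tnth_upd eqxx => // -[].
  rewrite product_measure1E//; last exact: measurableC.
  rewrite [X in (_ * X)%E](_ : _ = 0%E) ?mule0//.
  transitivity (1 - P S)%E; first exact: probability_setC.
  by rewrite PS subee.
have aeT : {ae mu, forall X, forall i, forall j, i != j -> dists X x i != dists X x j}.
  apply: filter_forall => i; apply: filter_forall => j.
  have [->|ij] := eqVneq i j; first by apply: aeW => X.
  exists [set X | dists X x i = dists X x j].
  have mA : measurable [set X : n.-tuple E | dists X x i = dists X x j].
    rewrite (_ : mkset _ = setT `&` (fun X => dists X x i == dists X x j) @^-1` [set true]).
      apply: (measurable_fun_eqr _ _ measurableT (Y := [set true])) => //;
        exact: measurable_dists.
    apply/seteqP; split => X /=; last by move=> [_ /eqP].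
    by move=> XE; split => //; exact/eqP.
  split => //; last by move=> X /= h; apply: contrapT => /eqP; tauto.
  rewrite (muP i)// /product_measure1; apply: integral0_eq => X _ /=.
  rewrite -[RHS](sphere_null x (dists X x j)); congr (P _).
  by apply/seteqP; split => u; rewrite /xsection/= inE/= !dists_upd eqxx eq_sym (negbTE ij).
apply: filterS2 aeS aeT => X XS XT; split => // i j.
by apply: contra_eq => /XT.
Qed.

End generic_sample.

(** * Mean and variance of the integrated error *)

Section core.
Context {R : realType} {d : nat} (d0 : (0 < d)%N).
Local Notation E := 'rV[R]_d.
Variables (S : set E) (P Q : probability E R) (p : E -> R) (pmax Lp c : R).
Hypotheses (mS : measurable S) (PS : P S = 1%E).
Hypothesis Pp : has_density P p.
Hypothesis pmax0 : 0 <= pmax.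
Hypothesis p_le : forall x, S x -> p x <= pmax.
Hypothesis Lp0 : 0 <= Lp.
Hypothesis p_lip : forall x y, S x -> S y -> `|p x - p y| <= Lp * enorm (x - y).
Hypothesis c0 : 0 < c.
Hypothesis ball_ge : forall x u, S x -> S u ->
  c * enorm (u - x) ^+ d <= ball_mass P x (enorm (u - x)).
Variables (Dm cq : R).
Hypothesis S_diam : forall x u, S x -> S u -> enorm (u - x) <= Dm.
Hypothesis cq0 : 0 <= cq.
Hypothesis Q_ball : forall x r, 0 <= r -> (Q (ecball x r) <= (cq * r ^+ d)%:E)%E.
Hypothesis Q_boundary : forall a, 0 < a -> exists2 C : R, 0 <= C & forall l, 0 < l ->
  \int[Q]_x (\1_S x * expR (- (a * (dist_compl S x / l) ^+ d))) <= C * l.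
Variables (F : E * E -> R) (KF : R).
Hypothesis bF : bmeas F.
Hypothesis KF0 : 0 <= KF.
Hypothesis F_S : forall x u, ~ (S x /\ S u) -> F (x, u) = 0.
Hypothesis F_lip : forall x u, S x -> S u -> `|F (x, u)| <= KF * enorm (u - x).
Hypothesis F_sym : forall x u, S x -> S u -> S (x + x - u) ->
  `|F (x, u) + F (x, x + x - u)| <= KF * enorm (u - x) ^+ 2.

Section fixed_n.
Variable n : nat.
Implicit Types (X : n.-tuple E) (x : E) (i j : 'I_n) (k : nat).

Definition knn_avg k X x : R :=
  k%:R^-1 * \sum_(i < n) (rank (dists X x) i < k)%N%:R * F (x, tnth X i).

Definition knn_avg_but k j X x : R :=
  k%:R^-1 * \sum_(i < n | i != j)
    (rank_but (dists X x) j i < k)%N%:R * F (x, tnth X i).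

Definition knn_err k X : R := \int[Q]_x knn_avg k X x.

Definition knn_err_but k j X : R := \int[Q]_x knn_avg_but k j X x.

Let bmeasF_tnth i : bmeas (fun z : n.-tuple E * E => F (z.2, tnth z.1 i)).
Proof.
apply: (bmeas_comp _ bF); apply: measurable_fun_pair => //.
exact: (measurableT_comp (measurable_tnth i) measurable_fst).
Qed.

Lemma bmeas_knn_avg k : bmeas (fun z : n.-tuple E * E => knn_avg k z.1 z.2).
Proof.
apply: bmeasZ; apply: bmeas_sum => i; apply: bmeasM => //.
by apply: bmeas_bool; exact: (measurable_rank i (fun r => (r < k)%N)).
Qed.

Lemma bmeas_knn_avg_but k j : bmeas (fun z : n.-tuple E * E => knn_avg_but k j z.1 z.2).
Proof.
apply: bmeasZ; apply: bmeas_sum => i; apply: bmeasM => //.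
by apply: bmeas_bool; exact: (measurable_rank_but j i (fun r => (r < k)%N)).
Qed.

Lemma bmeas_knn_err k : bmeas (knn_err k).
Proof. exact: bmeas_fubini (bmeas_knn_avg k). Qed.

Lemma bmeas_knn_err_but k j : bmeas (knn_err_but k j).
Proof. exact: bmeas_fubini (bmeas_knn_avg_but k j). Qed.

Lemma knn_err_but_ignores k j : ignores j (knn_err_but k j).
Proof.
move=> X u; apply: eq_Rintegral => x _; congr (_ * _).
apply: eq_bigr => i ij; rewrite tnth_upd (negbTE ij).
rewrite (_ : rank_but _ _ _ = rank_but (dists X x) j i)//.
by apply: eq_bigr => l lj; rewrite !dists_upd (negbTE ij) (negbTE lj).
Qed.

(** Distance in [S], made bounded by vanishing outside. *)
Definition dS (z : E * E) : R := \1_S z.1 * \1_S z.2 * enorm (z.2 - z.1).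

Lemma dSE x u : S x -> S u -> dS (x, u) = enorm (u - x).
Proof. by move=> Sx Su; rewrite /dS !indicE !mem_set// !mul1r. Qed.

Lemma dS0 x u : ~ (S x /\ S u) -> dS (x, u) = 0.
Proof.
move=> nS; rewrite /dS !indicE.
have [xS|_] := boolP (x \in S); last by rewrite !mul0r.
have [uS|_] := boolP (u \in S); last by rewrite mulr0 mul0r.
by case: nS; split; exact: set_mem.
Qed.

Lemma dS_ge0 z : 0 <= dS z.
Proof. by rewrite mulr_ge0 ?enorm_ge0// mulr_ge0. Qed.

Lemma bmeas_dS : bmeas dS.
Proof.
split.
  apply: measurable_funM; last exact: measurable_edist.
  by apply: measurable_funM;
    [exact: (measurableT_comp (measurable_indic mS) measurable_fst)
    |exact: (measurableT_comp (measurable_indic mS) measurable_snd)].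
exists (Num.max Dm 0) => -[x u]; rewrite ger0_norm ?dS_ge0//.
have [[Sx Su]|nS] := pselect (S x /\ S u).
  by rewrite dSE// le_max S_diam.
by rewrite dS0// le_max lexx orbT.
Qed.

Lemma F_le_dS x u : `|F (x, u)| <= KF * dS (x, u).
Proof.
have [[Sx Su]|nS] := pselect (S x /\ S u); first by rewrite dSE//; exact: F_lip.
by rewrite F_S// dS0// normr0 mulr0.
Qed.

(** Distance from [x] to the point of rank [k], that is, to its neighbour
    number [k + 1]; a sum over the sample is measurable and bounded without any
    choice of that point. *)
Definition knn_radius_S k X x : R :=
  \sum_(i < n) (rank (dists X x) i == k)%:R * dS (x, tnth X i).

Lemma knn_radius_S_ge0 k X x : 0 <= knn_radius_S k X x.
Proof. by apply: sumr_ge0 => i _; rewrite mulr_ge0 ?dS_ge0. Qed.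

Lemma bmeas_knn_radius_S k : bmeas (fun z : n.-tuple E * E => knn_radius_S k z.1 z.2).
Proof.
apply: bmeas_sum => i; apply: bmeasM.
  by apply: bmeas_bool; exact: (measurable_rank i (fun r => r == k)).
apply: (bmeas_comp _ bmeas_dS); apply: measurable_fun_pair => //.
exact: (measurableT_comp (measurable_tnth i) measurable_fst).
Qed.

Lemma knn_radius_SE k X x i : generic_at S x X -> S x ->
  rank (dists X x) i = k -> knn_radius_S k X x = dists X x i.
Proof.
move=> [XS inj] Sx ri; rewrite /knn_radius_S (bigD1 i)//= ri eqxx mul1r dSE//.
rewrite big1 ?addr0// => l li; case: eqP => [rl|_]; last by rewrite mul0r.
by case/eqP: li; apply: (rank_inj inj); rewrite rl ri.
Qed.

(** By [leave_one_out], only the terms of [X_j] and of the point of rank [k]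
    differ, and both points are within the radius. *)
Lemma knn_avg_diff k j X x : generic_at S x X -> S x -> (0 < k < n)%N ->
  `|knn_avg k X x - knn_avg_but k j X x| <=
    2 * KF / k%:R * ((rank (dists X x) j < k)%N%:R * knn_radius_S k X x).
Proof.
move=> gX Sx /andP[k0 kn]; have [XS inj] := gX.
have [i0 ri0] := rank_surj inj kn.
have tE := knn_radius_SE gX Sx ri0.
have t0 := knn_radius_S_ge0 k X x.
rewrite /knn_avg /knn_avg_but -mulrBr leave_one_out// normrM ger0_norm ?invr_ge0//.
rewrite [leRHS](_ : _ = k%:R^-1 *
  ((rank (dists X x) j < k)%N%:R * (KF * knn_radius_S k X x + KF * knn_radius_S k X x))); last by ring.
rewrite ler_wpM2l ?invr_ge0// normrM ger0_norm//.
have [jk|_] := ltnP (rank (dists X x) j) k; last by rewrite !mul0r.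
rewrite !mul1r; apply: le_trans (ler_normB _ _) _; apply: lerD.
  apply: le_trans (F_le_dS _ _) _; rewrite ler_wpM2l// dSE// tE.
  by apply/ltW/ltn_rank; rewrite ri0.
apply: le_trans (ler_norm_sum _ _ _) _; rewrite /knn_radius_S mulr_sumr.
apply: ler_sum => i _; rewrite normrM ger0_norm// mulrCA ler_wpM2l//.
exact: F_le_dS.
Qed.

(** Two query points sharing [X_j] among their neighbours are within the sum of
    their radii, hence within twice the larger one. *)
Lemma shared_neighbours k X x x' : generic_at S x X -> generic_at S x' X ->
  S x -> S x' -> (0 < k < n)%N ->
  \sum_(j < n) ((rank (dists X x) j < k)%N%:R * knn_radius_S k X x) *
     ((rank (dists X x') j < k)%N%:R * knn_radius_S k X x') <=
  k%:R * ((enorm (x' - x) <= 2 * knn_radius_S k X x)%R%:R * knn_radius_S k X x ^+ 2 +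
          (enorm (x - x') <= 2 * knn_radius_S k X x')%R%:R * knn_radius_S k X x' ^+ 2).
Proof.
move=> gX gX' Sx Sx' /andP[k0 kn].
have [XS inj] := gX; have [_ inj'] := gX'.
have [i0 ri0] := rank_surj inj kn; have tE := knn_radius_SE gX Sx ri0.
have [i1 ri1] := rank_surj inj' kn; have tE' := knn_radius_SE gX' Sx' ri1.
set t := knn_radius_S k X x in tE *; set t' := knn_radius_S k X x' in tE' *.
have t0 : 0 <= t by exact: knn_radius_S_ge0.
have t'0 : 0 <= t' by exact: knn_radius_S_ge0.
rewrite -[X in _ <= X%:R * _](card_rank_lt inj (ltnW kn)) natr_sum mulr_suml.
apply: ler_sum => j _.
have [jk|_] := ltnP (rank (dists X x) j) k; last by rewrite !mul0r.
rewrite !mul1r.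
have nn : 0 <= (enorm (x' - x) <= 2 * t)%R%:R * t ^+ 2 +
    (enorm (x - x') <= 2 * t')%R%:R * t' ^+ 2.
  by rewrite addr_ge0// mulr_ge0// sqr_ge0.
have [jk'|_] := ltnP (rank (dists X x') j) k; last by rewrite !mul0r mulr0.
rewrite mul1r.
have tj : dists X x j <= t by rewrite tE; apply/ltW/ltn_rank; rewrite ri0.
have tj' : dists X x' j <= t' by rewrite tE'; apply/ltW/ltn_rank; rewrite ri1.
have xx' : enorm (x' - x) <= t + t'.
  apply: le_trans (enorm_triangle x' (tnth X j) x) _.
  by rewrite addrC enormB [enorm (x' - _)]enormB lerD// enormB.
have [tt'|/ltW t't] := leP t t'.
  have -> : (enorm (x - x') <= 2 * t')%R by rewrite enormB (le_trans xx')//; lra.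
  rewrite mul1r -[leLHS]add0r; apply: lerD; first by rewrite mulr_ge0// sqr_ge0.
  by rewrite expr2 ler_wpM2r.
have -> : (enorm (x' - x) <= 2 * t)%R by rewrite (le_trans xx')//; lra.
rewrite mul1r -[leLHS]addr0; apply: lerD; last by rewrite mulr_ge0// sqr_ge0.
by rewrite expr2 ler_wpM2l.
Qed.

(** The [k + 1] points of ranks [k] to [2 k] are all at least as far as the one
    of rank [k]; the radius is thus controlled by sums over the sample, whose
    means are computable. *)
Lemma knn_radius_S_pow_le k X x s : generic_at S x X -> S x ->
  (0 < k)%N -> (2 * k < n)%N ->
  k.+1%:R * knn_radius_S k X x ^+ s <=
    \sum_(i < n) (rank (dists X x) i < (2 * k).+1)%N%:R * dS (x, tnth X i) ^+ s.
Proof.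
move=> gX Sx k0 kn; have [XS inj] := gX.
have kn' : (k < n)%N by lia.
have [i0 ri0] := rank_surj inj kn'; have tE := knn_radius_SE gX Sx ri0.
have t0 := knn_radius_S_ge0 k X x.
pose far i := (k <= rank (dists X x) i < (2 * k).+1)%N.
have <- : (\sum_(i < n) far i)%N = k.+1.
  have h1 := card_rank_lt inj kn; have h2 := card_rank_lt inj (ltnW kn').
  have : (\sum_(i < n) (rank (dists X x) i < (2 * k).+1) =
     \sum_(i < n) (rank (dists X x) i < k) + \sum_(i < n) far i)%N.
    rewrite -big_split/=; apply: eq_bigr => i _; rewrite /far.
    case: (leqP k (rank (dists X x) i)) => [_|h]; first by rewrite add0n.
    by rewrite (leq_trans h)//; lia.
  by rewrite h1 h2; lia.
rewrite natr_sum mulr_suml; apply: ler_sum => i _.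
rewrite /far; case: (leqP k _) => [ki|_]/=; last by rewrite mul0r mulr_ge0 ?exprn_ge0 ?dS_ge0.
rewrite ler_wpM2l// lerXn2r ?nnegrE ?dS_ge0// dSE// tE leNgt.
by apply/negP => /rank_mono; rewrite ri0 ltnNge ki.
Qed.

End fixed_n.

Lemma scale_le n k (l : R) : scale_of d n k l -> k%:R^-1 * n%:R * l ^+ d <= 1.
Proof.
move=> [/andP[k0 kn] l0 ->].
have k0' : 0 < k%:R :> R by rewrite ltr0n.
rewrite (_ : _ * _ = n%:R / n.+1%:R).
  by rewrite ler_pdivrMr// mul1r ler_nat.
by rewrite mulrACA mulVf ?mul1r// gt_eqF.
Qed.

(** Integrate [knn_bias_at] over the query points: its second term becomes [l]
    times the mass, of order [l], of a boundary layer of width [l]. *)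
Lemma knn_err_mean : exists2 C : R, 0 <= C &
  forall n k l (mu : probability (n.-tuple E) R),
  resamplable mu P -> scale_of d n k l -> `|\int[mu]_X knn_err k X| <= C * l ^+ 2.
Proof.
have [C C0 CP] := knn_bias_at d0 Pp pmax0 p_le Lp0 p_lip c0 ball_ge bF KF0 F_S F_lip F_sym.
have c160 : 0 < c / 16 by rewrite divr_gt0.
have [Cb Cb0 CbP] := Q_boundary c160.
exists (C * (1 + Cb)) => [|n k l mu muP sc].
  by rewrite mulr_ge0 ?addr_ge0// ltW.
have [/andP[k0 kn] l0 lE] := sc.
rewrite /knn_err (Rintegral_fubini mu Q (bmeas_knn_avg n k))/=.
pose ex x : R := \1_S x * expR (- (c / 16 * (dist_compl S x / l) ^+ d)).
have ex0 x : 0 <= ex x by rewrite mulr_ge0 ?expR_ge0.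
have bex : bmeas ex.
  split.
    apply: measurable_funM; first exact: measurable_indic.
    apply: measurableT_comp => //; apply: measurableT_comp => //.
    apply: measurable_funM => //; apply: measurable_funX.
    by apply: measurable_funM => //; exact: measurable_dist_compl.
  exists 1 => x; rewrite ger0_norm// -[leRHS]mulr1 ler_pM ?expR_ge0//.
  rewrite expR_le1 oppr_le0 mulr_ge0 ?exprn_ge0 ?divr_ge0 ?dist_compl_ge0 ?(ltW l0)//.
  exact: ltW.
have bm x := bmeas_slice2 x (bmeas_knn_avg n k).
have pointwise x : `|\int[mu]_X knn_avg k X x| <= C * (l ^+ 2 + l * ex x).
  have [Sx|nSx] := pselect (S x); last first.
    rewrite (_ : \int[mu]_X _ = 0).
      by rewrite normr0 mulr_ge0 ?(ltW C0)// addr_ge0 ?mulr_ge0 ?exprn_ge0 ?(ltW l0).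
    rewrite -[RHS](Rintegral_probability_cst mu); apply: eq_Rintegral => X _.
    rewrite /knn_avg big1 ?mulr0// => i _; rewrite F_S ?mulr0//; tauto.
  have -> : \int[mu]_X knn_avg k X x = k%:R^-1 *
      \sum_(i < n) \int[P]_u (few_near mu x i k (enorm (u - x)) * F (x, u)).
    have bi i : bmeas (fun X : n.-tuple E => (rank (dists X x) i < k)%N%:R * F (x, tnth X i)).
      apply: bmeasM; last by apply: (bmeas_comp _ (bmeasF bF x)); exact: measurable_tnth.
      by apply: bmeas_bool; exact: (measurable_rank i (fun r => (r < k)%N)).
    rewrite RintegralZl//; last by apply: bmeas_integrable; exact: bmeas_sum.
    congr (_ * _); rewrite Rintegral_bmeas_sum//; apply: eq_bigr => i _.
    by rewrite (knn_mean muP x i k (bmeasF bF x)).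
  rewrite normrM ger0_norm ?invr_ge0//.
  have exE : ex x = expR (- (c / 16 * (dist_compl S x / l) ^+ d)).
    by rewrite /ex indicE mem_set// mul1r.
  apply: (@le_trans _ _ (k%:R^-1 * \sum_(i < n) (C * l ^+ d * (l ^+ 2 + l * ex x)))).
    rewrite ler_wpM2l ?invr_ge0//; apply: le_trans (ler_norm_sum _ _ _) _.
    by apply: ler_sum => i _; rewrite exE; exact: CP.
  rewrite sumr_const card_ord -[X in _ * X <= _]mulr_natl.
  rewrite [leLHS](_ : _ = (k%:R^-1 * n%:R * l ^+ d) * (C * (l ^+ 2 + l * ex x))); last by ring.
  rewrite ler_piMl ?(scale_le sc)// mulr_ge0 ?(ltW C0)//.
  by rewrite addr_ge0 ?mulr_ge0 ?exprn_ge0 ?(ltW l0).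
have bme : bmeas (fun x => \int[mu]_X knn_avg k X x).
  apply: (@bmeas_fubini _ _ _ _ _ mu (fun z : E * n.-tuple E => knn_avg k z.2 z.1)).
  exact: (bmeas_swap (bmeas_knn_avg n k)).
apply: (@le_trans _ _ (\int[Q]_x (C * (l ^+ 2 + l * ex x)))).
  apply: norm_Rintegral_le => //; apply: bmeas_integrable => //.
  by apply: bmeasZ; apply: bmeasD; [exact: bmeas_cst|exact: bmeasZ].
rewrite RintegralZl//; last first.
  apply: (bmeas_integrable Q (f := fun x => l ^+ 2 + l * ex x)).
  by apply: bmeasD; [exact: bmeas_cst|exact: bmeasZ].
rewrite RintegralD//; last 2 first.
- by apply: (bmeas_integrable Q (f := fun=> l ^+ 2)); exact: bmeas_cst.
- by apply: bmeas_integrable; exact: bmeasZ.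
rewrite RintegralZl//; last exact: bmeas_integrable.
rewrite Rintegral_probability_cst -mulrA ler_wpM2l ?(ltW C0)//.
rewrite mulrDl mul1r lerD2l [leRHS](_ : _ = l * (Cb * l)); last by ring.
by rewrite ler_wpM2l ?(ltW l0)//; exact: CbP.
Qed.

(** By [knn_radius_S_pow_le] a sum over the [2 k + 1] nearest neighbours is to
    be bounded, which is [knn_moment] with [K = 2 k + 1]. *)
Lemma knn_radius_moment s : (0 < s)%N -> exists2 C : R, 0 <= C &
  forall n k l (mu : probability (n.-tuple E) R) x,
  resamplable mu P -> scale_of d n k l -> (2 * k < n)%N -> S x ->
  \int[mu]_X (knn_radius_S k X x ^+ s) <= C * l ^+ s.
Proof.
move=> s0.
have [C C0 CP] := knn_moment d0 Pp pmax0 p_le Lp0 c0 ball_ge s.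
exists C => [|n k l mu x muP sc kn Sx]; first exact: ltW.
have [/andP[k0 kn'] l0 lE] := sc.
have bG : bmeas (fun u => dS (x, u) ^+ s) by apply: bmeasX; exact: bmeas_slice1 bmeas_dS.
have bi i : bmeas (fun X : n.-tuple E =>
    (rank (dists X x) i < (2 * k).+1)%N%:R * dS (x, tnth X i) ^+ s).
  apply: bmeasM; last by apply: (bmeas_comp _ bG); exact: measurable_tnth.
  by apply: bmeas_bool; exact: (measurable_rank i (fun r => (r < (2 * k).+1)%N)).
have bt : bmeas (fun X : n.-tuple E => knn_radius_S k X x ^+ s).
  by apply: bmeasX; exact: (bmeas_slice2 x (bmeas_knn_radius_S n k)).
have h1 : k.+1%:R * \int[mu]_X (knn_radius_S k X x ^+ s) <=
    \sum_(i < n) \int[P]_u (few_near mu x i (2 * k).+1 (enorm (u - x)) * dS (x, u) ^+ s).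
  rewrite -RintegralZl//; last exact: bmeas_integrable.
  apply: (@le_trans _ _ (\int[mu]_X (\sum_(i < n)
      (rank (dists X x) i < (2 * k).+1)%N%:R * dS (x, tnth X i) ^+ s))).
    apply: ae_le_Rintegral; [exact: bmeasZ|exact: bmeas_sum|].
    apply: filterS (generic_ae d0 mS PS Pp x muP) => X gX.
    exact: knn_radius_S_pow_le.
  rewrite Rintegral_bmeas_sum//; apply: ler_sum => i _.
  by rewrite (knn_mean muP x i (2 * k).+1 bG).
have h2 : k.+1%:R * \int[mu]_X (knn_radius_S k X x ^+ s) <=
    \sum_(i < n) (1 * C * l ^+ (s + d)).
  apply: (le_trans h1); apply: ler_sum => i _.
  apply: le_trans (ler_norm _) _; apply: (CP n k l) => //.
  - by clear -k0; lia.
  - by move=> u Su; rewrite dSE// ger0_norm ?mul1r// exprn_ge0 ?enorm_ge0.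
  - by move=> u nSu; rewrite dS0 ?expr0n ?gtn_eqF//; tauto.
rewrite sumr_const card_ord -[X in _ <= X]mulr_natl mul1r in h2.
have kp : 0 < k.+1%:R :> R by [].
rewrite -(ler_pM2l kp); apply: (le_trans h2).
have h3 := scale_le sc.
rewrite exprD [leLHS](_ : _ = (k%:R * (k%:R^-1 * n%:R * l ^+ d)) * (C * l ^+ s)); last first.
  by field; rewrite pnatr_eq0 -lt0n.
apply: ler_wpM2r; first by rewrite mulr_ge0 ?exprn_ge0 ?(ltW C0) ?(ltW l0).
apply: (@le_trans _ _ (k%:R * 1)); first by rewrite ler_wpM2l.
by rewrite mulr1 ler_nat.
Qed.

Lemma knn_avg_outside n k (X : n.-tuple E) x : ~ S x -> knn_avg k X x = 0.
Proof. by move=> nS; rewrite /knn_avg big1 ?mulr0// => i _; rewrite F_S ?mulr0//; tauto. Qed.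

Lemma knn_avg_but_outside n k j (X : n.-tuple E) x : ~ S x -> knn_avg_but k j X x = 0.
Proof. by move=> nS; rewrite /knn_avg_but big1 ?mulr0// => i _; rewrite F_S ?mulr0//; tauto. Qed.

Lemma knn_radius_S_outside n k (X : n.-tuple E) x : ~ S x -> knn_radius_S k X x = 0.
Proof. by move=> nS; rewrite /knn_radius_S big1// => i _; rewrite dS0 ?mulr0//; tauto. Qed.

Section variance.
Variables (n k : nat) (l Cm : R) (mu : probability (n.-tuple E) R).
Hypotheses (muP : resamplable mu P) (k0 : (0 < k)%N) (kn : (2 * k < n)%N).
Hypothesis radius_moment : forall x, S x ->
  \int[mu]_X (knn_radius_S k X x ^+ (d + 2)) <= Cm.
Hypothesis Cm0 : 0 <= Cm.

Let D j (X : n.-tuple E) x := knn_avg k X x - knn_avg_but k j X x.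
Let N (X : n.-tuple E) x x' := \sum_(j < n) D j X x * D j X x'.
Let W (X : n.-tuple E) x x' : R :=
  (enorm (x' - x) <= 2 * knn_radius_S k X x)%R%:R * knn_radius_S k X x ^+ 2.
Let w x x' := \int[mu]_X W X x x'.

Let bD j : bmeas (fun z : n.-tuple E * E => D j z.1 z.2).
Proof. by apply: bmeasB; [exact: bmeas_knn_avg|exact: bmeas_knn_avg_but]. Qed.

Let bDx j X : bmeas (D j X).
Proof. exact: (bmeas_slice1 X (bD j)). Qed.

Let bN : bmeas (fun z : (n.-tuple E * E) * E => N z.1.1 z.1.2 z.2).
Proof.
apply: bmeas_sum => j; apply: bmeasM.
  exact: (bmeas_comp measurable_fst (bD j)).
have mp : measurable_fun [set: (n.-tuple E * E) * E] (fun z => (z.1.1, z.2)).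
  apply: measurable_fun_pair => //; exact: (measurableT_comp measurable_fst measurable_fst).
exact: (bmeas_comp mp (bD j)).
Qed.

Let bW : bmeas (fun z : (E * E) * n.-tuple E => W z.2 z.1.1 z.1.2).
Proof.
have m1 : measurable_fun [set: (E * E) * n.-tuple E] (fun z => (z.2, z.1.1)).
  apply: measurable_fun_pair => //; exact: (measurableT_comp measurable_fst measurable_fst).
have bt := bmeas_comp m1 (bmeas_knn_radius_S n k).
apply: bmeasM; last by apply: bmeasX; exact: bt.
apply: bmeas_bool; apply: measurable_fun_ler.
  apply: measurable_edist; last exact: (measurableT_comp measurable_fst measurable_fst).
  exact: (measurableT_comp measurable_snd measurable_fst).
by have [mt _] := bmeasZ 2 bt; exact: mt.
Qed.

Let bw : bmeas (fun z : E * E => w z.1 z.2).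
Proof. exact: bmeas_fubini bW. Qed.

Let w_ge0 x x' : 0 <= w x x'.
Proof. by apply: Rintegral_ge0 => X _; rewrite mulr_ge0// sqr_ge0. Qed.

Let mean_N x x' : \int[mu]_X N X x x' <= 4 * KF ^+ 2 / k%:R * (w x x' + w x' x).
Proof.
have K0 : 0 <= 4 * KF ^+ 2 / k%:R by rewrite !mulr_ge0 ?sqr_ge0 ?invr_ge0.
have [[Sx Sx']|nS] := pselect (S x /\ S x'); last first.
  rewrite (_ : \int[mu]_X _ = 0); first by rewrite mulr_ge0// addr_ge0.
  rewrite -[RHS](Rintegral_probability_cst mu); apply: eq_Rintegral => X _.
  rewrite /N big1// => j _.
  have [Sx|nSx] := pselect (S x); last first.
    by rewrite /D knn_avg_outside// knn_avg_but_outside// subrr mul0r.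
  have nSx' : ~ S x' by tauto.
  by rewrite /D (knn_avg_outside _ _ nSx')// (knn_avg_but_outside _ _ _ nSx') subrr mulr0.
have bNx : bmeas (fun X => N X x x') by exact: (bmeas_slice2 x (bmeas_slice2 x' bN)).
have bWx y y' : bmeas (fun X => W X y y') by exact: (bmeas_slice1 (y, y') bW).
rewrite /w -RintegralD//; last 2 first.
- exact: bmeas_integrable.
- exact: bmeas_integrable.
rewrite -RintegralZl//; last by apply: bmeas_integrable; exact: bmeasD.
apply: ae_le_Rintegral => //; first by apply: bmeasZ; exact: bmeasD.
apply: filterS2 (generic_ae d0 mS PS Pp x muP) (generic_ae d0 mS PS Pp x' muP) => X gX gX'.
have kkn : (0 < k < n)%N by rewrite k0/=; clear -kn; lia.
have h := shared_neighbours gX gX' Sx Sx' kkn.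
have KF20 : 0 <= 2 * KF / k%:R by rewrite !mulr_ge0 ?invr_ge0.
apply: (@le_trans _ _ ((2 * KF / k%:R) ^+ 2 *
    \sum_(j < n) ((rank (dists X x) j < k)%N%:R * knn_radius_S k X x) *
     ((rank (dists X x') j < k)%N%:R * knn_radius_S k X x'))).
  rewrite mulr_sumr; apply: ler_sum => j _.
  apply: le_trans (ler_norm _) _; rewrite normrM expr2.
  rewrite mulrACA; apply: ler_pM => //; exact: knn_avg_diff.
apply: le_trans (ler_wpM2l (sqr_ge0 _) h) _.
rewrite /W le_eqVlt; apply/orP; left; apply/eqP.
by field; rewrite pnatr_eq0 -lt0n.
Qed.

(** Integrate over [x'] first: it ranges over a ball of radius twice that of
    [x]. *)
Let mean_w x : \int[Q]_x' w x x' <= cq * 2 ^+ d * Cm.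
Proof.
have C0 : 0 <= cq * 2 ^+ d by rewrite mulr_ge0 ?exprn_ge0.
have bWX : bmeas (fun z : E * n.-tuple E => W z.2 x z.1).
  have mp : measurable_fun [set: E * n.-tuple E] (fun z => ((x, z.1), z.2)).
    by apply: measurable_fun_pair => //; apply: measurable_fun_pair.
  exact: (bmeas_comp mp bW).
rewrite /w (Rintegral_fubini Q mu bWX)/=.
have bt : bmeas (fun X : n.-tuple E => knn_radius_S k X x).
  exact: (bmeas_slice2 x (bmeas_knn_radius_S n k)).
apply: (@le_trans _ _ (\int[mu]_X (cq * 2 ^+ d * knn_radius_S k X x ^+ (d + 2)))).
  apply: le_Rintegral => //.
  - apply: bmeas_integrable.
    exact: (bmeas_fubini Q (bmeas_swap bWX)).
  - by apply: bmeas_integrable; apply: bmeasZ; exact: bmeasX.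
  move=> X _; set t := knn_radius_S k X x.
  have t0 : 0 <= t by exact: knn_radius_S_ge0.
  have mb := measurable_ecball x (2 * t).
  rewrite (_ : \int[Q]_x0 _ = fine (Q (ecball x (2 * t))) * t ^+ 2); last first.
    rewrite /W RintegralZr//; last first.
      apply: bmeas_integrable; apply: bmeas_bool.
      by apply: measurable_fun_ler => //; exact: measurable_edist.
    congr (_ * _); congr fine.
    rewrite -[X in Q X]setIT -integral_indic//; apply: eq_integral => v _.
    by rewrite indicE; congr ((nat_of_bool _)%:R%:E); apply/idP/idP; rewrite inE.
  rewrite exprD mulrA ler_wpM2r ?sqr_ge0//.
  rewrite -mulrA -exprMn -lee_fin fineK; last exact: fin_num_measure.
  by apply: Q_ball; rewrite mulr_ge0.
rewrite RintegralZl//; last by apply: bmeas_integrable; exact: bmeasX.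
rewrite ler_wpM2l//; have [Sx|nSx] := pselect (S x); first exact: radius_moment.
rewrite (_ : \int[mu]_X _ = 0)// -[RHS](Rintegral_probability_cst mu).
by apply: eq_Rintegral => X _; rewrite knn_radius_S_outside// addn2 exprS mul0r.
Qed.

(** The square of an integral over the query points is a double integral; once
    summed over [j], only pairs of query points sharing neighbours
    contribute. *)
Lemma knn_err_variance_aux :
  \sum_(j < n) \int[mu]_X ((knn_err k X - knn_err_but k j X) ^+ 2) <=
    4 * KF ^+ 2 / k%:R * (2 * (cq * 2 ^+ d * Cm)).
Proof.
have K0 : 0 <= 4 * KF ^+ 2 / k%:R by rewrite !mulr_ge0 ?sqr_ge0 ?invr_ge0.
have bNX X : bmeas (fun z : E * E => N X z.1 z.2).
  have mp : measurable_fun [set: E * E] (fun z => ((X, z.1), z.2)).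
    by apply: measurable_fun_pair => //; apply: measurable_fun_pair.
  exact: (bmeas_comp mp bN).
have sumE X : \sum_(j < n) (knn_err k X - knn_err_but k j X) ^+ 2 =
    \int[Q]_x \int[Q]_x' N X x x'.
  have bDD j : bmeas (fun z : E * E => D j X z.1 * D j X z.2).
    by apply: bmeasM; [exact: (bmeas_comp measurable_fst (bDx j X))
                      |exact: (bmeas_comp measurable_snd (bDx j X))].
  transitivity (\sum_(j < n) \int[Q]_x \int[Q]_x' (D j X x * D j X x')).
    apply: eq_bigr => j _.
    have -> : knn_err k X - knn_err_but k j X = \int[Q]_x D j X x.
      rewrite RintegralB//; apply: bmeas_integrable.
        exact: (bmeas_slice1 X (bmeas_knn_avg n k)).
      exact: (bmeas_slice1 X (bmeas_knn_avg_but k j)).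
    rewrite expr2 -RintegralZr//; last exact: bmeas_integrable.
    by apply: eq_Rintegral => x _; rewrite RintegralZl//; exact: bmeas_integrable.
  rewrite -Rintegral_bmeas_sum; last by move=> j; exact: (bmeas_fubini Q (bDD j)).
  apply: eq_Rintegral => x _; rewrite -Rintegral_bmeas_sum// => j.
  by apply: bmeasZ; exact: bDx.
rewrite -Rintegral_bmeas_sum; last first.
  move=> j; apply: bmeasX; apply: bmeasB; first exact: bmeas_knn_err.
  exact: bmeas_knn_err_but.
under eq_Rintegral do rewrite sumE.
have bN1 := bmeas_fubini Q bN.
rewrite (Rintegral_fubini mu Q bN1)/=.
have bN2 x : bmeas (fun z : n.-tuple E * E => N z.1 x z.2).
  have mp : measurable_fun [set: n.-tuple E * E] (fun z => ((z.1, x), z.2)).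
    by apply: measurable_fun_pair => //; apply: measurable_fun_pair.
  exact: (bmeas_comp mp bN).
under eq_Rintegral do rewrite (Rintegral_fubini mu Q (bN2 _))/=.
have bNm : bmeas (fun z : E * E => \int[mu]_X N X z.1 z.2).
  apply: (@bmeas_fubini _ _ _ _ _ mu (fun y : (E * E) * n.-tuple E => N y.2 y.1.1 y.1.2)).
  have mp : measurable_fun [set: (E * E) * n.-tuple E] (fun y => ((y.2, y.1.1), y.1.2)).
    apply: measurable_fun_pair.
      apply: measurable_fun_pair => //.
      exact: (measurableT_comp measurable_fst measurable_fst).
    exact: (measurableT_comp measurable_snd measurable_fst).
  exact: (bmeas_comp mp bN).
apply: (@le_trans _ _ (\int[Q]_x \int[Q]_x' (4 * KF ^+ 2 / k%:R * (w x x' + w x' x)))).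
  have bs := bmeas_symmetrized (4 * KF ^+ 2 / k%:R) bw.
  apply: le_Rintegral => //.
  - by apply: bmeas_integrable; exact: (bmeas_fubini Q bNm).
  - by apply: bmeas_integrable; exact: (bmeas_fubini Q bs).
  move=> x _; apply: le_Rintegral => //; apply: bmeas_integrable.
    exact: bmeas_slice1 bNm.
  exact: (bmeas_slice1 x bs).
exact: (Rintegral_symmetrized_le K0 bw mean_w).
Qed.

End variance.

Lemma knn_err_variance : exists2 C : R, 0 <= C &
  forall n k l (mu : probability (n.-tuple E) R),
  resamplable mu P -> scale_of d n k l -> (2 * k < n)%N ->
  \sum_(j < n) \int[mu]_X ((knn_err k X - knn_err_but k j X) ^+ 2) <=
    C * l ^+ (d + 2).
Proof.
have [|C C0 CP] := @knn_radius_moment (d + 2); first by rewrite addn2.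
exists (4 * KF ^+ 2 * (2 * (cq * 2 ^+ d * C))).
  by rewrite !mulr_ge0 ?sqr_ge0 ?exprn_ge0.
move=> n k l mu muP sc kn; have [/andP[k0 _] l0 _] := sc.
have Cl : 0 <= C * l ^+ (d + 2) by rewrite mulr_ge0 ?exprn_ge0 ?(ltW l0).
apply: le_trans (knn_err_variance_aux muP k0 kn _ Cl) _.
  by move=> x Sx; exact: CP.
rewrite [leLHS](_ : _ = k%:R^-1 *
  (4 * KF ^+ 2 * (2 * (cq * 2 ^+ d * C)) * l ^+ (d + 2))); last by ring.
rewrite ler_piMl//; last by rewrite invf_le1 ?ltr0n// ler1n.
by rewrite !mulr_ge0 ?sqr_ge0 ?exprn_ge0 ?(ltW l0).
Qed.

(** [efron_stein] adds the squared mean and the variance when [2 k < n];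
    otherwise [l] is bounded below, and bounding the average by the supremum of
    [F] is enough. *)
Theorem knn_err_second_moment : exists2 C : R, 0 <= C &
  forall n k l (mu : probability (n.-tuple E) R),
  resamplable mu P -> scale_of d n k l ->
  \int[mu]_X (knn_err k X ^+ 2) <= C * (l ^+ 4 + l ^+ (d + 2)).
Proof.
have [C1 C10 C1P] := knn_err_mean; have [C2 C20 C2P] := knn_err_variance.
have [_ [M FM]] := bF.
have M0 : 0 <= M by apply: le_trans (FM (0, 0)).
exists (C1 ^+ 2 + C2 + 256 * M ^+ 2) => [|n k l mu muP sc].
  apply: addr_ge0; last by apply: mulr_ge0 => //; exact: sqr_ge0.
  by apply: addr_ge0 => //; exact: sqr_ge0.
have [/andP[k0 kn] l0 lE] := sc.
have l4 : 0 <= l ^+ 4 by rewrite exprn_ge0 ?(ltW l0).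
have ld2 : 0 <= l ^+ (d + 2) by rewrite exprn_ge0 ?(ltW l0).
have C12 := sqr_ge0 C1; have M2 := sqr_ge0 M.
have [kn2|kn2] := ltnP (2 * k) n.
  have := efron_stein muP (bmeas_knn_err n k) (fun j => bmeas_knn_err_but k j)
    (fun j => @knn_err_but_ignores n k j).
  move/le_trans; apply.
  have h1 : (\int[mu]_X knn_err k X) ^+ 2 <= C1 ^+ 2 * l ^+ 4.
    rewrite -(real_normK (num_real _)).
    rewrite (_ : C1 ^+ 2 * l ^+ 4 = (C1 * l ^+ 2) ^+ 2); last by ring.
    apply: lerXn2r; rewrite ?nnegrE; [exact: normr_ge0|by apply: mulr_ge0 => //; exact: sqr_ge0|exact: C1P muP sc].
  apply: le_trans (lerD h1 (C2P n k l mu muP sc kn2)) _.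
  rewrite [leRHS](_ : _ = C1 ^+ 2 * l ^+ 4 + C2 * l ^+ (d + 2) +
    (C1 ^+ 2 * l ^+ (d + 2) + C2 * l ^+ 4 + 256 * M ^+ 2 * (l ^+ 4 + l ^+ (d + 2)))); last by ring.
  rewrite lerDl; apply: addr_ge0.
    by apply: addr_ge0; exact: mulr_ge0.
  by apply: mulr_ge0; [exact: mulr_ge0|exact: addr_ge0].
(* [n <= 2 k] gives [l ^ d = k / (n + 1) >= 1 / 4], hence [l >= 1] or
   [l >= 1 / 4] *)
have l4ge : 256^-1 <= l ^+ 4.
  have ld : 4^-1 <= l ^+ d.
    rewrite lE ler_pdivlMr// mulrC ler_pdivrMr// -natrM ler_nat.
    by clear -k0 kn2; lia.
  have [l1|l1] := leP 1 l.
    by apply: (@le_trans _ _ 1); [rewrite invf_le1// ler1n|exact: exprn_ege1].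
  have ll : 4^-1 <= l.
    by apply: (le_trans ld); rewrite -[leRHS]expr1; apply: ler_wiXn2l => //; exact: ltW.
  rewrite (_ : 256^-1 = 4^-1 ^+ 4); last by lra.
  by rewrite lerXn2r// nnegrE ?invr_ge0// ltW.
apply: (@le_trans _ _ (M ^+ 2)).
  have bA2 := bmeasX 2 (bmeas_knn_avg n k).
  apply: (@le_trans _ _ (\int[mu]_X \int[Q]_x (knn_avg k X x ^+ 2))).
    apply: le_Rintegral => //.
    - by apply: bmeas_integrable; apply: bmeasX; exact: bmeas_knn_err.
    - by apply: bmeas_integrable; exact: (bmeas_fubini Q bA2).
    move=> X _; apply: sqr_Rintegral_le.
    exact: (bmeas_slice1 X (bmeas_knn_avg n k)).
  rewrite (Rintegral_fubini mu Q bA2)/= -[leRHS](Rintegral_probability_cst Q).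
  apply: le_Rintegral => //.
  - by apply: bmeas_integrable; exact: (bmeas_fubini mu (bmeas_swap bA2)).
  - by apply: (bmeas_integrable Q (f := fun=> M ^+ 2)); exact: bmeas_cst.
  move=> x _; rewrite -[leRHS](Rintegral_probability_cst mu).
  apply: ae_le_Rintegral.
  - exact: (bmeas_slice2 x bA2).
  - exact: bmeas_cst.
  apply: filterS (generic_ae d0 mS PS Pp x muP) => X [XS inj].
  rewrite -real_normK ?num_real// lerXn2r ?nnegrE//.
  rewrite /knn_avg normrM ger0_norm ?invr_ge0// ler_pdivrMl ?ltr0n//.
  rewrite -[X in _ <= X%:R * _](card_rank_lt inj kn) natr_sum mulr_suml.
  apply: le_trans (ler_norm_sum _ _ _) _; apply: ler_sum => i _.
  by rewrite normrM ger0_norm// ler_wpM2l.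
apply: (@le_trans _ _ (256 * M ^+ 2 * l ^+ 4)).
  by rewrite mulrAC ler_peMl// -ler_pdivrMl// mulr1.
have M256 : 0 <= 256 * M ^+ 2 by exact: mulr_ge0.
apply: ler_pM => //; last by rewrite lerDl.
by rewrite lerDr; exact: addr_ge0.
Qed.

End core.

(** * Second-order remainders *)

Section second_order.
Context {R : realType} {d : nat}.
Local Notation E := 'rV[R]_d.
Implicit Types (f : E -> R) (x v : E) (U : set E) (M : R).

Lemma derive_coordinates f x v : differentiable f x ->
  'D_v f x = \sum_i v ord0 i * partial f i x.
Proof.
move=> df; rewrite deriveE// {1}(matrix_sum_delta v) big_ord1 linear_sum/=.
by apply: eq_bigr => i _; rewrite linearZ/= /partial deriveE.
Qed.

Lemma is_derive_segment f x v (t : R) : differentiable f (x + t *: v) ->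
  is_derive t 1 (fun s : R => f (x + s *: v)) (\sum_i v ord0 i * partial f i (x + t *: v)).
Proof.
move=> df; rewrite -derive_coordinates//.
have dg : differentiable (fun s : R => x + s *: v) t by [].
have dfg := differentiable_comp dg df.
apply: DeriveDef; first exact/derivable1_diffP.
have dS : is_diff t (fun s : R => x + s *: v) (fun s => 0 + s *: v).
  exact: (is_diffD (is_diff_cst x t) (is_diff_scalel t v)).
by rewrite deriveE// diff_comp//= [in LHS]diff_val/= deriveE// scale1r add0r.
Qed.

Lemma mean_value_segment f x v : (forall t : R, 0 <= t <= 1 -> differentiable f (x + t *: v)) ->
  exists2 t : R, 0 <= t <= 1 & f (x + v) - f x = \sum_i v ord0 i * partial f i (x + t *: v).
Proof.
move=> df.
have [| |t /itvP tI] := @MVT_segment R (fun s : R => f (x + s *: v))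
  (fun t => \sum_i v ord0 i * partial f i (x + t *: v)) 0 1 ler01.
- move=> t; rewrite in_itv/= => /andP[/ltW t0 /ltW t1]; apply: is_derive_segment.
  by apply: df; rewrite t0.
- apply: continuous_in_subspaceT => t; rewrite inE/= in_itv/= => tI.
  by have [/derivable1_diffP/differentiable_continuous + _] := is_derive_segment (df t tI).
by rewrite scale1r scale0r addr0 subr0 mulr1 => h; exists t; rewrite ?tI.
Qed.

Lemma gradient_lipschitz f x v M :
  (forall t : R, 0 <= t <= 1 -> differentiable f (x + t *: v)) ->
  (forall t : R, 0 <= t <= 1 -> enorm (gradient f (x + t *: v)) <= M) ->
  `|f (x + v) - f x| <= M * enorm v.
Proof.
move=> df gM; have [t tI ->] := mean_value_segment df.
rewrite (_ : \sum_i _ = \sum_i v ord0 i * gradient f (x + t *: v) ord0 i); last first.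
  by apply: eq_bigr => i _; rewrite mxE.
apply: le_trans (cauchy_schwarz _ _) _.
by rewrite mulrC ler_wpM2r ?enorm_ge0//; exact: gM.
Qed.

Definition hessian_form f y v : R := \sum_i \sum_j v ord0 i * v ord0 j * hessian f y i j.

(** The odd part of [f] around [x] cancels, so that a second-order remainder is
    left: the mean value theorem is applied to
    [s |-> f (x + s v) + f (x - s v)] and then to its derivative. *)
Lemma second_difference_le f x v M :
  (forall s : R, -1 <= s <= 1 -> differentiable f (x + s *: v)) ->
  (forall s : R, -1 <= s <= 1 -> forall i, differentiable (partial f i) (x + s *: v)) ->
  (forall s : R, -1 <= s <= 1 -> `|hessian_form f (x + s *: v) v| <= M) ->
  `|f (x + v) + f (x - v) - f x *+ 2| <= 2 * M.
Proof.
move=> df ddf hM.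
pose df1 y := \sum_i v ord0 i * partial f i y.
have opp (s : R) : -1 <= s <= 1 -> -1 <= - s <= 1 by lra.
have d1 (s : R) : -1 <= s <= 1 -> is_derive s 1 (fun s : R => f (x + s *: v)) (df1 (x + s *: v)).
  by move=> sI; apply: is_derive_segment; exact: df.
have d2 (s : R) : -1 <= s <= 1 -> is_derive s 1 (fun s : R => f (x + s *: - v)) (- df1 (x - s *: v)).
  move=> sI; rewrite (_ : - df1 _ = \sum_i (- v) ord0 i * partial f i (x + s *: - v)).
    by apply: is_derive_segment; rewrite scalerN -scaleNr; exact/df/opp.
  by rewrite /df1 -sumrN scalerN; apply: eq_bigr => i _; rewrite mxE mulNr.
have d12 (s : R) : -1 <= s <= 1 ->
    is_derive s 1 (fun s : R => f (x + s *: v) + f (x + s *: - v))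
      (df1 (x + s *: v) - df1 (x - s *: v)).
  by move=> sI; have h1 := d1 _ sI; have h2 := d2 _ sI; exact: is_deriveD.
have [| |t /itvP tI] := @MVT_segment R (fun s : R => f (x + s *: v) + f (x + s *: - v))
  (fun s => df1 (x + s *: v) - df1 (x - s *: v)) 0 1 ler01.
- by move=> t; rewrite in_itv/= => tI; apply: d12; lra.
- apply: continuous_in_subspaceT => t; rewrite inE/= in_itv/= => tI.
  have tI' : -1 <= t <= 1 by lra.
  by have [/derivable1_diffP/differentiable_continuous + _] := d12 t tI'.
rewrite !scale1r !scale0r addr0 subr0 mulr1 -mulr2n => ->.
have t0 : 0 <= t by rewrite tI.
have t1 : t <= 1 by rewrite tI.
have base (r : R) : x - t *: v + r *: ((2 * t) *: v) = x + (2 * t * r - t) *: v.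
  by rewrite scalerA -addrA; congr (_ + _); rewrite -scaleNr -scalerDl; congr (_ *: _); ring.
have rI (r : R) : 0 <= r <= 1 -> -1 <= 2 * t * r - t <= 1 by nra.
have df1E : df1 = \sum_i (v ord0 i \*: partial f i).
  by apply/funext => z; rewrite /df1 fct_sumE.
have ddf1 y : (forall i, differentiable (partial f i) y) -> differentiable df1 y.
  move=> h; rewrite df1E; apply: differentiable_sum => i; exact: differentiableZ.
have [|r /rI rI' h] := @mean_value_segment df1 (x - t *: v) ((2 * t) *: v).
  by move=> r /rI rI'; rewrite base; apply: ddf1; exact: ddf.
rewrite -[x + t *: v](_ : x - t *: v + (2 * t) *: v = _); last first.
  by have := base 1; rewrite scale1r => ->; congr (_ + _ *: _); ring.
rewrite h base.
rewrite (_ : \sum_i _ = 2 * t * hessian_form f (x + (2 * t * r - t) *: v) v).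
  have t20 : 0 <= 2 * t by lra.
  rewrite normrM (ger0_norm t20).
  have := hM _ rI'; have := normr_ge0 (hessian_form f (x + (2 * t * r - t) *: v) v).
  by nra.
rewrite /hessian_form exchange_big/= mulr_sumr; apply: eq_bigr => j _.
rewrite mxE mulr_sumr {1}/partial df1E derive_sum; last first.
  by move=> i; exact/derivableZ/diff_derivable/ddf.
rewrite mulr_sumr; apply: eq_bigr => i _; rewrite deriveZ; last exact/diff_derivable/ddf.
have scE (a b : R) : a *: b = a * b by [].
by rewrite mxE scE /partial; ring.
Qed.

Lemma opnorm_has_sup (A : 'M[R]_d) :
  has_sup [set enorm (v *m A) | v in [set v : E | enorm v <= 1]].
Proof.
split; first by exists (enorm (0 *m A)), 0; rewrite //= enorm0.
exists (\sum_i \sum_j `|A i j|) => _ [v v1 <-].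
apply: le_trans (enorm_le_sum _) _; rewrite exchange_big/=; apply: ler_sum => j _.
rewrite mxE; apply: le_trans (ler_norm_sum _ _ _) _; apply: ler_sum => i _.
rewrite normrM -[leRHS]mul1r ler_wpM2r//.
exact: le_trans (coord_le_enorm _ _) v1.
Qed.

Lemma opnorm_le_sum (A : 'M[R]_d) : opnorm A <= \sum_i \sum_j `|A i j|.
Proof.
apply: ge_sup; first by case: (opnorm_has_sup A).
move=> _ [v v1 <-].
apply: le_trans (enorm_le_sum _) _; rewrite exchange_big/=; apply: ler_sum => j _.
rewrite mxE; apply: le_trans (ler_norm_sum _ _ _) _; apply: ler_sum => i _.
rewrite normrM -[leRHS]mul1r ler_wpM2r//.
exact: le_trans (coord_le_enorm _ _) v1.
Qed.

Lemma opnorm_ge0 (A : 'M[R]_d) : 0 <= opnorm A.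
Proof.
rewrite (le_trans (enorm_ge0 (0 *m A)))//; apply: sup_upper_bound.
  exact: opnorm_has_sup.
by exists 0; rewrite //= enorm0.
Qed.

Lemma opnormP (A : 'M[R]_d) v : enorm (v *m A) <= opnorm A * enorm v.
Proof.
have [v0|v0] := eqVneq (enorm v) 0.
  rewrite v0 mulr0 (_ : v = 0) ?mul0mx ?enorm0//.
  apply/rowP => i; rewrite mxE; apply/eqP; rewrite -normr_le0 -v0.
  exact: coord_le_enorm.
have vp : 0 < enorm v by rewrite lt_neqAle eq_sym v0 enorm_ge0.
rewrite -ler_pdivrMr// mulrC -[X in X * _]ger0_norm ?invr_ge0 ?enorm_ge0//.
rewrite -enormZ scalemxAl; apply: sup_upper_bound; first exact: opnorm_has_sup.
by exists ((enorm v)^-1 *: v) => //=; rewrite enormZ ger0_norm ?invr_ge0 ?enorm_ge0// mulVf.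
Qed.

Lemma hessian_form_le f y v :
  `|hessian_form f y v| <= opnorm (hessian f y) * enorm v ^+ 2.
Proof.
rewrite (_ : hessian_form f y v = \sum_j (v *m hessian f y) ord0 j * v ord0 j).
  apply: le_trans (cauchy_schwarz _ _) _.
  by rewrite expr2 mulrA ler_wpM2r ?enorm_ge0//; exact: opnormP.
rewrite /hessian_form exchange_big/=; apply: eq_bigr => j _.
by rewrite !mxE mulr_suml; apply: eq_bigr => i _; rewrite mulrAC.
Qed.

(** Taylor's formula evaluates derivatives on the segments joining two points
    of [S]. Their union is compact when [S] is, and contained in its convex
    hull. *)
Definition segments (S : set E) : set E :=
  (fun z : (E * E) * R => z.1.1 + z.2 *: (z.1.2 - z.1.1)) @`
    ((S `*` S) `*` [set t | 0 <= t <= 1]).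

Lemma segments_convex S U : @convex_set R E U -> S `<=` U -> segments S `<=` U.
Proof.
move=> cU SU _ [[[x u] t] /= [[Sx Su] t01] <-].
have [t0 t1] := andP t01.
have := cU u x (Itv01 t0 t1); rewrite !inE => /(_ (SU _ Su) (SU _ Sx)).
move=> h; rewrite (_ : _ + _ = t *: u + (1 - t) *: x); first exact: h.
by rewrite /= scalerBl scale1r scalerBr addrCA.
Qed.

Lemma segments_conv_hull S : segments S `<=` conv_hull S.
Proof. by move=> y yS A [cA SA]; exact: segments_convex cA SA y yS. Qed.

Lemma compact_segments S : compact S -> compact (segments S).
Proof.
move=> cS; apply: continuous_compact.
  apply: continuous_subspaceT => z; apply: cvgD.
    by apply: (cvg_comp _ _ cvg_fst); exact: cvg_fst.
  apply: cvgZ; first exact: cvg_snd.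
  apply: cvgB; first by apply: (cvg_comp _ _ cvg_fst); exact: cvg_snd.
  by apply: (cvg_comp _ _ cvg_fst); exact: cvg_fst.
apply: compact_setX; first exact: compact_setX.
rewrite (_ : mkset _ = `[0%R, 1%R]%classic); first exact: segment_compact.
by apply/seteqP; split => t /=; rewrite in_itv.
Qed.

(** The derivatives are continuous on the compact set [segments S]. *)
Lemma C2_bounded_on_segments S U f : compact S -> @convex_set R E U -> S `<=` U ->
  C2_on U f -> exists M, forall y, segments S y ->
    enorm (gradient f y) + opnorm (hessian f y) <= M.
Proof.
move=> cS cU SU fU.
pose B y : R := (\sum_i `|partial f i y|) + \sum_i \sum_j `|hessian f y i j|.
have cB : {within segments S, continuous B}.
  apply: continuous_in_subspaceT => y; rewrite inE => /(segments_convex cU SU)/fU[_ df ch].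
  have csum (g : 'I_d -> E -> R) : (forall i, {for y, continuous (g i)}) ->
      {for y, continuous (fun z => \sum_i g i z)}.
    move=> cg; rewrite /prop_for /continuous_at.
    have Fy : Filter (nbhs y) by exact: nbhs_filter.
    by apply: cvg_big => [|i _]; [exact: add_continuous|exact: cg].
  have cn (g : E -> R) : {for y, continuous g} -> {for y, continuous (fun z => `|g z|)}.
    by move=> cg; apply: (continuous_comp cg); exact: (@norm_continuous R R^o).
  have c1 : {for y, continuous (fun z => \sum_i `|partial f i z|)}.
    apply: (csum (fun i z => `|partial f i z|)) => i; apply: cn.
    exact: differentiable_continuous (df i).
  have c2 : {for y, continuous (fun z => \sum_i \sum_j `|hessian f z i j|)}.
    apply: (csum (fun i z => \sum_j `|hessian f z i j|)) => i.
    apply: (csum (fun j z => `|hessian f z i j|)) => j; apply: cn.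
    apply: (continuous_comp (g := fun A : 'M[R]_d => A i j)); first exact: ch.
    exact: coord_continuous.
  exact: cvgD c1 c2.
have [M [Mr MB]] := compact_bounded (continuous_compact cB (compact_segments cS)).
exists (M + 1) => y yS; apply: (@le_trans _ _ (B y)).
  apply: lerD; last exact: opnorm_le_sum.
  apply: le_trans (enorm_le_sum _) _; apply: ler_sum => i _.
  by rewrite mxE.
apply: le_trans (ler_norm _) _; apply: (MB (M + 1)); first by rewrite ltrDl.
by exists y.
Qed.

(** First and second order formulas along the segments from [x] to [u] and from
    [2 x - u] to [u]. *)
Lemma C2_remainders S U f M : @convex_set R E U -> S `<=` U -> C2_on U f ->
  (forall y, segments S y -> enorm (gradient f y) + opnorm (hessian f y) <= M) ->
  forall x u, S x -> S u -> `|f u - f x| <= M * enorm (u - x) /\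
    (S (x + x - u) ->
      `|f u + f (x + x - u) - f x *+ 2| <= 2 * M * enorm (u - x) ^+ 2).
Proof.
move=> cU SU fU fM x u Sx Su; split => [|Su'].
  rewrite -{1}(subrKC x u); apply: gradient_lipschitz => t t01.
    have /fU[] // : U (x + t *: (u - x)).
    by apply: (segments_convex cU SU); exists ((x, u), t).
  rewrite (le_trans _ (fM (x + t *: (u - x)) _)) ?lerDl ?opnorm_ge0//.
  by exists ((x, u), t).
have seg (s : R) : -1 <= s <= 1 -> segments S (x + s *: (u - x)).
  move=> s1; exists ((x + x - u, u), (1 + s) / 2); first by split => //=; lra.
  rewrite /=; apply/rowP => i; by rewrite !mxE; field.
have Us (s : R) : -1 <= s <= 1 -> U (x + s *: (u - x)).
  by move=> /seg; exact: segments_convex.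
rewrite -{1}(subrKC x u) -(_ : x - (u - x) = x + x - u); last by rewrite opprB addrA.
rewrite -mulrA; apply: second_difference_le => s s1.
- by have [] := fU _ (Us _ s1).
- by have [] := fU _ (Us _ s1).
apply: le_trans (hessian_form_le _ _ _) _; rewrite ler_wpM2r ?sqr_ge0//.
by rewrite (le_trans _ (fM _ (seg _ s1)))// lerDr enorm_ge0.
Qed.

End second_order.

(** * Regularity of the support and of the densities *)

Section assumptions.
Context {R : realType} {d : nat}.
Local Notation E := 'rV[R]_d.
Variable S : set E.
Hypothesis mS : measurable S.

Lemma elipschitz_ge0 (f : E -> R) : elipschitz_on S f ->
  exists2 K : R, 0 <= K & forall x y, S x -> S y -> `|f x - f y| <= K * enorm (x - y).
Proof.
move=> [K fK]; exists (Num.max K 0); first by rewrite le_max lexx orbT.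
move=> x y Sx Sy; apply: (le_trans (fK x y Sx Sy)).
by rewrite ler_wpM2r ?enorm_ge0// le_max lexx.
Qed.

Lemma compact_enorm_bounded : compact S ->
  exists2 Dm : R, 0 <= Dm & forall x u, S x -> S u -> enorm (u - x) <= Dm.
Proof.
move=> /compact_bounded[M [Mr MS]].
pose N := Num.max (M + 1) 0.
have SN x : S x -> enorm x <= d%:R * N.
  move=> Sx; apply: enorm_le_coord => i.
  apply: le_trans (_ : `|x| <= _).
    rewrite [leRHS]/Num.norm/= mx_normrE.
    by apply: (le_trans _ (le_bigmax _ _ (ord0, i))).
  apply: MS => //; rewrite lt_max ltrDl; lra.
exists (d%:R * N + d%:R * N) => [|x u Sx Su].
  by rewrite -mulrDr mulr_ge0// addr_ge0 // le_max lexx orbT.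
by apply: le_trans (enormD _ _) _; rewrite enormN lerD ?SN.
Qed.

Lemma enorm_le_ediam x u : compact S -> S x -> S u -> enorm (u - x) <= ediam S.
Proof.
move=> /compact_enorm_bounded[Dm _ SDm] Sx Su; apply: sup_upper_bound.
  split; first by exists (enorm (u - x)), u => //; exists x.
  by exists Dm => _ [y Sy [z Sz <-]]; exact: SDm.
by exists u => //; exists x.
Qed.

Lemma density_ge (P : probability E R) (p : E -> R) (plow : R) A :
  has_density P p -> 0 <= plow -> (forall x, S x -> plow <= p x) -> measurable A ->
  A `<=` S -> (plow%:E * lebesgue_rV R d A <= P A)%E.
Proof.
move=> [mp p0 PE] pl0 pS mA AS; rewrite PE// -integral_cst//.
apply: ge0_le_integral => //.
- by apply/measurable_EFinP; exact: measurable_funTS.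
- by move=> x Ax; rewrite lee_fin; exact/pS/AS.
Qed.

Lemma density_le (Q : probability E R) (q : E -> R) (qup : R) A :
  has_density Q q -> 0 <= qup -> (forall x, S x -> q x <= qup) -> measurable A ->
  A `<=` S -> (Q A <= qup%:E * lebesgue_rV R d A)%E.
Proof.
move=> [mq q0 QE] ql0 qS mA AS; rewrite QE// -integral_cst//.
apply: ge0_le_integral => //.
- by move=> x _; rewrite lee_fin.
- by apply/measurable_EFinP; exact: measurable_funTS.
- by move=> x Ax; rewrite lee_fin; exact/qS/AS.
Qed.

Lemma probability_capture (Q : probability E R) A : Q S = 1%E -> measurable A ->
  Q A = Q (A `&` S).
Proof.
move=> QS mA; rewrite [LHS](_ : _ = Q (A `&` S) + Q (A `\` S))%E.
  rewrite [X in (_ + X)%E](_ : _ = 0%E) ?adde0//; apply/eqP; rewrite -measure_le0.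
  apply: (@le_trans _ _ (Q (~` S))).
    by apply: le_measure; rewrite ?inE; [exact: measurableD|exact: measurableC|move=> x []].
  rewrite [leLHS](_ : _ = 1 - Q S)%E; last exact: probability_setC.
  by rewrite QS subee.
by rewrite addeC; exact: measureDI.
Qed.

(** The open ball contains the closed ball of half the radius, to which the
    lower bounds on the density and on the volume apply. *)
Lemma ball_mass_ge (P : probability E R) (p : E -> R) : (0 < d)%N ->
  has_density P p -> compact S ->
  (exists2 plow : R, 0 < plow & forall x, S x -> plow <= p x) ->
  (exists2 c : R, 0 < c &
     forall (x : E) (r : R), S x -> 0 <= r <= ediam S ->
       (c%:E * lebesgue_rV R d (ecball x r)
         <= lebesgue_rV R d (ecball x r `&` S))%E) ->
  exists2 c : R, 0 < c & forall x u, S x -> S u ->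
    c * enorm (u - x) ^+ d <= ball_mass P x (enorm (u - x)).
Proof.
move=> d0 Pp cS [plow pl0 plS] [c c0 cball].
have dp : 0 < (d%:R)^-1 :> R by rewrite invr_gt0 ltr0n.
exists (plow * (c * d%:R^-1 ^+ d)) => [|x u Sx Su].
  by apply: mulr_gt0 => //; apply: mulr_gt0 => //; exact: exprn_gt0.
set r := enorm (u - x); have r0 : 0 <= r := enorm_ge0 _.
have [->|rn0] := eqVneq r 0.
  by rewrite expr0n eqn0Ngt d0/= mulr0; exact: fine_ge0.
have rp : 0 < r by rewrite lt_neqAle eq_sym rn0.
have rd : r <= ediam S by exact: enorm_le_ediam.
have r2 : 0 <= r / 2 <= ediam S by lra.
have mb := measurable_ecball x (r / 2).
have mo : measurable [set v : E | enorm (v - x) < r].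
  rewrite -[X in measurable X]setTI; apply: measurable_fun_ltr => //.
  exact: measurable_edist.
rewrite -lee_fin /ball_mass fineK; last exact: fin_num_measure.
apply: (@le_trans _ _ (P (ecball x (r / 2) `&` S))); last first.
  apply: le_measure; rewrite ?inE//; first exact: measurableI.
  by move=> v [/= vr _]; rewrite (le_lt_trans vr)//; lra.
apply: le_trans (density_ge Pp (ltW pl0) plS _ _); [|exact: measurableI|by move=> v []].
rewrite -mulrA EFinM; apply: lee_wpmul2l; first by rewrite lee_fin ltW.
apply: le_trans (cball _ _ Sx r2).
rewrite -mulrA EFinM; apply: lee_wpmul2l; first by rewrite lee_fin ltW.
have r20 : 0 <= r / 2 by lra.
apply: le_trans (lebesgue_ecball_ge x d0 r20); rewrite lee_fin -exprMn.
by rewrite le_eqVlt; apply/orP; left; apply/eqP; congr (_ ^+ _); field; rewrite pnatr_eq0 -lt0n.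
Qed.

Lemma density_ball_le (Q : probability E R) (q : E -> R) :
  has_density Q q -> Q S = 1%E ->
  (exists2 qup : R, 0 < qup & forall x, S x -> q x <= qup) ->
  exists2 c : R, 0 <= c & forall x r, 0 <= r -> (Q (ecball x r) <= (c * r ^+ d)%:E)%E.
Proof.
move=> Qq QS [qup q0 qS]; exists (qup * 2 ^+ d) => [|x r r0].
  by apply: mulr_ge0; [exact: ltW|exact: exprn_ge0].
have mb := measurable_ecball x r.
rewrite (probability_capture QS mb).
apply: le_trans (density_le Qq (ltW q0) qS _ _) _; [exact: measurableI|by move=> v []|].
rewrite -mulrA -exprMn EFinM; apply: lee_wpmul2l; first by rewrite lee_fin ltW.
apply: le_trans (lebesgue_ecball_le x r0).
by apply: le_measure; rewrite ?inE//; first exact: measurableI.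
Qed.

(** Take [L = a / l ^ d], for which [L ^ (1 / d)] is of order [1 / l]. *)
Lemma boundary_layer (Q : probability E R) : (0 < d)%N ->
  (ereal_sup [set (L `^ d%:R^-1)%R%:E *
           \int[Q]_(x in S) (expR (- (L * dist_compl S x ^+ d)))%R%:E
           | L in [set L : R | (0 < L)%R]] < +oo)%E ->
  forall a, 0 < a -> exists2 C : R, 0 <= C & forall l, 0 < l ->
    \int[Q]_x (\1_S x * expR (- (a * (dist_compl S x / l) ^+ d))) <= C * l.
Proof.
move=> d0; set M := ereal_sup _ => Moo a a0.
have I0 (L : R) : (0 <= \int[Q]_(x in S) (expR (- (L * dist_compl S x ^+ d)))%R%:E)%E.
  by apply: integral_ge0 => x _; rewrite lee_fin expR_ge0.
have ub L : 0 < L -> ((L `^ d%:R^-1)%R%:E *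
           \int[Q]_(x in S) (expR (- (L * dist_compl S x ^+ d)))%R%:E <= M)%E.
  by move=> L0; apply: ereal_sup_ubound; exists L.
have M0 : (0 <= M)%E.
  by apply: le_trans (ub 1 ltr01); rewrite mule_ge0// lee_fin powR_ge0.
have Mf : M \is a fin_num by rewrite ge0_fin_numE.
have ap : 0 < a `^ d%:R^-1 by exact: powR_gt0.
exists (fine M / a `^ d%:R^-1) => [|l l0].
  by apply: divr_ge0; [exact: fine_ge0|exact: ltW].
have ld : 0 < l ^+ d by exact: exprn_gt0.
have L0 : 0 < a / l ^+ d by exact: divr_gt0.
have := ub _ L0.
have -> : (a / l ^+ d) `^ d%:R^-1 = a `^ d%:R^-1 / l.
  rewrite powRM ?invr_ge0 ?(ltW a0) ?(ltW ld)//; congr (_ * _).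
  rewrite -exprVn -powR_mulrn ?invr_ge0 ?(ltW l0)// -powRrM mulfV ?powRr1 ?invr_ge0 ?(ltW l0)//.
  by rewrite pnatr_eq0 -lt0n.
have -> : (\int[Q]_(x in S) (expR (- (a / l ^+ d * dist_compl S x ^+ d)))%:E =
   \int[Q]_x (\1_S x * expR (- (a * (dist_compl S x / l) ^+ d)))%:E)%E.
  rewrite integral_mkcond; apply: eq_integral => x _; rewrite patchE indicE.
  case: ifPn => _; rewrite ?mul1r ?mul0r//; congr (expR (- _))%:E.
  by rewrite expr_div_n mulrAC mulrA.
set J := (\int[Q]_x _)%E => h.
have J0 : (0 <= J)%E.
  by apply: integral_ge0 => x _; rewrite lee_fin mulr_ge0 ?expR_ge0.
have al : 0 < a `^ d%:R^-1 / l by exact: divr_gt0.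
move: h; rewrite -lee_pdivlMl// -(fineK Mf) -EFinM => h.
have Jf : J \is a fin_num by rewrite ge0_fin_numE// (le_lt_trans h)// ltry.
move: h; rewrite -(fineK Jf) lee_fin => /le_trans; apply.
by rewrite invf_div mulrC mulrA mulrAC.
Qed.

(** The regularity of [S], [P] and [Q] provides the constants of
    [knn_err_second_moment]; in particular [p] is bounded, being Lipschitz on a
    bounded set. *)
Theorem knn_second_moment (P Q : probability E R) (p q : E -> R) (F : E * E -> R) (K : R) :
  (0 < d)%N -> P S = 1%E -> Q S = 1%E -> compact S ->
  (exists2 c : R, 0 < c &
     forall (x : E) (r : R), S x -> 0 <= r <= ediam S ->
       (c%:E * lebesgue_rV R d (ecball x r)
         <= lebesgue_rV R d (ecball x r `&` S))%E) ->
  has_density P p -> has_density Q q ->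
  (exists2 plow : R, 0 < plow & forall x, S x -> plow <= p x) ->
  (exists2 qup : R, 0 < qup & forall x, S x -> q x <= qup) ->
  elipschitz_on S p ->
  (ereal_sup [set (L `^ d%:R^-1)%R%:E *
           \int[Q]_(x in S) (expR (- (L * dist_compl S x ^+ d)))%R%:E
           | L in [set L : R | (0 < L)%R]] < +oo)%E ->
  measurable_fun [set: E * E] F -> 0 <= K ->
  (forall x u, ~ (S x /\ S u) -> F (x, u) = 0) ->
  (forall x u, S x -> S u -> `|F (x, u)| <= K * enorm (u - x)) ->
  (forall x u, S x -> S u -> S (x + x - u) ->
     `|F (x, u) + F (x, x + x - u)| <= K * enorm (u - x) ^+ 2) ->
  exists2 C : R, 0 <= C &
  forall n k l (mu : probability (n.-tuple E) R),
  resamplable mu P -> scale_of d n k l ->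
  \int[mu]_X (knn_err Q F k X ^+ 2) <= C * (l ^+ 4 + l ^+ (d + 2)).
Proof.
move=> d0 PS QS cS X2 Pp Qq X3p X3q /elipschitz_ge0[Lp Lp0 p_lip] HA mF K0 F_S F_lip F_sym.
have [Dm Dm0 S_diam] := compact_enorm_bounded cS.
have [c c0 ball_ge] := ball_mass_ge d0 Pp cS X3p X2.
have [cq cq0 Q_ball] := density_ball_le Qq QS X3q.
have Q_boundary := boundary_layer d0 HA.
have [x0 Sx0] : S !=set0.
  apply/set0P/negP => /eqP S0; move/eqP: PS.
  by rewrite S0 measure0 eq_sym onee_eq0.
have [_ p0 _] := Pp.
have pmax0 : 0 <= p x0 + Lp * Dm by rewrite addr_ge0// mulr_ge0.
have p_le x : S x -> p x <= p x0 + Lp * Dm.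
  move=> Sx; rewrite -lerBlDl (le_trans (ler_norm _))// (le_trans (p_lip _ _ Sx Sx0))//.
  by rewrite ler_wpM2l// S_diam.
have bF : bmeas F.
  split=> //; exists (K * Dm) => -[x u].
  have [[Sx Su]|nS] := pselect (S x /\ S u); last by rewrite F_S// normr0 mulr_ge0.
  by apply: (le_trans (F_lip _ _ Sx Su)); rewrite ler_wpM2l// S_diam.
exact: (knn_err_second_moment d0 mS PS Pp pmax0 p_le Lp0 p_lip c0 ball_ge S_diam cq0
  Q_ball Q_boundary bF K0 F_S F_lip F_sym).
Qed.

End assumptions.

(** * Functionals determined by their values on generators *)

Section integral_like_measure.
Local Open Scope ereal_scope.
Context {R : realType} d (T : measurableType d).
Implicit Types (Phi Psi : (T -> \bar R) -> \bar R).

Lemma integral_like0 Phi : integral_like Phi -> Phi (fun=> 0) = 0.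
Proof.
move=> [_ sc _]; transitivity (Phi (fun=> 0%:E * 0)).
  by congr Phi; apply/funext => x; rewrite mul0e.
by rewrite sc//; exact: mul0e.
Qed.

(** Countable additivity is monotone convergence applied to partial sums of
    indicators. *)
Lemma integral_like_measure Phi : integral_like Phi ->
  (forall f, (forall x, 0 <= f x) -> 0 <= Phi f) ->
  exists m : {measure set T -> \bar R},
    forall A, m A = Phi (fun x => (\1_A x)%:E).
Proof.
move=> PhiI Phi0; pose m (A : set T) := Phi (fun x => (\1_A x)%:E).
have m0 : m set0 = 0.
  rewrite -(integral_like0 PhiI); congr Phi; apply/funext => x.
  by rewrite indic0.
have m_ge0 A : 0 <= m A by apply: Phi0 => x; rewrite lee_fin.
have [addP _ cvP] := PhiI.
have nI A : measurable A -> measurable_fun [set: T] (fun x => (\1_A x)%:E : \bar R).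
  by move=> mA; apply/measurable_EFinP; exact: measurable_indic.
have m_sigma : semi_sigma_additive m.
  move=> F mF tF mUF.
  have mE : m (\bigcup_n F n) = \sum_(0 <= i <oo) m (F i).
    have sumE n : Phi (fun x => \sum_(0 <= i < n) (\1_(F i) x)%:E) =
        \sum_(0 <= i < n) m (F i).
      elim: n => [|n ih].
        rewrite big_geq// -[RHS](integral_like0 PhiI); congr Phi.
        by apply/funext => x; rewrite big_geq.
      rewrite big_nat_recr//= -ih -addP//.
      - by congr Phi; apply/funext => x; rewrite big_nat_recr.
      - split; first by apply: emeasurable_sum => i; exact: nI.
        by move=> x; apply: sume_ge0 => i _; rewrite lee_fin.
      - by split; [exact: nI|move=> x; rewrite lee_fin].
    transitivity (Phi (fun x => limn (fun n => \sum_(0 <= i < n) (\1_(F i) x)%:E))).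
      congr Phi; apply/funext => x; apply/esym/cvg_lim => //.
      exact: (@measure_semi_sigma_additive _ _ _ (\d_x) F mF tF mUF).
    rewrite cvP; first by congr (limn _); apply/funext => n; rewrite sumE.
    - move=> n; split; first by apply: emeasurable_sum => i; exact: nI.
      by move=> x; apply: sume_ge0 => i _; rewrite lee_fin.
    - by move=> x a b ab; apply: lee_sum_nneg_natr.
  rewrite mE; apply: is_cvg_nneseries => i _ _; exact: m_ge0.
pose mM := isMeasure.Build _ _ _ m m0 m_ge0 m_sigma.
pose M : {measure set T -> \bar R} := HB.pack m mM.
by exists M.
Qed.

(** Both functionals are given by measures ([integral_like_measure]), and
    finite measures that agree on a generating family closed under intersection
    are equal. *)
Lemma integral_like_unique (G : set (set T)) Phi Psi :
  @measurable _ T = <<s G >> -> setI_closed G -> G setT ->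
  integral_like Phi -> integral_like Psi ->
  (forall f, (forall x, 0 <= f x) -> 0 <= Phi f) ->
  (forall f, (forall x, 0 <= f x) -> 0 <= Psi f) ->
  Phi (fun=> 1) < +oo ->
  (forall A, G A -> Phi (fun x => (\1_A x)%:E) = Psi (fun x => (\1_A x)%:E)) ->
  forall f, measurable_fun [set: T] f -> (forall x, 0 <= f x) -> Phi f = Psi f.
Proof.
move=> GE GI GT PhiI PsiI Phi0 Psi0 Phioo PhiPsi; apply: integral_like_ext => // A mA.
have [m mE] := integral_like_measure PhiI Phi0.
have [m' m'E] := integral_like_measure PsiI Psi0.
rewrite -mE -m'E; apply: (measure_unique G (fun=> setT)) => //.
- by rewrite bigcup_const.
- by move=> B GB; rewrite mE m'E PhiPsi.
- move=> _; rewrite mE; apply: le_lt_trans Phioo.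
  by rewrite le_eqVlt; apply/orP; left; apply/eqP; congr Phi; apply/funext => x; rewrite indicT.
Qed.

Lemma integral_like_sum (I : Type) (s : seq I) (Phi : I -> (T -> \bar R) -> \bar R) :
  (forall i, integral_like (Phi i)) ->
  (forall i f, (forall x, 0 <= f x) -> 0 <= Phi i f) ->
  (forall i f g, measurable_fun [set: T] f -> measurable_fun [set: T] g ->
     (forall x, 0 <= f x <= g x) -> Phi i f <= Phi i g) ->
  integral_like (fun f => \sum_(i <- s) Phi i f).
Proof.
move=> PhiI Phi0 PhiM; split.
- move=> f g nf ng; rewrite -big_split/=; apply: eq_bigr => i _.
  by have [-> //] := PhiI i.
- move=> c f c0 nf; rewrite ge0_sume_distrr; last by move=> i _; apply: Phi0; case: nf.
  by apply: eq_bigr => i _; have [_ -> //] := PhiI i.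
- move=> f nf ndf.
  have c i : cvgn (fun n => Phi i (f n)).
    apply: ereal_nondecreasing_is_cvgn => a b ab.
    have [ma a0] := nf a; have [mb _] := nf b.
    by apply: PhiM => // x; rewrite a0; exact: ndf.
  transitivity (\sum_(i <- s) limn (fun n => Phi i (f n))).
    by apply: eq_bigr => i _; have [_ _ -> //] := PhiI i.
  apply/esym/cvg_lim => //; apply: cvg_nnesum.
  + by move=> i _; near=> n; apply: Phi0; case: (nf n).
  + by move=> i _; exact: c.
Unshelve. all: by end_near. Qed.

End integral_like_measure.

Section weighted.
Local Open Scope ereal_scope.
Context {R : realType} d d' (T : measurableType d) (T' : measurableType d').
Variables (mu : {measure set T -> \bar R}) (w : T -> R) (g : T -> T').
Hypotheses (mw : measurable_fun [set: T] w) (w0 : forall t, (0 <= w t)%R).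
Hypothesis mg : measurable_fun [set: T] g.

Lemma integral_like_weighted :
  integral_like (fun f : T' -> \bar R => \int[mu]_t ((w t)%:E * f (g t))).
Proof.
have mwE : measurable_fun [set: T] (EFin \o w) by exact/measurable_EFinP.
have mf f : measurable_fun [set: T'] f ->
    measurable_fun [set: T] (fun t => (w t)%:E * f (g t)).
  by move=> mf; apply: emeasurable_funM => //; exact: measurableT_comp.
have f0 (f : T' -> \bar R) : (forall x, 0 <= f x) -> forall t, 0 <= (w t)%:E * f (g t).
  by move=> f0 t; rewrite mule_ge0// lee_fin.
split.
- move=> f1 f2 [mf1 f10] [mf2 f20]; rewrite -ge0_integralD//; last 4 first.
  + by move=> t _; exact: f0.
  + exact: mf.
  + by move=> t _; exact: f0.
  + exact: mf.
  by apply: eq_integral => t _; rewrite ge0_muleDr.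
- move=> c f c0 [mf1 f10]; rewrite -ge0_integralZl//; last 2 first.
  + exact: mf.
  + by move=> t _; exact: f0.
  by apply: eq_integral => t _; rewrite muleCA.
- move=> f nf ndf; rewrite -monotone_convergence//; last 3 first.
  + by move=> n; case: (nf n) => m1 _; exact: mf.
  + by move=> n t _; case: (nf n) => _ ?; exact: f0.
  + by move=> t _ a b ab; rewrite lee_wpmul2l ?lee_fin//; exact: ndf.
  apply: eq_integral => t _; rewrite limeMl//.
  by apply: ereal_nondecreasing_is_cvgn; exact: ndf.
Qed.

End weighted.

Section product_generators.
Context d1 d2 (T1 : measurableType d1) (T2 : measurableType d2).
Variables (G1 : set (set T1)) (G2 : set (set T2)).

Definition product_sets : set (set (T1 * T2)) := [set A `*` B | A in G1 & B in G2].

Lemma product_sets_setI : setI_closed G1 -> setI_closed G2 -> setI_closed product_sets.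
Proof.
move=> I1 I2 _ _ [A1 GA1 [B1 GB1 <-]] [A2 GA2 [B2 GB2 <-]].
exists (A1 `&` A2); first exact: I1.
by exists (B1 `&` B2); [exact: I2|rewrite setXI].
Qed.

(** For each factor, the measurable sets whose cylinder is generated form a
    sigma-algebra; products are intersections of two cylinders. *)
Lemma product_sets_generate : @measurable _ T1 = <<s G1 >> -> @measurable _ T2 = <<s G2 >> ->
  G1 setT -> G2 setT -> @measurable _ (T1 * T2)%type = <<s product_sets >>.
Proof.
move=> E1 E2 T1G T2G; apply/seteqP; split.
- rewrite measurable_prod_measurableType.
  have sG : sigma_algebra setT <<s product_sets >> by exact: smallest_sigma_algebra.
  have [sG0 sGC sGU] := sG.
  have s1 A : measurable A -> <<s product_sets >> (A `*` setT).
    suff h : <<s G1 >> `<=` [set A | <<s product_sets >> (A `*` setT)] by rewrite E1; exact: h.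
    apply: smallest_sub.
      split.
      + by rewrite /= set0X.
      + move=> B /= sB; rewrite setTD (_ : _ `*` _ = setT `\` (B `*` setT)).
          exact: sGC.
        by apply/seteqP; split => -[x y] /=; tauto.
      + by move=> F sF /=; rewrite (_ : _ `*` _ = \bigcup_n (F n `*` setT));
          [exact: sGU|rewrite setX_bigcupl].
    by move=> B GB; apply: sub_sigma_algebra; exists B => //; exists setT.
  have s2 A : measurable A -> <<s product_sets >> (setT `*` A).
    suff h : <<s G2 >> `<=` [set A | <<s product_sets >> (setT `*` A)] by rewrite E2; exact: h.
    apply: smallest_sub.
      split.
      + by rewrite /= setX0.
      + move=> B /= sB; rewrite setTD (_ : _ `*` _ = setT `\` (setT `*` B)).
          exact: sGC.
        by apply/seteqP; split => -[x y] /=; tauto.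
      + by move=> F sF /=; rewrite (_ : _ `*` _ = \bigcup_n (setT `*` F n));
          [exact: sGU|rewrite setX_bigcupr].
    by move=> B GB; apply: sub_sigma_algebra; exists setT => //; exists B.
  apply: smallest_sub => // _ [A mA [B mB <-]].
  rewrite (_ : A `*` B = (A `*` setT) `&` (setT `*` B)); last first.
    by rewrite -setXI setIT setTI.
  exact: (@measurableI _ (g_sigma_algebraType product_sets) _ _ (s1 _ mA) (s2 _ mB)).
- apply: smallest_sub; first exact: sigma_algebra_measurable.
  move=> _ [A GA [B GB <-]]; apply: measurableX.
  + by rewrite E1; exact: sub_sigma_algebra.
  + by rewrite E2; exact: sub_sigma_algebra.
Qed.

End product_generators.

Section pullback.
Local Open Scope ereal_scope.
Context {R : realType} d d' (T : measurableType d) (T' : measurableType d').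
Variables (mu : {measure set T -> \bar R}) (g : T -> T').
Hypothesis mg : measurable_fun [set: T] g.

Lemma integral_like_pullback :
  integral_like (fun f : T' -> \bar R => \int[mu]_t f (g t)).
Proof.
rewrite (_ : (fun f => _) = fun f : T' -> \bar R => \int[mu]_t (1%:E * f (g t))).
  exact: integral_like_weighted.
by apply/funext => f; apply: eq_integral => t _; rewrite mul1e.
Qed.

Lemma integral_indic_pullback A : measurable A ->
  \int[mu]_t (\1_A (g t))%:E = mu (g @^-1` A).
Proof.
move=> mA; rewrite -[g @^-1` A]setIT -integral_indic//.
by rewrite -[X in measurable X]setTI; exact: mg.
Qed.

End pullback.

(** * Law of the sample *)

Section delayed_kernel.
Context d1 d2 (T1 : measurableType d1) (T2 : measurableType d2) {R : realType}.
Variable nu : R.-pker T1 ~> T2.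

(** The kernel with an inert first argument, the query point: averages over the
    label are then measurable jointly in the query point and the covariate. *)
Definition delayed (z : T1 * T1) : {measure set T2 -> \bar R} := nu z.2.

Let measurable_delayed U : measurable U -> measurable_fun [set: T1 * T1] (delayed ^~ U).
Proof. by move=> mU; apply: (measurableT_comp (measurable_kernel nu U mU)). Qed.

HB.instance Definition _ := isKernel.Build _ _ _ _ _ delayed measurable_delayed.

Let delayed_setT z : delayed z setT = 1%E.
Proof. exact: prob_kernel. Qed.

HB.instance Definition _ := Kernel_isProbability.Build _ _ _ _ _ delayed delayed_setT.

Lemma measurable_delayed_integral (H : T1 * (T1 * T2) -> \bar R) :
  measurable_fun setT H -> (forall z, 0 <= H z)%E ->
  measurable_fun [set: T1 * T1] (fun z => \int[nu z.2]_y H (z.1, (z.2, y)))%E.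
Proof.
move=> mH H0.
have mp : measurable_fun [set: (T1 * T1) * T2] (fun z => (z.1.1, (z.1.2, z.2))).
  apply: measurable_fun_pair; first exact: (measurableT_comp measurable_fst measurable_fst).
  by apply: measurable_fun_pair => //; exact: (measurableT_comp measurable_snd measurable_fst).
exact: (@measurable_fun_integral_finite_kernel _ _ _ _ _
  (fun z => H (z.1.1, (z.1.2, z.2))) delayed (fun z => H0 _) (measurableT_comp mH mp)).
Qed.

End delayed_kernel.

Section sample_law.
Context dT (T : measurableType dT) (R : realType) (d n m : nat).
Local Notation E := 'rV[R]_d.
Variables (Pr : probability T R) (P Q : probability E R) (nu : R.-pker E ~> R).
Variables (X : 'I_n -> {RV Pr >-> E}) (Y : 'I_n -> {RV Pr >-> R}).
Variables (Xs : 'I_m -> {RV Pr >-> E}).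
Hypothesis sampleP : is_sample P Q nu X Y Xs.

Definition Xt w : n.-tuple E := [tuple X i w | i < n].

Lemma measurable_Xt : measurable_fun [set: T] Xt.
Proof.
apply/measurable_fun_tnthP => i.
rewrite (_ : _ \o _ = X i); first exact: measurable_funPT.
by apply/funext => w; rewrite /= tnth_mktuple.
Qed.

Definition XtRV : {mfun T >-> n.-tuple E} := mfun_Sub (mem_set measurable_Xt).

Definition law_Xt : probability (n.-tuple E) R := distribution Pr XtRV.

Lemma law_XtE A : law_Xt A = Pr [set w | A (Xt w)].
Proof. by []. Qed.

Let mXY i : measurable_fun [set: T] (fun w => (X i w, Y i w)).
Proof. by apply: measurable_fun_pair; exact: measurable_funPT. Qed.

Lemma sample_product (B : 'I_n -> set (E * R)) (C : 'I_m -> set E) :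
  (forall l, measurable (B l)) -> (forall j, measurable (C j)) ->
  (Pr [set w | (forall l, B l (X l w, Y l w)) /\ (forall j, C j (Xs j w))] =
   (\prod_l joint_law P nu (B l)) * \prod_j Q (C j))%E.
Proof.
move=> mB mC; have [XYlaw Xslaw indep] := sampleP.
pose A (s : 'I_n + 'I_m) : set T := match s with
  | inl l => [set w | B l (X l w, Y l w)]
  | inr j => [set w | C j (Xs j w)]
  end.
have indepA : (Pr (\bigcap_s A s) =
    \prod_l Pr [set w | B l (X l w, Y l w)] * \prod_j Pr [set w | C j (Xs j w)])%E.
  rewrite indep ?big_sumType//.
  case=> [l|j].
    by exists (B l) => //; rewrite setTI.
  by exists (C j) => //; rewrite setTI.
transitivity (Pr (\bigcap_s A s)).
  congr (Pr _); apply/seteqP; split => w /=.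
    by move=> [hB hC] [l|j] _; [exact: hB|exact: hC].
  by move=> h; split => [l|j]; [exact: (h (inl l))|exact: (h (inr j))].
by rewrite indepA; congr (_ * _)%E; apply: eq_bigr => i _; [exact: XYlaw|exact: Xslaw].
Qed.

Lemma sample_product1 (B : 'I_n -> set (E * R)) (C : set E) j :
  (forall l, measurable (B l)) -> measurable C ->
  (Pr [set w | (forall l, B l (X l w, Y l w)) /\ C (Xs j w)] =
   (\prod_l joint_law P nu (B l)) * Q C)%E.
Proof.
move=> mB mC; pose C' j' := if j' == j then C else setT.
have -> : Q C = (\prod_j' Q (C' j'))%E.
  rewrite (bigD1 j)//= /C' eqxx big1 ?mule1// => j' /negbTE ->.
  exact: probability_setT.
rewrite -sample_product//; last by move=> j'; rewrite /C'; case: ifP.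
congr (Pr _); apply/seteqP; split => w /= -[hB hC]; split => //.
  by move=> j'; rewrite /C'; case: eqP => [->|].
by have := hC j; rewrite /C' eqxx.
Qed.

Lemma joint_law_fst (A : set E) : measurable A -> joint_law P nu (A `*` setT) = P A.
Proof.
move=> mA; rewrite -[in RHS](setIT A) -(integral_indic P _ mA)//.
apply: eq_integral => x _; rewrite indicE.
have [xA|xA] := boolP (x \in A).
  by rewrite in_xsectionX//; exact: prob_kernel.
by rewrite notin_xsectionX//= measure0.
Qed.

Let JL : probability (E * R)%type R := joint_law P nu.

Let M2 : probability (E * (E * R))%type R := (Q \x JL)%E.

Let M3 : probability (n.-tuple E * (E * (E * R)))%type R := (law_Xt \x M2)%E.

Lemma law_Xt_rectangle (A : 'I_n -> set E) : (forall l, measurable (A l)) -> (0 < m)%N ->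
  law_Xt (rectangle (fun l t => tnth t l) A) = (\prod_l P (A l))%E.
Proof.
move=> mA m0; rewrite law_XtE.
have := @sample_product1 (fun l => A l `*` setT) setT (Ordinal m0)
  (fun l => measurableX (mA l) measurableT) measurableT.
rewrite [X in (_ * X)%E](@probability_setT _ _ _ Q) mule1.
under [in RHS]eq_bigr do rewrite joint_law_fst//.
move=> <-; congr (Pr _); apply/seteqP; split => w /=.
  by move=> h; split => // l; split => //=; have := h l; rewrite tnth_mktuple.
by move=> [h _] l; rewrite tnth_mktuple; case: (h l).
Qed.

Let GX := rectangles (fun l (t : n.-tuple E) => tnth t l).

Let GXE : @measurable _ (n.-tuple E) = <<s GX >>.
Proof. exact: (g_sigma_preimage_rectangles (fun l (t : n.-tuple E) => tnth t l)). Qed.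

Let mX l : measurable_fun [set: T] (X l). Proof. exact: measurable_funPT. Qed.
Let mXs j : measurable_fun [set: T] (Xs j). Proof. exact: measurable_funPT. Qed.

Let joined i j w : n.-tuple E * (E * (E * R)) := (Xt w, (Xs j w, (X i w, Y i w))).

Let mjoined i j : measurable_fun [set: T] (joined i j).
Proof.
apply: measurable_fun_pair; first exact: measurable_Xt.
by apply: measurable_fun_pair.
Qed.

Let substituted i (z : n.-tuple E * (E * (E * R))) := (upd z.1 i z.2.2.1, z.2).

Let msubstituted i : measurable_fun [set: n.-tuple E * (E * (E * R))] (substituted i).
Proof.
apply: measurable_fun_pair => //.
have mp : measurable_fun [set: n.-tuple E * (E * (E * R))] (fun z => (z.1, z.2.2.1)).
  apply: measurable_fun_pair => //.
  apply: (measurableT_comp measurable_fst); apply: (measurableT_comp measurable_snd).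
  exact: measurable_snd.
exact: (measurableT_comp (measurable_upd i) mp).
Qed.

(** Given the other data, replacing [X_i] by a fresh copy of [(X, Y)] does not
    change the law of the sample: this is independence read on integrals. *)
Lemma sample_law i j (f : n.-tuple E * (E * (E * R)) -> \bar R) :
  measurable_fun setT f -> (forall z, 0 <= f z)%E ->
  (\int[Pr]_w f (Xt w, (Xs j w, (X i w, Y i w))) =
   \int[M3]_z f (upd z.1 i z.2.2.1, z.2))%E.
Proof.
have m0 : (0 < m)%N by apply: leq_ltn_trans (ltn_ord j).
pose G := product_sets GX (product_sets (@measurable _ E) (@measurable _ (E * R)%type)).
have GT : G setT.
  exists setT; first exact: rectangles_setT.
  exists setT; last by rewrite setXTT.
  by exists setT => //; exists setT => //; rewrite setXTT.
have GI : setI_closed G.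
  apply: product_sets_setI; first exact: rectangles_setI.
  by apply: product_sets_setI => A B; exact: measurableI.
have GE : @measurable _ (n.-tuple E * (E * (E * R)))%type = <<s G >>.
  apply: product_sets_generate => //; first exact: measurable_prod_measurableType.
    exact: rectangles_setT.
  by exists setT => //; exists setT => //; rewrite setXTT.
apply: (@integral_like_unique _ _ _ G (fun f => \int[Pr]_w f (joined i j w))%E
  (fun f => \int[M3]_z f (substituted i z))%E) => //.
- by apply: integral_like_pullback; exact: mjoined.
- by apply: (integral_like_pullback M3); exact: msubstituted.
- by move=> g g0; exact: integral_ge0.
- by move=> g g0; exact: integral_ge0.
- by rewrite integral_cst// mul1e [ltLHS](@probability_setT _ _ _ Pr) ltry.
move=> _ [A' [A mA <-] [_ [C mC [D mD <-]] <-]].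
have mrect : measurable (rectangle (fun l (t : n.-tuple E) => tnth t l) A).
  by rewrite GXE; apply: sub_sigma_algebra; exists A.
have mACD := measurableX mrect (measurableX mC mD).
rewrite [LHS](integral_indic_pullback Pr (mjoined i j) mACD).
rewrite [RHS](integral_indic_pullback M3 (msubstituted i) mACD).
pose B l := (A l `*` setT) `&` (if l == i then D else setT).
have mB l : measurable (B l).
  by apply: measurableI; [exact: measurableX|case: ifP].
pose A0 l := if l == i then setT else A l.
have mA0 l : measurable (A0 l) by rewrite /A0; case: ifP.
transitivity (\prod_l JL (B l) * Q C)%E.
  rewrite -(sample_product1 j mB mC); congr (Pr _); apply/seteqP; split => w.
    move=> [/= h [hC hD]]; split => // l; split => /=.
      by split => //; have := h l; rewrite tnth_mktuple.
    by case: eqP => [->|].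
  move=> [/= h hC]; split => /=.
    by move=> l; rewrite tnth_mktuple; case: (h l) => -[].
  by split => //=; case: (h i) => _; rewrite eqxx.
have mrect0 : measurable (rectangle (fun l (t : n.-tuple E) => tnth t l) A0).
  by rewrite GXE; apply: sub_sigma_algebra; exists A0.
rewrite (_ : _ @^-1` _ = rectangle (fun l (t : n.-tuple E) => tnth t l) A0 `*`
    (C `*` B i)); last first.
  apply/seteqP; split => -[t [x [u y]]] /=.
    move=> [/= h [hC hD]]; split => /=.
      by move=> l; have := h l; rewrite tnth_upd /A0; case: ifP.
    split => //=; rewrite /B eqxx; split => //=; split => //.
    by have := h i; rewrite tnth_upd eqxx.
  move=> [/= h [hC]]; rewrite /B eqxx => -[[/= hA _] hD]; split => //= l.
  rewrite tnth_upd; case: eqP => [->//|/eqP/negbTE li].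
  by have := h l; rewrite /A0 li.
have M3E : M3 (rectangle (fun l (t : n.-tuple E) => tnth t l) A0 `*` (C `*` B i)) =
    (law_Xt (rectangle (fun l (t : n.-tuple E) => tnth t l) A0) * (Q C * JL (B i)))%E.
  rewrite -(product_measure1E Q JL mC (mB i)).
  exact: (product_measure1E law_Xt M2 mrect0 (measurableX mC (mB i))).
apply: (etrans _ (esym M3E)); rewrite law_Xt_rectangle//.
rewrite (bigD1 i)//= [in RHS](bigD1 i)//= {1}/A0 eqxx [P setT](@probability_setT _ _ _ P) mul1e.
rewrite -[in LHS]muleA [in LHS]muleC -[in LHS]muleA; congr (_ * (_ * _))%E.
apply: eq_bigr => l /negbTE li; rewrite /B /A0 li setIT; exact: joint_law_fst.
Qed.

(** [sample_law] on events of the covariates alone. *)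
Lemma law_Xt_resamplable : (0 < m)%N -> resamplable law_Xt P.
Proof.
move=> m0 i A mA; pose j := Ordinal m0.
have mf : measurable_fun [set: n.-tuple E * (E * (E * R))] (fun z => (\1_A z.1)%:E : \bar R).
  apply/measurable_EFinP; apply: (measurableT_comp (measurable_indic mA)).
  exact: measurable_fst.
have f0 (z : n.-tuple E * (E * (E * R))) : (0 <= (\1_A z.1)%:E :> \bar R)%E.
  by rewrite lee_fin.
rewrite law_XtE -[LHS](integral_indic_pullback Pr measurable_Xt mA).
rewrite [LHS](sample_law i j mf f0).
have mg : measurable_fun [set: n.-tuple E * (E * (E * R))] (fun z => upd z.1 i z.2.2.1).
  exact: (measurableT_comp measurable_fst (msubstituted i)).
rewrite [LHS](integral_indic_pullback M3 mg mA); apply: eq_integral => x _ /=.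
have mU : measurable ((fun z : n.-tuple E * E => upd z.1 i z.2) @^-1` A).
  by rewrite -[X in measurable X]setTI; exact: (measurable_upd i).
have mAx := measurable_xsection x mU.
rewrite -joint_law_fst//.
transitivity (M2 (setT `*` (xsection ((fun z : n.-tuple E * E => upd z.1 i z.2) @^-1` A) x `*` setT))).
  congr (M2 _); apply/seteqP; split => -[y [u r]]; rewrite /xsection/= !inE//=.
  by move=> [_ []].
rewrite [LHS](product_measure1E Q JL measurableT (measurableX mAx measurableT)).
rewrite -[RHS]mul1e; congr (_ * _)%E; exact: probability_setT.
Qed.

(** Independence of the covariates and a query point, read on integrals. *)
Lemma sample_query_law j (f : n.-tuple E * E -> \bar R) :
  measurable_fun setT f -> (forall z, 0 <= f z)%E ->
  (\int[Pr]_w f (Xt w, Xs j w) = \int[law_Xt \x Q]_z f z)%E.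
Proof.
have m0 : (0 < m)%N by apply: leq_ltn_trans (ltn_ord j).
pose G := product_sets GX (@measurable _ E).
have mXX : measurable_fun [set: T] (fun w => (Xt w, Xs j w)).
  by apply: measurable_fun_pair => //; exact: measurable_Xt.
have GT : G setT.
  exists setT; first exact: rectangles_setT.
  by exists setT => //; rewrite setXTT.
have GI : setI_closed G.
  apply: product_sets_setI; first exact: rectangles_setI.
  by move=> A B; exact: measurableI.
have GE : @measurable _ (n.-tuple E * E)%type = <<s G >>.
  apply: product_sets_generate => //; last exact: rectangles_setT.
  by rewrite sigma_algebra_id//; exact: sigma_algebra_measurable.
apply: (@integral_like_unique _ _ _ G (fun f => \int[Pr]_w f (Xt w, Xs j w))%E
  (fun f => \int[law_Xt \x Q]_z f z)%E) => //.
- exact: (integral_like_pullback Pr mXX).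
- exact: integral_like_integral.
- by move=> g g0; exact: integral_ge0.
- by move=> g g0; exact: integral_ge0.
- by rewrite integral_cst// mul1e [ltLHS](@probability_setT _ _ _ Pr) ltry.
move=> _ [A' [A mA <-] [C mC <-]].
have mrect : measurable (rectangle (fun l (t : n.-tuple E) => tnth t l) A).
  by rewrite GXE; apply: sub_sigma_algebra; exists A.
have mAC := measurableX mrect mC.
rewrite [LHS](integral_indic_pullback Pr mXX mAC) integral_indic// setIT.
apply: (etrans _ (esym (product_measure1E law_Xt Q mrect mC))).
transitivity ((\prod_l P (A l)) * Q C)%E; last by rewrite -(law_Xt_rectangle mA m0).
have := @sample_product1 (fun l => A l `*` setT) C j
  (fun l => measurableX (mA l) measurableT) mC.
under [in RHS]eq_bigr do rewrite joint_law_fst//.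
move=> <-; congr (Pr _); apply/seteqP; split => w /=.
  by move=> [/= h hC]; split => // l; split => //=; have := h l; rewrite tnth_mktuple.
by move=> [h hC]; split => //= l; rewrite tnth_mktuple; case: (h l).
Qed.

Lemma sample_law_iterated i j (f : n.-tuple E * (E * (E * R)) -> \bar R) :
  measurable_fun setT f -> (forall z, 0 <= f z)%E ->
  (\int[Pr]_w f (Xt w, (Xs j w, (X i w, Y i w))) =
   \int[law_Xt]_t \int[Q]_x \int[P]_u \int[nu u]_y f (upd t i u, (x, (u, y))))%E.
Proof.
move=> mf f0; rewrite sample_law//.
have mfs : measurable_fun [set: n.-tuple E * (E * (E * R))] (fun z => f (substituted i z)).
  by apply: measurableT_comp => //; exact: msubstituted.
rewrite [LHS](@fubini_tonelli1 _ _ _ _ _ law_Xt M2)//.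
apply: eq_integral => t _.
have mft : measurable_fun [set: E * (E * R)] (fun z => f (substituted i (t, z))).
  by apply: (measurableT_comp mfs); exact: measurable_pair1.
rewrite [LHS](@fubini_tonelli1 _ _ _ _ _ Q JL)//.
apply: eq_integral => x _.
have mfx : measurable_fun [set: E * R] (fun z => f (substituted i (t, (x, z)))).
  by apply: (measurableT_comp mft); exact: measurable_pair1.
exact: (@integral_joint_law _ _ _ _ _ P nu _ mfx (fun z => f0 _)).
Qed.

(** Integrating out the label: a function of [(X_i, Y_i)] and of the query
    point may be replaced by its conditional expectation. *)
Lemma sample_tower i j (phi : n.-tuple E * E -> R) (H : E * (E * R) -> \bar R) :
  measurable_fun setT phi -> (forall z, 0 <= phi z) ->
  measurable_fun setT H -> (forall z, 0 <= H z)%E ->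
  (\int[Pr]_w ((phi (Xt w, Xs j w))%:E * H (Xs j w, (X i w, Y i w))) =
   \int[Pr]_w ((phi (Xt w, Xs j w))%:E * \int[nu (X i w)]_y H (Xs j w, (X i w, y))))%E.
Proof.
move=> mphi phi0 mH H0.
pose D (z : E * E) := (\int[nu z.2]_y H (z.1, (z.2, y)))%E.
have mD : measurable_fun [set: E * E] D by exact: measurable_delayed_integral.
have D0 z : (0 <= D z)%E by exact: integral_ge0.
have mp1 : measurable_fun [set: n.-tuple E * (E * (E * R))] (fun z => (z.1, z.2.1)).
  by apply: measurable_fun_pair => //; exact: (measurableT_comp measurable_fst measurable_snd).
have mp2 : measurable_fun [set: n.-tuple E * (E * (E * R))] (fun z => (z.2.1, z.2.2.1)).
  apply: measurable_fun_pair; first exact: (measurableT_comp measurable_fst measurable_snd).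
  apply: (measurableT_comp measurable_fst); exact: (measurableT_comp measurable_snd measurable_snd).
have mphiE : measurable_fun [set: n.-tuple E * (E * (E * R))] (fun z => (phi (z.1, z.2.1))%:E).
  by apply/measurable_EFinP; exact: (measurableT_comp mphi mp1).
rewrite (@sample_law_iterated i j (fun z => (phi (z.1, z.2.1))%:E * H z.2)%E); last 2 first.
- by apply: emeasurable_funM => //; exact: measurableT_comp.
- by move=> z; rewrite mule_ge0 ?lee_fin.
rewrite (@sample_law_iterated i j (fun z => (phi (z.1, z.2.1))%:E * D (z.2.1, z.2.2.1))%E); last 2 first.
- by apply: emeasurable_funM => //; exact: (measurableT_comp mD mp2).
- by move=> z; rewrite mule_ge0 ?lee_fin.
apply: eq_integral => t _; apply: eq_integral => x _; apply: eq_integral => u _ /=.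
rewrite ge0_integralZl ?lee_fin//; last first.
  apply: measurableT_comp => //; apply: measurable_fun_pair => //; exact: measurable_pair1.
rewrite [in RHS]integral_cst// (_ : nu u setT = 1%E) ?mule1//.
exact: prob_kernel.
Qed.

End sample_law.

(** * Averaging out labels and query points *)

Section signed_parts.
Local Open Scope ereal_scope.
Context {R : realType} d (T : measurableType d) (mu : {measure set T -> \bar R}).

Lemma integral_signed_parts (f : T -> R) :
  \int[mu]_x (f x)%:E =
  \int[mu]_x (Num.max (f x) 0)%:E - \int[mu]_x (Num.max (- f x) 0)%:E.
Proof.
rewrite integralE; congr (_ - _); apply: eq_integral => x _.
  by rewrite funeposE EFin_max.
by rewrite funenegE EFin_max.
Qed.

Lemma integrable_signed_parts (f : T -> R) : measurable_fun [set: T] f ->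
  \int[mu]_x (`|f x|)%:E < +oo ->
  mu.-integrable [set: T] (EFin \o f).
Proof.
move=> mf foo; apply/integrableP; split; first exact/measurable_EFinP.
exact: foo.
Qed.

End signed_parts.

Section conditional_bias.
Context dT (T : measurableType dT) (R : realType) (d n m k : nat).
Local Notation E := 'rV[R]_d.
Variables (Pr : probability T R) (P Q : probability E R) (nu : R.-pker E ~> R).
Variables (X : 'I_n -> {RV Pr >-> E}) (Y : 'I_n -> {RV Pr >-> R}).
Variables (Xs : 'I_m -> {RV Pr >-> E}).
Hypothesis sampleP : is_sample P Q nu X Y Xs.
Variable H : E * (E * R) -> R.
Hypothesis mH : measurable_fun [set: E * (E * R)] H.
Hypothesis H_int : forall x u, (nu u).-integrable [set: R] (fun y => (H (x, (u, y)))%:E).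
Hypothesis H_fin : (\int[Q]_x \int[joint_law P nu]_z `|(H (x, z))%:E| < +oo)%E.

(** The integrand is averaged over the label attached to the covariate [z.2],
    for the query point [z.1]. *)
Definition fibre_mean (z : E * E) : R := \int[nu z.2]_y H (z.1, (z.2, y)).

Let D := fibre_mean.
Hypothesis bD : bmeas D.

Let mX l : measurable_fun [set: T] (X l). Proof. exact: measurable_funPT. Qed.
Let mY l : measurable_fun [set: T] (Y l). Proof. exact: measurable_funPT. Qed.
Let mXs j : measurable_fun [set: T] (Xs j). Proof. exact: measurable_funPT. Qed.

Let HXY i j w := H (Xs j w, (X i w, Y i w)).

Let mHXY i j : measurable_fun [set: T] (HXY i j).
Proof.
apply: (measurableT_comp mH); apply: measurable_fun_pair => //.
exact: measurable_fun_pair.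
Qed.

Lemma sample_H_integrable i j : Pr.-integrable [set: T] (EFin \o HXY i j).
Proof.
apply: integrable_signed_parts => //; apply: le_lt_trans H_fin.
rewrite (@sample_law_iterated _ _ _ _ _ _ _ _ _ _ _ _ _ sampleP i j
  (fun z => (`|H z.2|)%:E)); last 2 first.
- apply/measurable_EFinP; apply: measurableT_comp => //.
  exact: (measurableT_comp mH measurable_snd).
- by move=> z; rewrite lee_fin.
have HE : (\int[Q]_x \int[P]_u \int[nu u]_y (`|H (x, (u, y))|)%:E =
    \int[Q]_x \int[joint_law P nu]_z `|(H (x, z))%:E|)%E.
  apply: eq_integral => x _.
  rewrite integral_joint_law//; apply/measurable_EFinP; apply: measurableT_comp => //.
  by apply: (measurableT_comp mH); exact: measurable_pair1.
rewrite [leLHS](_ : _ = \int[law_Xt X]_t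
    (cst (\int[Q]_x \int[joint_law P nu]_z `|(H (x, z))%:E|) t))%E; last first.
  by apply: eq_integral => t _; exact: HE.
by rewrite integral_cst// [X in (_ * X)%E](@probability_setT _ _ _ (law_Xt X)) mule1.
Qed.

Let Hp (z : E * (E * R)) : R := Num.max (H z) 0.
Let Hn (z : E * (E * R)) : R := Num.max (- H z) 0.

Let mHp : measurable_fun [set: E * (E * R)] Hp. Proof. exact: measurable_maxr. Qed.
Let mHn : measurable_fun [set: E * (E * R)] Hn.
Proof. by apply: measurable_maxr => //; exact: measurableT_comp. Qed.

Let DG (G : E * (E * R) -> R) (z : E * E) : \bar R := (\int[nu z.2]_y (G (z.1, (z.2, y)))%:E)%E.

Let DG_fin (G : E * (E * R) -> R) z : measurable_fun setT G -> (forall z, 0 <= G z <= `|H z|) ->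
  DG G z \is a fin_num.
Proof.
move=> mG GH; apply: integrable_fin_num => //.
have mGz : measurable_fun [set: R] (fun y => G (z.1, (z.2, y))).
  by apply: (measurableT_comp mG); apply: measurable_fun_pair => //; exact: measurable_pair1.
apply: (le_integrable measurableT _ _ (H_int z.1 z.2)); first exact/measurable_EFinP.
move=> y _; rewrite !abse_EFin lee_fin; case/andP: (GH (z.1, (z.2, y))) => G0 GH'.
by rewrite ger0_norm.
Qed.

Let Hp_le z : 0 <= Hp z <= `|H z|.
Proof. by rewrite /Hp le_max lexx orbT ge_max ler_norm normr_ge0. Qed.

Let Hn_le z : 0 <= Hn z <= `|H z|.
Proof. by rewrite /Hn le_max lexx orbT ge_max -[X in _ <= X]normrN ler_norm normr_ge0. Qed.

Let DE z : D z = fine (DG Hp z) - fine (DG Hn z).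
Proof.
rewrite /D /fibre_mean /Rintegral integral_signed_parts.
exact: (fineB (DG_fin z mHp Hp_le) (DG_fin z mHn Hn_le)).
Qed.

Let measurable_DG (G : E * (E * R) -> R) : measurable_fun setT G ->
  (forall z, 0 <= G z <= `|H z|) -> measurable_fun [set: E * E] (fun z => fine (DG G z)).
Proof.
move=> mG GH; apply/measurable_EFinP.
rewrite (_ : EFin \o _ = DG G); last by apply/funext => z; rewrite /= fineK//; exact: DG_fin.
apply: (@measurable_delayed_integral _ _ _ _ _ nu (EFin \o G)); first exact/measurable_EFinP.
by move=> z; rewrite lee_fin; case/andP: (GH z).
Qed.

Lemma measurable_fibre_mean : measurable_fun [set: E * E] fibre_mean.
Proof.
rewrite (_ : fibre_mean = fun z => fine (DG Hp z) - fine (DG Hn z)); last first.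
  by apply/funext => z; exact: DE.
by apply: measurable_funB; exact: measurable_DG.
Qed.

Section weight.
Variables (phi : n.-tuple E * E -> R) (M : R).
Hypotheses (mphi : measurable_fun setT phi) (phiM : forall z, 0 <= phi z <= M).

Let phiX j w := phi (Xt X w, Xs j w).

Let mphiX j : measurable_fun [set: T] (phiX j).
Proof.
by apply: (measurableT_comp mphi); apply: measurable_fun_pair => //; exact: measurable_Xt.
Qed.

Let phi0 z : 0 <= phi z. Proof. by case/andP: (phiM z). Qed.

Lemma weighted_H_integrable i j : Pr.-integrable [set: T] (fun w => (phiX j w * HXY i j w)%:E).
Proof.
have := integrableZl measurableT (Num.max M 0) (sample_H_integrable i j).
apply: le_integrable => //; first by apply/measurable_EFinP; exact: measurable_funM.
move=> w _; rewrite /= lee_fin !normrM ler_wpM2r// ger0_norm; last exact: phi0.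
rewrite ger0_norm; last by rewrite le_max lexx orbT.
by rewrite le_max; case/andP: (phiM (Xt X w, Xs j w)) => _ ->.
Qed.

Let tower_part i j (G : E * (E * R) -> R) : measurable_fun setT G -> (forall z, 0 <= G z <= `|H z|) ->
  (\int[Pr]_w (phiX j w * G (Xs j w, (X i w, Y i w)))%:E =
   \int[Pr]_w (phiX j w * fine (DG G (Xs j w, X i w)))%:E)%E.
Proof.
move=> mG GH; have := @sample_tower _ _ _ _ _ _ _ _ _ _ _ _ _ sampleP i j phi
  (EFin \o G) mphi phi0 _ _.
rewrite (_ : (fun w => _ * _)%E = fun w => (phiX j w * G (Xs j w, (X i w, Y i w)))%:E)//.
move=> ->.
- apply: eq_integral => w _; rewrite EFinM fineK//; exact: DG_fin.
- exact/measurable_EFinP.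
- by move=> z; rewrite lee_fin; case/andP: (GH z).
Qed.

(** [sample_tower] applied to the positive and negative parts of the
    integrand. *)
Lemma signed_tower i j :
  (\int[Pr]_w (phiX j w * HXY i j w)%:E = \int[Pr]_w (phiX j w * D (Xs j w, X i w))%:E)%E.
Proof.
have maxM w (a : R) : Num.max (phiX j w * a) 0 = phiX j w * Num.max a 0.
  by rewrite maxr_pMr ?mulr0//; exact: phi0.
have pos (G : E * (E * R) -> R) : measurable_fun setT G -> (forall z, 0 <= G z <= `|H z|) ->
    Pr.-integrable [set: T] (fun w => (phiX j w * fine (DG G (Xs j w, X i w)))%:E).
  move=> mG GH.
  have mfine : measurable_fun [set: T] (fun w => fine (DG G (Xs j w, X i w))).
    by apply: (measurableT_comp (measurable_DG mG GH)); exact: measurable_fun_pair.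
  have f0 w : 0 <= phiX j w * fine (DG G (Xs j w, X i w)).
    apply: mulr_ge0; first exact: phi0.
    by apply: fine_ge0; apply: integral_ge0 => y _; rewrite lee_fin; case/andP: (GH (Xs j w, (X i w, y))).
  apply/integrableP; split; first by apply/measurable_EFinP; exact: measurable_funM.
  under eq_integral do rewrite abse_EFin ger0_norm//.
  rewrite -tower_part//.
  have /integrableP[_] := weighted_H_integrable i j.
  apply: le_lt_trans; apply: ge0_le_integral => //.
  - by move=> w _; rewrite lee_fin mulr_ge0; [|exact: phi0|case/andP: (GH (Xs j w, (X i w, Y i w)))].
  - apply/measurable_EFinP; apply: measurable_funM => //; apply: (measurableT_comp mG).
    by apply: measurable_fun_pair => //; exact: measurable_fun_pair.
  - by apply: measurableT_comp => //; apply/measurable_EFinP; exact: measurable_funM.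
  move=> w _; rewrite abse_EFin lee_fin normrM (ger0_norm (phi0 _)) ler_wpM2l//.
    exact: phi0.
  by case/andP: (GH (Xs j w, (X i w, Y i w))).
rewrite integral_signed_parts.
under eq_integral do rewrite maxM.
under [X in (_ - X)%E]eq_integral do rewrite -mulrN maxM.
rewrite (tower_part i j mHp Hp_le) (tower_part i j mHn Hn_le).
rewrite -integralB//; last 2 first.
- exact: pos.
- exact: pos.
by apply: eq_integral => w _; rewrite -EFinB -mulrBr DE.
Qed.

End weight.

Lemma law_Xt_mean (f : n.-tuple E -> R) : bmeas f ->
  \int[law_Xt X]_t f t = \int[Pr]_w f (Xt X w).
Proof.
move=> bf; have mXt := measurable_Xt X.
have bfX := bmeas_comp mXt bf.
congr fine; rewrite [LHS](@integral_pushforward _ _ _ _ _ (XtRV X))//.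
- by apply/measurable_EFinP; case: bf.
- by rewrite preimage_setT; exact: (bmeas_integrable Pr bfX).
Qed.

(** [sample_query_law] after shifting a bounded function to a nonnegative
    one. *)
Lemma sample_query_mean j (g : n.-tuple E * E -> R) : bmeas g ->
  \int[Pr]_w g (Xt X w, Xs j w) = \int[law_Xt X]_t \int[Q]_x g (t, x).
Proof.
move=> bg; have [mg [M gM]] := bg.
have mXX : measurable_fun [set: T] (fun w => (Xt X w, Xs j w)).
  by apply: measurable_fun_pair => //; exact: measurable_Xt.
have bgX := bmeas_comp mXX bg.
pose g' z := g z + M.
have g'0 z : 0 <= g' z by have := gM z; have := ler_norm (- g z); rewrite normrN /g'; lra.
have bg' : bmeas g' by apply: bmeasD => //; exact: bmeas_cst.
have bg't t := bmeas_slice1 t bg'; have bgt t := bmeas_slice1 t bg.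
have mg' : measurable_fun [set: n.-tuple E * E] (EFin \o g').
  by apply/measurable_EFinP; case: bg'.
have key : \int[Pr]_w g' (Xt X w, Xs j w) = \int[law_Xt X]_t \int[Q]_x g' (t, x).
  congr fine.
  rewrite [LHS](@sample_query_law _ _ _ _ _ _ _ _ _ _ _ _ _ sampleP j (EFin \o g'))//.
  rewrite [LHS](@fubini_tonelli1 _ _ _ _ _ (law_Xt X) Q)//.
  by apply: eq_integral => t _; rewrite (bmeas_EFin Q (bg't t)).
apply: (addIr M); rewrite -[X in _ + X](Rintegral_probability_cst Pr M) -RintegralD//; last 2 first.
- exact: (bmeas_integrable Pr bgX).
- by apply: (bmeas_integrable Pr (f := fun=> M)); exact: bmeas_cst.
rewrite [LHS]key -[X in _ = _ + X](Rintegral_probability_cst (law_Xt X) M) -RintegralD//; last 2 first.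
- exact: (bmeas_integrable (law_Xt X) (bmeas_fubini Q bg)).
- by apply: (bmeas_integrable (law_Xt X) (f := fun=> M)); exact: bmeas_cst.
apply: eq_Rintegral => t _; rewrite -[X in _ = _ + X](Rintegral_probability_cst Q M) -RintegralD//.
- exact: (bmeas_integrable Q (bgt t)).
- by apply: (bmeas_integrable Q (f := fun=> M)); exact: bmeas_cst.
Qed.

Section identity.
Variables (S : set E) (p : E -> R).
Hypotheses (d0 : (0 < d)%N) (mS : measurable S) (PS : P S = 1%E) (Pp : has_density P p).
Hypotheses (m0 : (0 < m)%N) (kn : (0 < k <= n)%N).

(** Error made at the query point [z.1] by using a label attached to [z.2].
    Without the indicator, the second term would remain for [z.2] outside
    [S]. *)
Definition bias_kernel (z : E * E) : R := \1_S z.2 * (D z - D (z.1, z.1)).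

(** Weight of [X_i] in the average over the neighbours of a query point, on the
    event [A]: testing a conditional expectation amounts to these weights. *)
Definition knn_test (A : set (n.-tuple E)) i (z : n.-tuple E * E) : R :=
  \1_A z.1 * (k%:R^-1 * (rank (dists z.1 z.2) i < k)%N%:R).

Let bDdiag : bmeas (fun x => D (x, x)).
Proof. exact: (bmeas_comp (measurable_fun_pair _ _) bD). Qed.

Lemma bmeas_bias_kernel : bmeas bias_kernel.
Proof.
apply: bmeasM; first exact: (bmeas_comp measurable_snd (bmeas_indic mS)).
apply: bmeasB => //.
exact: (bmeas_comp measurable_fst bDdiag).
Qed.

Lemma bmeas_knn_test A i : measurable A -> bmeas (knn_test A i).
Proof.
move=> mA; apply: bmeasM; first exact: (bmeas_comp measurable_fst (bmeas_indic mA)).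
by apply: bmeasZ; apply: bmeas_bool; exact: (measurable_rank i (fun r => (r < k)%N)).
Qed.

Lemma knn_test_ge0_le1 A i z : 0 <= knn_test A i z <= 1.
Proof.
have /andP[k0 _] := kn.
have k1 : 0 <= (k%:R^-1 : R) <= 1.
  by rewrite invr_ge0 ler0n invf_le1 ?ltr0n// ler1n.
rewrite /knn_test indicE; case: (_ \in _); case: (_ < _)%N; rewrite ?mul0r ?mulr0 ?mul1r ?mulr1 ?lexx ?ler01//.
Qed.

(** The label is averaged out by [signed_tower], the query point by
    [sample_query_mean]. Almost surely exactly [k] ranks are below [k], so that
    subtracting [D (x, x)] from the value of every neighbour subtracts it once
    from their average. *)
Lemma estimator_mean j A : measurable A ->
  (\sum_(i < n) \int[Pr]_w (knn_test A i (Xt X w, Xs j w) * H (Xs j w, (X i w, Y i w)))%:E =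
   (\int[Pr]_w (\1_A (Xt X w) *
      (knn_err Q bias_kernel k (Xt X w) + \int[Q]_x D (x, x))))%:E)%E.
Proof.
move=> mA; have /andP[k0 kn'] := kn.
have bt i := bmeas_knn_test i mA.
have mt i : measurable_fun setT (knn_test A i) by case: (bt i).
have mXt := measurable_Xt X.
pose g (z : n.-tuple E * E) : R := \sum_(i < n) knn_test A i z * D (z.2, tnth z.1 i).
have bDt i : bmeas (fun z : n.-tuple E * E => D (z.2, tnth z.1 i)).
  have mp : measurable_fun [set: n.-tuple E * E] (fun z => (z.2, tnth z.1 i)).
    by apply: measurable_fun_pair => //; exact: (measurableT_comp (measurable_tnth i) measurable_fst).
  exact: (bmeas_comp mp bD).
have bgi i : bmeas (fun z => knn_test A i z * D (z.2, tnth z.1 i)) by exact: bmeasM.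
have bg : bmeas g by exact: bmeas_sum.
have mXX : measurable_fun [set: T] (fun w => (Xt X w, Xs j w)).
  by apply: measurable_fun_pair.
transitivity ((\int[Pr]_w g (Xt X w, Xs j w))%:E).
  rewrite (Rintegral_bmeas_sum Pr (index_enum 'I_n) (fun i => bmeas_comp mXX (bgi i))).
  rewrite -sumEFin; apply: eq_bigr => i _.
  rewrite (signed_tower (mt i) (knn_test_ge0_le1 A i)).
  rewrite (bmeas_EFin Pr (bmeas_comp mXX (bgi i))).
  by apply: eq_integral => w _; rewrite /= tnth_mktuple.
congr EFin; rewrite sample_query_mean// (Rintegral_fubini (law_Xt X) Q bg)/=.
have muP : resamplable (law_Xt X) P := law_Xt_resamplable sampleP m0.
have bF := bmeas_bias_kernel.
have bavg := bmeas_knn_avg bF n k.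
pose g2 (z : n.-tuple E * E) : R := \1_A z.1 * (knn_avg bias_kernel k z.1 z.2 + D (z.2, z.2)).
have bA1 : bmeas (fun z : n.-tuple E * E => \1_A z.1 : R).
  exact: (bmeas_comp measurable_fst (bmeas_indic mA)).
have bD1 : bmeas (fun z : n.-tuple E * E => D (z.2, z.2)).
  exact: (bmeas_comp measurable_snd bDdiag).
have bg2 : bmeas g2 by apply: bmeasM => //; exact: bmeasD.
transitivity (\int[Q]_x \int[law_Xt X]_t g2 (t, x)).
  apply: eq_Rintegral => x _; congr fine; apply: ae_eq_integral => //.
  - by apply/measurable_EFinP; case: (bmeas_slice2 x bg).
  - by apply/measurable_EFinP; case: (bmeas_slice2 x bg2).
  apply: filterS (generic_ae d0 mS PS Pp x muP) => t [tS inj] _; congr EFin.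
  rewrite /g /g2 /knn_test /=; under eq_bigr do rewrite -mulrA.
  rewrite -mulr_sumr; congr (_ * _).
  have kE : \sum_(i < n) (rank (dists t x) i < k)%N%:R = k%:R :> R.
    by rewrite -natr_sum (card_rank_lt inj kn').
  have k0' : k%:R != 0 :> R by rewrite pnatr_eq0 -lt0n.
  have DxE : D (x, x) = k%:R^-1 * \sum_(i < n) (rank (dists t x) i < k)%N%:R * D (x, x).
    by rewrite -mulr_suml kE mulKf.
  rewrite [X in _ = _ + X]DxE /knn_avg -mulrDr -big_split/= mulr_sumr.
  apply: eq_bigr => i _; rewrite -mulrA; congr (_ * _).
  rewrite -mulrDr; congr (_ * _).
  by rewrite /bias_kernel/= indicE mem_set// mul1r subrK.
rewrite -(Rintegral_fubini (law_Xt X) Q bg2)/=.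
have berr := bmeas_knn_err Q bF n k.
transitivity (\int[law_Xt X]_t (\1_A t * (knn_err Q bias_kernel k t + \int[Q]_x D (x, x)))).
  apply: eq_Rintegral => t _; rewrite /g2/= RintegralZl//; last first.
    by apply: bmeas_integrable; apply: bmeasD => //; exact: (bmeas_slice1 t bavg).
  rewrite RintegralD//; first exact: (bmeas_integrable Q (bmeas_slice1 t bavg)).
  exact: (bmeas_integrable Q bDdiag).
apply: law_Xt_mean; apply: bmeasM; first exact: bmeas_indic.
by apply: bmeasD => //; exact: bmeas_cst.
Qed.

End identity.

End conditional_bias.

(** * Versions of the conditional expectation *)

Section versions.
Context dT (T : measurableType dT) (R : realType) (d n : nat).
Local Notation E := 'rV[R]_d.
Variables (Pr : probability T R) (X : 'I_n -> {RV Pr >-> E}).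

Lemma sigma_X_preimage B : sigma_X X B <-> exists2 A, measurable A & B = Xt X @^-1` A.
Proof.
have XE : sigma_X X = preimage_set_system setT (Xt X) measurable.
  rewrite /sigma_X -[RHS](g_sigma_preimage_comp (fun i (t : n.-tuple E) => tnth t i)).
  congr g_sigma_preimage; apply/funext => i; apply/funext => w.
  by rewrite /= tnth_mktuple.
rewrite XE; split => [[A mA <-]|[A mA ->]]; exists A => //; by rewrite setTI.
Qed.

(** Two versions of a conditional expectation agree where neither exceeds the
    other, and each of these two events is in the conditioning
    sigma-algebra. *)
Lemma cond_expectation_unique (Z W : T -> R) (v : n.-tuple E -> R) :
  is_cond_expectation Pr (sigma_X X) Z W -> bmeas v ->
  (forall A, measurable A -> (\int[Pr]_(w in Xt X @^-1` A) (Z w)%:E =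
     \int[Pr]_(w in Xt X @^-1` A) (v (Xt X w))%:E)%E) ->
  {ae Pr, forall w, W w = v (Xt X w)}.
Proof.
move=> [Zint Wint mW WZ] bv Zv; have [mv _] := bv.
have bvX := bmeas_comp (measurable_Xt X) bv.
have vint := bmeas_integrable Pr bvX.
pose V := v \o Xt X.
have mWT : measurable_fun [set: T] W by case/integrableP: Wint => /measurable_EFinP.
have mVT : measurable_fun [set: T] V by case: bvX.
pose G : set (set T) := \big[setU/set0]_(i < n) preimage_set_system setT (X i : T -> E) measurable.
have mW' : measurable_fun [set: g_sigma_algebraType G] W.
  by move=> _ B mB; rewrite setTI; exact: mW.
have mV' : measurable_fun [set: g_sigma_algebraType G] V.
  move=> _ B mB; rewrite setTI; apply/sigma_X_preimage; exists (v @^-1` B) => //.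
  by rewrite -[X in measurable X]setTI; exact: mv.
have null (f g : T -> R) : measurable_fun [set: T] f -> measurable_fun [set: T] g ->
    Pr.-integrable [set: T] (EFin \o f) -> Pr.-integrable [set: T] (EFin \o g) ->
    (\int[Pr]_(w in [set w | (f w < g w)%R]) (f w)%:E =
     \int[Pr]_(w in [set w | (f w < g w)%R]) (g w)%:E)%E ->
    {ae Pr, forall w, (g w <= f w)%R}.
  move=> mf mg intf intg fg.
  have mA : measurable [set w | (f w < g w)%R].
    by rewrite -[X in measurable X]setTI; exact: measurable_fun_ltr.
  have intf' := integrableS measurableT mA (@subsetT _ _) intf.
  have intg' := integrableS measurableT mA (@subsetT _ _) intg.
  have : (\int[Pr]_(w in [set w | (f w < g w)%R]) `|(g w - f w)%:E| = 0)%E.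
    transitivity (\int[Pr]_(w in [set w | (f w < g w)%R]) ((g w)%:E - (f w)%:E))%E.
      apply: eq_integral => w; rewrite inE/= => fgw.
      by rewrite ger0_norm ?subr_ge0 ?(ltW fgw)// EFinD.
    rewrite integralB// fg subee//.
    exact: integrable_fin_num.
  move/(ae_eq_integral_abs Pr mA) => h.
  have {}h := h _.
  apply: filterS (h _) => [w hw|]; last first.
    by apply/measurable_EFinP; apply: measurable_funB; exact: measurable_funTS.
  rewrite leNgt; apply/negP => fgw.
  have [] := hw fgw => /eqP; rewrite subr_eq0 => /eqP gf.
  by move: fgw; rewrite gf ltxx.
have sets (f g : T -> R) : measurable_fun [set: g_sigma_algebraType G] f ->
    measurable_fun [set: g_sigma_algebraType G] g ->
    sigma_X X [set w | (f w < g w)%R].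
  have mt : measurable [set true] by [].
  move=> mf mg; have := measurable_fun_ltr mf mg measurableT mt.
  by rewrite setTI.
have eqA A : sigma_X X A -> (\int[Pr]_(w in A) (W w)%:E = \int[Pr]_(w in A) (V w)%:E)%E.
  by move=> sA; rewrite WZ//; have [B mB ->] := (sigma_X_preimage A).1 sA; exact: Zv.
have le1 := null V W mVT mWT vint Wint (esym (eqA _ (sets V W mV' mW'))).
have le2 := null W V mWT mVT Wint vint (eqA _ (sets W V mW' mV')).
apply: filterS2 le1 le2 => w WV VW; apply/eqP.
by rewrite eq_le WV.
Qed.

Variable k : nat.
Hypothesis kn : (0 < k <= n)%N.

Lemma dists_Xt w z i : dists (Xt X w) z i = enorm (X i w - z).
Proof. by rewrite /dists tnth_mktuple. Qed.

Lemma le_knn_radius w z i :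
  (enorm (X i w - z) <= knn_radius k (X ^~ w) z)%R = (rank (dists (Xt X w) z) i < k)%N.
Proof.
rewrite -dists_Xt -(le_order_statistic (dists (Xt X w) z) i kn).
congr (_ <= nth 0 (sort _ (codom _)) _)%R; apply/funext => l.
by rewrite dists_Xt.
Qed.

Lemma knn_weightE w z i :
  knn_weight k (X ^~ w) z i = k%:R^-1 * (rank (dists (Xt X w) z) i < k)%N%:R.
Proof. by rewrite /knn_weight le_knn_radius. Qed.

(** The count attached to [X_i] is a sum over the query points; exchanging the
    sums leaves an average over query points of averages over neighbours. *)
Lemma estimator2E m (h : E * R -> R) w (y : 'I_n -> R) (xs : 'I_m -> E) :
  (0 < m)%N ->
  estimator2 k h (X ^~ w) y xs =
    m%:R^-1 * \sum_(j < m) \sum_(i < n) knn_weight k (X ^~ w) (xs j) i * h (X i w, y i).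
Proof.
move=> m0; have /andP[k0 kn'] := kn.
have n0 : n%:R != 0 :> R by rewrite pnatr_eq0 -lt0n (leq_trans k0).
have k0' : k%:R != 0 :> R by rewrite pnatr_eq0 -lt0n.
have m0' : m%:R != 0 :> R by rewrite pnatr_eq0 -lt0n.
have countE i : (knn_count k (X ^~ w) xs (X i w))%:R =
    k%:R * \sum_(j < m) knn_weight k (X ^~ w) (xs j) i.
  rewrite /knn_weight -mulr_sumr mulrA mulfV// mul1r /knn_count natr_sum.
  by apply: eq_bigr => j _; rewrite enormB.
rewrite /estimator2 exchange_big/= !mulr_sumr; apply: eq_bigr => i _.
by rewrite countE -mulr_suml; field; rewrite n0 m0' k0'.
Qed.

End versions.

(** * Labels drawn among the neighbours *)

Section labels.
Context dT (T : measurableType dT) (R : realType) (d n m k : nat).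
Local Notation E := 'rV[R]_d.
Variables (Pr : probability T R) (P Q : probability E R) (nu : R.-pker E ~> R).
Variables (X : 'I_n -> {RV Pr >-> E}) (Y : 'I_n -> {RV Pr >-> R}).
Variables (Xs : 'I_m -> {RV Pr >-> E}) (Ys : 'I_m -> {RV Pr >-> R}).
Variables (S : set E) (p : E -> R).
Hypothesis sampleP : is_sample P Q nu X Y Xs.
Hypothesis labelsP : resampled_labels X Y Xs Ys k.
Hypotheses (d0 : (0 < d)%N) (mS : measurable S) (PS : P S = 1%E) (Pp : has_density P p).
Hypotheses (m0 : (0 < m)%N) (kn : (0 < k <= n)%N).

Let mX l : measurable_fun [set: T] (X l). Proof. exact: measurable_funPT. Qed.
Let mY l : measurable_fun [set: T] (Y l). Proof. exact: measurable_funPT. Qed.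
Let mXs j : measurable_fun [set: T] (Xs j). Proof. exact: measurable_funPT. Qed.
Let mYs j : measurable_fun [set: T] (Ys j). Proof. exact: measurable_funPT. Qed.

Let mXX j : measurable_fun [set: T] (fun w => (Xt X w, Xs j w)).
Proof. by apply: measurable_fun_pair => //; exact: measurable_Xt. Qed.

Let gens : set (set T) := g_sigma_preimage (fun i => X i : T -> _)
      `|` g_sigma_preimage (fun i => Y i : T -> _)
      `|` g_sigma_preimage (fun j => Xs j : T -> _).

Let coordinate dE (E' : measurableType dE) l (f : 'I_l -> T -> E') i :
  g_sigma_preimage f `<=` gens -> measurable_fun [set: g_sigma_algebraType gens] (f i).
Proof.
move=> fgens _ B mB; rewrite setTI; apply: sub_sigma_algebra; apply: fgens.
by apply: sub_sigma_algebra; rewrite (bigD1 i)//=; left; exists B => //; rewrite setTI.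
Qed.

Lemma sigma_sample_query j (A : set (n.-tuple E * E)) : measurable A ->
  sigma_sample X Y Xs [set w | A (Xt X w, Xs j w)].
Proof.
move=> mA.
have mXt' : measurable_fun [set: g_sigma_algebraType gens] (Xt X).
  apply/measurable_fun_tnthP => i.
  rewrite (_ : _ \o _ = X i); last by apply/funext => w; rewrite /= tnth_mktuple.
  by apply: (coordinate (f := fun i => X i : T -> _)) => B sB; left; left.
have mXs' : measurable_fun [set: g_sigma_algebraType gens] (Xs j).
  by apply: (coordinate (f := fun i => Xs i : T -> _)) => B sB; right.
have := measurable_fun_pair mXt' mXs' measurableT mA.
by rewrite setTI.
Qed.

Definition query_weight i (z : n.-tuple E * E) : R :=
  k%:R^-1 * (rank (dists z.1 z.2) i < k)%N%:R.

Lemma bmeas_query_weight i : bmeas (query_weight i).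
Proof. by apply: bmeasZ; apply: bmeas_bool; exact: (measurable_rank i (fun r => (r < k)%N)). Qed.

Lemma query_weight_ge0 i z : 0 <= query_weight i z.
Proof. by rewrite mulr_ge0 ?invr_ge0. Qed.

(** Almost surely there are no ties, and exactly [k] points have weight
    [1 / k]. *)
Lemma query_weight_sum j :
  {ae Pr, forall w, \sum_(i < n) query_weight i (Xt X w, Xs j w) = 1}.
Proof.
have /andP[k0 kn'] := kn.
pose g (z : n.-tuple E * E) : R := `|\sum_(i < n) query_weight i z - 1|.
have bs : bmeas (fun z => \sum_(i < n) query_weight i z - 1).
  apply: bmeasB; last exact: bmeas_cst.
  by apply: bmeas_sum => i; exact: bmeas_query_weight.
have bg : bmeas g.
  have [mg [M gM]] := bs; split; first exact: measurableT_comp.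
  by exists M => z; rewrite normr_id.
have muP : resamplable (law_Xt X) P := law_Xt_resamplable sampleP m0.
have g0 : \int[Pr]_w g (Xt X w, Xs j w) = 0.
  rewrite (sample_query_mean sampleP j bg) (Rintegral_fubini (law_Xt X) Q bg)/=.
  rewrite -[RHS](Rintegral_probability_cst Q); apply: eq_Rintegral => x _.
  rewrite -[RHS](Rintegral_probability_cst (law_Xt X)); congr fine.
  apply: ae_eq_integral => //.
    by apply/measurable_EFinP; case: (bmeas_slice2 x bg).
  apply: filterS (generic_ae d0 mS PS Pp x muP) => t [tS inj] _; congr EFin.
  rewrite /g /query_weight /= -mulr_sumr -natr_sum (card_rank_lt inj kn') mulVf ?subrr ?normr0//.
  by rewrite pnatr_eq0 -lt0n.
have bgX := bmeas_comp (mXX j) bg.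
have mgX : measurable_fun [set: T] (EFin \o (g \o (fun w => (Xt X w, Xs j w)))).
  by apply/measurable_EFinP; case: bgX.
have : (\int[Pr]_w `|(g (Xt X w, Xs j w))%:E| = 0)%E.
  transitivity (\int[Pr]_w g (Xt X w, Xs j w))%:E; last by rewrite g0.
  rewrite (bmeas_EFin Pr bgX); apply: eq_integral => w _.
  by rewrite gee0_abs// lee_fin normr_ge0.
move/(ae_eq_integral_abs Pr measurableT mgX); apply: filterS => w /(_ I)[].
by move/eqP; rewrite normr_eq0 subr_eq0 => /eqP.
Qed.

(** The conditional law of the labels is tested with a constraint on the [j]-th
    one only: the other factors of the product are [1] almost surely by
    [query_weight_sum]. *)
Lemma label_law j (f : (n.-tuple E * E) * R -> \bar R) :
  measurable_fun setT f -> (forall z, 0 <= f z)%E ->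
  (\int[Pr]_w f ((Xt X w, Xs j w), Ys j w) =
   \sum_(i < n) \int[Pr]_w ((query_weight i (Xt X w, Xs j w))%:E *
      f ((Xt X w, Xs j w), Y i w)))%E.
Proof.
pose G := product_sets (@measurable _ (n.-tuple E * E)%type) (@measurable _ R).
have GT : G setT by exists setT => //; exists setT => //; rewrite setXTT.
have GI : setI_closed G by apply: product_sets_setI => A B; exact: measurableI.
have mXXY j' (Z : T -> R) : measurable_fun setT Z ->
    measurable_fun [set: T] (fun w => ((Xt X w, Xs j' w), Z w)).
  by move=> mZ; apply: measurable_fun_pair.
have mqw i : measurable_fun [set: T] (fun w => query_weight i (Xt X w, Xs j w)).
  by case: (bmeas_comp (mXX j) (bmeas_query_weight i)).
have qw0 i w : 0 <= query_weight i (Xt X w, Xs j w) by exact: query_weight_ge0.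
move: f; apply: (@integral_like_unique _ _ _ G
  (fun f => \int[Pr]_w f ((Xt X w, Xs j w), Ys j w))%E
  (fun f => \sum_(i < n) \int[Pr]_w ((query_weight i (Xt X w, Xs j w))%:E *
      f ((Xt X w, Xs j w), Y i w)))%E) => //.
- exact: measurable_prod_measurableType.
- exact: (integral_like_pullback Pr (mXXY j _ (mYs j))).
- apply: integral_like_sum.
  + by move=> i; apply: (integral_like_weighted Pr (mqw i) (qw0 i)); exact: mXXY.
  + by move=> i g g0; apply: integral_ge0 => w _; rewrite mule_ge0// lee_fin.
  + move=> i g1 g2 mg1 mg2 g12.
    have mM g : measurable_fun setT g -> measurable_fun [set: T]
        (fun w => (query_weight i (Xt X w, Xs j w))%:E * g ((Xt X w, Xs j w), Y i w))%E.
      move=> mg; apply: emeasurable_funM; first exact/measurable_EFinP.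
      by apply: (measurableT_comp mg); exact: mXXY.
    apply: ge0_le_integral => //.
    * move=> w _; rewrite mule_ge0 ?lee_fin//.
      by case/andP: (g12 ((Xt X w, Xs j w), Y i w)).
    * exact: mM.
    * exact: mM.
    * move=> w _; rewrite lee_wpmul2l ?lee_fin//.
      by case/andP: (g12 ((Xt X w, Xs j w), Y i w)).
- by move=> g g0; exact: integral_ge0.
- by move=> g g0; apply: sume_ge0 => i _; apply: integral_ge0 => w _; rewrite mule_ge0// lee_fin.
- by rewrite integral_cst// mul1e [ltLHS](@probability_setT _ _ _ Pr) ltry.
move=> _ [A mA [B mB <-]].
have mAB := measurableX mA mB.
pose A0 := [set w | A (Xt X w, Xs j w)].
have mA0 : measurable A0.
  by rewrite -[X in measurable X]setTI; exact: mXX.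
pose Bj (j' : 'I_m) := if j' == j then B else setT.
have mBj j' : measurable (Bj j') by rewrite /Bj; case: ifP.
have [_ Wint _ WZ] := labelsP mBj.
have bigE : \bigcap_j' (Ys j' @^-1` Bj j') = Ys j @^-1` B.
  apply/seteqP; split => w /=.
    by move=> /(_ j Logic.I); rewrite /Bj eqxx.
  by move=> Bw j' _; rewrite /Bj; case: eqP => [->|].
rewrite (integral_indic_pullback Pr (mXXY j _ (mYs j)) mAB).
transitivity (Pr ((Ys j @^-1` B) `&` A0)).
  by congr (Pr _); apply/seteqP; split => w /= [].
have mYB : measurable (Ys j @^-1` B) by rewrite -[X in measurable X]setTI; exact: mYs.
transitivity (\int[Pr]_(w in A0) (\1_(Ys j @^-1` B) w)%:E)%E.
  by rewrite integral_indic.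
have := WZ A0 (sigma_sample_query j mA); rewrite bigE => <-.
transitivity (\int[Pr]_(w in A0) (\sum_(i < n) query_weight i (Xt X w, Xs j w) * \1_B (Y i w))%:E)%E.
  apply: ae_eq_integral => //.
  - case/integrableP: Wint => mW _; exact: measurable_funTS.
  - apply: measurable_funTS; apply/measurable_EFinP; apply: measurable_sum => i.
    apply: measurable_funM => //.
    exact: (measurableT_comp (measurable_indic mB)).
  have ae1 : {ae Pr, forall w, forall j', \sum_(i < n) query_weight i (Xt X w, Xs j' w) = 1}.
    by apply: filter_forall => j'; exact: query_weight_sum.
  apply: filterS ae1 => w w1 _; congr EFin.
  rewrite (bigD1 j)//= [X in _ * X]big1 ?mulr1.
    by apply: eq_bigr => i _; rewrite /Bj eqxx (knn_weightE _ kn).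
  move=> j' /negbTE j'j; rewrite -[RHS](w1 j'); apply: eq_bigr => i _.
  by rewrite /Bj j'j indicT mulr1 (knn_weightE _ kn).
under eq_integral do rewrite -sumEFin.
rewrite ge0_integral_sum//; last 2 first.
- move=> i; apply: measurable_funTS; apply/measurable_EFinP; apply: measurable_funM => //.
  exact: (measurableT_comp (measurable_indic mB)).
- by move=> i w _; rewrite lee_fin mulr_ge0.
apply: eq_bigr => i _; rewrite integral_mkcond; apply: eq_integral => w _.
rewrite patchE -EFinM; case: ifPn => wA.
  congr EFin; congr (_ * _); rewrite !indicE; congr (nat_of_bool _)%:R.
  by apply/idP/idP; rewrite !inE//; [move=> Bw; split => //; exact: set_mem wA|case].
rewrite indicE memNset ?mulr0// => -[Aw _]; case/negP: wA; exact/mem_set.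
Qed.

Section label_mean.
Variables (g : E * R -> R) (j : 'I_m).
Hypothesis mg : measurable_fun [set: E * R] g.
Hypothesis g_int : forall i, Pr.-integrable [set: T] (fun w => (g (Xs j w, Y i w))%:E).

Let mgY (Z : T -> R) : measurable_fun [set: T] Z ->
  measurable_fun [set: T] (fun w => g (Xs j w, Z w)).
Proof. by move=> mZ; apply: (measurableT_comp mg); exact: measurable_fun_pair. Qed.

Let mtest (A : set (n.-tuple E)) i : measurable A ->
  measurable_fun [set: T] (fun w => knn_test k A i (Xt X w, Xs j w)).
Proof. by move=> mA; case: (bmeas_comp (mXX j) (bmeas_knn_test k i mA)). Qed.

Let damped_integrable (A : set (n.-tuple E)) i (f : E * R -> R) : measurable A ->
  measurable_fun setT f -> (forall z, `|f z| <= `|g z|) ->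
  Pr.-integrable [set: T] (fun w => (knn_test k A i (Xt X w, Xs j w) * f (Xs j w, Y i w))%:E).
Proof.
move=> mA mf fg; have mfY : measurable_fun [set: T] (fun w => f (Xs j w, Y i w)).
  by apply: (measurableT_comp mf); exact: measurable_fun_pair.
apply: (le_integrable measurableT _ _ (g_int i)).
  by apply/measurable_EFinP; apply: measurable_funM => //; exact: mtest.
move=> w _; rewrite !abse_EFin lee_fin normrM -[leRHS]mul1r.
have /andP[t0 t1] := knn_test_ge0_le1 kn A i (Xt X w, Xs j w).
by apply: ler_pM => //; rewrite ger0_norm.
Qed.

Let label_mean_ge0 (A : set (n.-tuple E)) (f : E * R -> R) : measurable A ->
  measurable_fun setT f -> (forall z, 0 <= f z) ->
  (\int[Pr]_w (\1_A (Xt X w) * f (Xs j w, Ys j w))%:E =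
   \sum_(i < n) \int[Pr]_w (knn_test k A i (Xt X w, Xs j w) * f (Xs j w, Y i w))%:E)%E.
Proof.
move=> mA mf f0.
have m1 : measurable_fun [set: (n.-tuple E * E) * R] (fun z => \1_A z.1.1 : R).
  apply: (measurableT_comp (measurable_indic mA)).
  exact: (measurableT_comp measurable_fst measurable_fst).
have m2 : measurable_fun [set: (n.-tuple E * E) * R] (fun z => f (z.1.2, z.2)).
  apply: (measurableT_comp mf); apply: measurable_fun_pair => //.
  exact: (measurableT_comp measurable_snd measurable_fst).
rewrite [LHS](@label_law j (fun z => (\1_A z.1.1 * f (z.1.2, z.2))%:E)); last 2 first.
- by apply/measurable_EFinP; exact: measurable_funM.
- by move=> z; rewrite lee_fin mulr_ge0.
apply: eq_bigr => i _; apply: eq_integral => w _.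
by rewrite -EFinM /query_weight /knn_test/= mulrCA mulrA.
Qed.

(** [label_law] applied to the positive and negative parts of [g]. *)
Lemma label_mean (A : set (n.-tuple E)) : measurable A ->
  Pr.-integrable [set: T] (fun w => (g (Xs j w, Ys j w))%:E) /\
  (\int[Pr]_w (\1_A (Xt X w) * g (Xs j w, Ys j w))%:E =
   \sum_(i < n) \int[Pr]_w (knn_test k A i (Xt X w, Xs j w) * g (Xs j w, Y i w))%:E)%E.
Proof.
move=> mA; split.
  apply: integrable_signed_parts; first exact: mgY.
  have mag : measurable_fun [set: E * R] (fun z => `|g z|) by exact: measurableT_comp.
  have := @label_mean_ge0 setT (fun z => `|g z|) measurableT mag (fun z => normr_ge0 _).
  rewrite (_ : (\int[Pr]_w _)%E = (\int[Pr]_w (`|g (Xs j w, Ys j w)|)%:E)%E); last first.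
    by apply: eq_integral => w _; rewrite indicT mul1r.
  move=> ->; apply: lte_sum_pinfty => i _.
  have nn z : `| `|g z| | <= `|g z| by rewrite normr_id.
  have := integrable_fin_num measurableT (damped_integrable i measurableT mag nn).
  by rewrite fin_numElt => /andP[].
pose gp z := Num.max (g z) 0; pose gn z := Num.max (- g z) 0.
have mgp : measurable_fun [set: E * R] gp by exact: measurable_maxr.
have mgn : measurable_fun [set: E * R] gn.
  by apply: measurable_maxr => //; exact: measurableT_comp.
have gp0 z : 0 <= gp z by rewrite le_max lexx orbT.
have gn0 z : 0 <= gn z by rewrite le_max lexx orbT.
have gpg z : `|gp z| <= `|g z| by rewrite ger0_norm// ge_max ler_norm normr_ge0.
have gng z : `|gn z| <= `|g z|.
  by rewrite ger0_norm// ge_max -[X in _ <= X]normrN ler_norm normr_ge0.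
have maxM (a b : R) : 0 <= a -> Num.max (a * b) 0 = a * Num.max b 0.
  by move=> a0; rewrite maxr_pMr ?mulr0.
have ip i := integrable_fin_num measurableT (damped_integrable i mA mgp gpg).
have in_ i := integrable_fin_num measurableT (damped_integrable i mA mgn gng).
rewrite integral_signed_parts.
under eq_integral do rewrite maxM//.
under [X in (_ - X)%E]eq_integral do rewrite -mulrN maxM//.
rewrite (label_mean_ge0 mA mgp gp0) (label_mean_ge0 mA mgn gn0).
transitivity (\sum_(i < n)
  (\int[Pr]_w (knn_test k A i (Xt X w, Xs j w) * gp (Xs j w, Y i w))%:E -
   \int[Pr]_w (knn_test k A i (Xt X w, Xs j w) * gn (Xs j w, Y i w))%:E))%E.
  by rewrite -fin_num_sumeN// -big_split.
apply: eq_bigr => i _; rewrite [RHS]integral_signed_parts; congr (_ - _)%E.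
  apply: eq_integral => w _; rewrite maxM//.
  by case/andP: (knn_test_ge0_le1 kn A i (Xt X w, Xs j w)).
apply: eq_integral => w _; rewrite -mulrN maxM//.
by case/andP: (knn_test_ge0_le1 kn A i (Xt X w, Xs j w)).
Qed.

End label_mean.

End labels.

(** * Signed integrals against kernels, and rates *)

Section joint_law_mean.
Context d1 d2 (T1 : measurableType d1) (T2 : measurableType d2) {R : realType}.
Variables (mu : probability T1 R) (nu : R.-pker T1 ~> T2) (f : T1 * T2 -> R).
Hypothesis mf : measurable_fun [set: T1 * T2] f.
Hypothesis f_int : (joint_law mu nu).-integrable [set: T1 * T2] (EFin \o f).
Hypothesis f_fibre : forall x, (nu x).-integrable [set: T2] (fun y => (f (x, y))%:E).

Let fibre (g : T1 * T2 -> R) x : \bar R := (\int[nu x]_y (g (x, y))%:E)%E.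

Let fibre_fin (g : T1 * T2 -> R) x : measurable_fun setT g ->
  (forall z, 0 <= g z <= `|f z|) -> fibre g x \is a fin_num.
Proof.
move=> mg gf; apply: integrable_fin_num => //.
have mgx : measurable_fun [set: T2] (fun y => g (x, y)).
  by apply: (measurableT_comp mg); exact: measurable_pair1.
apply: (le_integrable measurableT _ _ (f_fibre x)); first exact/measurable_EFinP.
move=> y _; rewrite !abse_EFin lee_fin; case/andP: (gf (x, y)) => g0 gf'.
by rewrite ger0_norm.
Qed.

Let fibre_int (g : T1 * T2 -> R) : measurable_fun setT g ->
  (forall z, 0 <= g z <= `|f z|) -> mu.-integrable [set: T1] (fun x => (fine (fibre g x))%:E) /\
  (\int[joint_law mu nu]_z (g z)%:E = \int[mu]_x (fine (fibre g x))%:E)%E.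
Proof.
move=> mg gf; have mgE : measurable_fun [set: T1 * T2] (EFin \o g) by exact/measurable_EFinP.
have g0 z : 0 <= g z by case/andP: (gf z).
have eqI : (\int[joint_law mu nu]_z (g z)%:E = \int[mu]_x (fine (fibre g x))%:E)%E.
  have gE0 z : (0 <= (EFin \o g) z)%E by rewrite lee_fin.
  rewrite [LHS](@integral_joint_law _ _ _ _ _ mu nu _ mgE gE0).
  by apply: eq_integral => x _; rewrite fineK//; exact: fibre_fin.
split => //.
have fibreE : (fun x => (fine (fibre g x))%:E) = fibre g.
  by apply/funext => x; rewrite fineK//; exact: fibre_fin.
have mfib : measurable_fun [set: T1] (fibre g).
  exact: (@measurable_fun_integral_finite_kernel _ _ _ _ _ (EFin \o g) nu).
apply/integrableP; split; first by rewrite fibreE.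
rewrite (_ : (\int[mu]_x _)%E = (\int[mu]_x (fine (fibre g x))%:E)%E); last first.
  apply: eq_integral => x _; rewrite abse_EFin ger0_norm//.
  by apply: fine_ge0; apply: integral_ge0 => y _; rewrite lee_fin.
rewrite -eqI; case/integrableP: f_int => _; apply: le_lt_trans.
apply: ge0_le_integral => //.
- by move=> z _; rewrite lee_fin.
- by apply: measurableT_comp => //; exact/measurable_EFinP.
- by move=> z _; rewrite lee_fin; case/andP: (gf z).
Qed.

(** Fubini's theorem for a law given by a kernel, by positive and negative
    parts. *)
Lemma Rintegral_joint_law :
  \int[joint_law mu nu]_z f z = \int[mu]_x \int[nu x]_y f (x, y).
Proof.
have mp : measurable_fun [set: T1 * T2] (fun z => Num.max (f z) 0) by exact: measurable_maxr.
have mn : measurable_fun [set: T1 * T2] (fun z => Num.max (- f z) 0).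
  by apply: measurable_maxr => //; exact: measurableT_comp.
have lp z : 0 <= Num.max (f z) 0 <= `|f z|.
  by rewrite le_max lexx orbT ge_max ler_norm normr_ge0.
have ln z : 0 <= Num.max (- f z) 0 <= `|f z|.
  by rewrite le_max lexx orbT ge_max -[X in _ <= X]normrN ler_norm normr_ge0.
have [ip ep] := fibre_int mp lp; have [in_ en] := fibre_int mn ln.
congr fine; rewrite integral_signed_parts ep en -integralB//.
apply: eq_integral => x _; rewrite -EFinB; congr EFin.
rewrite /Rintegral integral_signed_parts.
by rewrite (fineB (fibre_fin x mp lp) (fibre_fin x mn ln)).
Qed.

End joint_law_mean.

Section rates.
Context {R : realType}.

(** [l = (k / (n + 1)) ^ (1 / d)] turns the squared mean [l ^ 4] and the
    variance [l ^ (d + 2)] into powers of [k / (n + 1)]; the exponent of the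
    second is [1 + 2 / d], at least [4 / d] when [2 <= d] and equal to [3] when
    [d = 1]. *)
Lemma rate_le (a : R) (d : nat) : (0 < d)%N -> 0 < a <= 1 ->
  let l := a `^ d%:R^-1 in
  [/\ 0 < l, l ^+ d = a & l ^+ 4 + l ^+ (d + 2) <= 2 * a `^ Num.min (4 / d%:R) 3].
Proof.
move=> d0 /andP[a0 a1] l; have dn0 : d%:R != 0 :> R by rewrite pnatr_eq0 -lt0n.
have dp : 0 < d%:R :> R by rewrite ltr0n.
have l0 : 0 < l by exact: powR_gt0.
have lX e : l ^+ e = a `^ (e%:R / d%:R).
  by rewrite -powR_mulrn ?(ltW l0)// /l -powRrM mulrC.
split => //; first by rewrite lX mulfV// powRr1// ltW.
rewrite mulr_natl mulr2n; apply: lerD; rewrite lX; apply: ger_powR; rewrite ?a0//.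
  by rewrite ge_min lexx.
rewrite ge_min (_ : (d + 2)%:R / d%:R = 1 + 2 / d%:R :> R); last by rewrite natrD; field.
have [d1|d1] := leqP d 1.
  have -> : d = 1%N by apply/eqP; rewrite eqn_leq d1.
  by apply/orP; right; lra.
apply/orP; left; rewrite -lerBlDr -mulrBl ler_pdivrMr// mul1r.
have : 2 <= d%:R :> R by rewrite ler_nat.
by lra.
Qed.

End rates.

(** * Second moment of the conditional bias *)

Section second_moment.
Context dT (T : measurableType dT) (R : realType) (d n m k : nat).
Local Notation E := 'rV[R]_d.
Variables (Pr : probability T R) (P Q : probability E R) (nu : R.-pker E ~> R).
Variables (X : 'I_n -> {RV Pr >-> E}) (Y : 'I_n -> {RV Pr >-> R}).
Variables (Xs : 'I_m -> {RV Pr >-> E}).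
Variables (S : set E) (p : E -> R).
Hypothesis sampleP : is_sample P Q nu X Y Xs.
Hypotheses (d0 : (0 < d)%N) (mS : measurable S) (PS : P S = 1%E) (Pp : has_density P p).
Hypotheses (m0 : (0 < m)%N) (kn : (0 < k <= n)%N).

Lemma integral_event (A : set (n.-tuple E)) (f : T -> R) :
  (\int[Pr]_(w in Xt X @^-1` A) (f w)%:E = \int[Pr]_w (\1_A (Xt X w) * f w)%:E)%E.
Proof.
rewrite integral_mkcond; apply: eq_integral => w _; rewrite patchE indicE.
rewrite (_ : (w \in Xt X @^-1` A) = (Xt X w \in A)).
  by case: ifP => _; rewrite ?mul1r ?mul0r.
by apply/idP/idP; rewrite !inE.
Qed.

Lemma integral_event_average (A : set (n.-tuple E)) (z : 'I_m -> T -> R) : measurable A ->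
  (forall j, Pr.-integrable [set: T] (EFin \o z j)) ->
  (\int[Pr]_(w in Xt X @^-1` A) (m%:R^-1 * \sum_(j < m) z j w)%:E =
   m%:R^-1%:E * \sum_(j < m) \int[Pr]_w (\1_A (Xt X w) * z j w)%:E)%E.
Proof.
move=> mA zint.
have mXA : measurable (Xt X @^-1` A).
  by rewrite -[X in measurable X]setTI; exact: (measurable_Xt X).
have zint' j : Pr.-integrable (Xt X @^-1` A) (EFin \o z j).
  exact: integrableS (zint j).
under eq_integral do rewrite EFinM -sumEFin.
have ints : Pr.-integrable (Xt X @^-1` A) (fun w => \sum_(j < m) (z j w)%:E)%E.
  by apply: integrable_sum => // j _; exact: zint'.
rewrite integralZl//.
rewrite integral_sum//; congr (_ * _)%E; apply: eq_bigr => j _.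
exact: integral_event.
Qed.

Variable H : E * (E * R) -> R.
Hypothesis mH : measurable_fun [set: E * (E * R)] H.
Hypothesis H_int : forall x u, (nu u).-integrable [set: R] (fun y => (H (x, (u, y)))%:E).
Hypothesis H_fin : (\int[Q]_x \int[joint_law P nu]_z `|(H (x, z))%:E| < +oo)%E.
Hypothesis bD : bmeas (fibre_mean nu H).

Let F := bias_kernel nu H S.
Let eh := \int[Q]_x fibre_mean nu H (x, x).

(** On the events of [sigma_X], [estimator_mean] identifies the mean of [Z]
    with that of [knn_err] plus a constant, so [W] is that function of the
    sample by uniqueness. *)
Lemma cond_second_moment (Z W : T -> R) :
  is_cond_expectation Pr (sigma_X X) Z W ->
  (forall A, measurable A -> (\int[Pr]_(w in Xt X @^-1` A) (Z w)%:E =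
     m%:R^-1%:E * \sum_(j < m) \sum_(i < n)
       \int[Pr]_w (knn_test k A i (Xt X w, Xs j w) * H (Xs j w, (X i w, Y i w)))%:E)%E) ->
  ('E_Pr[(fun w => (W w - eh) ^+ 2)%R] = (\int[law_Xt X]_t (knn_err Q F k t ^+ 2))%R%:E)%E.
Proof.
move=> ZW ZE; have bF : bmeas F := bmeas_bias_kernel bD mS.
have berr : bmeas (knn_err Q F k : n.-tuple E -> R) := bmeas_knn_err Q bF n k.
pose v (t : n.-tuple E) := knn_err Q F k t + eh.
have bv : bmeas v by apply: bmeasD => //; exact: bmeas_cst.
have aeWv : {ae Pr, forall w, W w = v (Xt X w)}.
  apply: (cond_expectation_unique ZW bv) => A mA; rewrite ZE//.
  under eq_bigr do rewrite (estimator_mean sampleP mH H_int H_fin bD d0 mS PS Pp m0 kn _ mA).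
  rewrite sumEFin sumr_const card_ord -EFinM -[X in _ * X]mulr_natl mulrA mulVf ?mul1r; last first.
    by rewrite pnatr_eq0 -lt0n.
  have bAv : bmeas (fun t : n.-tuple E => \1_A t * v t).
    by apply: bmeasM => //; exact: bmeas_indic.
  by rewrite (bmeas_EFin Pr (bmeas_comp (measurable_Xt X) bAv)) integral_event.
have berr2 := bmeasX 2 berr.
rewrite unlock law_Xt_mean// (bmeas_EFin Pr (bmeas_comp (measurable_Xt X) berr2)).
have [_ Wint _ _] := ZW.
have mWT : measurable_fun [set: T] W by case/integrableP: Wint => /measurable_EFinP.
apply: ae_eq_integral => //.
- by apply/measurable_EFinP; apply: measurable_funX; exact: measurable_funB.
- by apply/measurable_EFinP; case: (bmeas_comp (measurable_Xt X) berr2).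
by apply: filterS aeWv => w -> _; rewrite /v addrK.
Qed.

End second_moment.

Section bound.
Context (R : realType) (d : nat) (d_gt0 : (0 < d)%N).
Local Notation E := 'rV[R]_d.
Variables (S : set E) (P Q : probability E R) (nu : R.-pker E ~> R).
Variables (p q : E -> R).
Hypotheses (mS : measurable S) (PS : P S = 1%E) (QS : Q S = 1%E) (cS : compact S).
Hypothesis X2 : exists2 c : R, 0 < c &
  forall (x : E) (r : R), S x -> 0 <= r <= ediam S ->
    (c%:E * lebesgue_rV R d (ecball x r) <= lebesgue_rV R d (ecball x r `&` S))%E.
Hypotheses (Pp : has_density P p) (Qq : has_density Q q).
Hypothesis p_ge : exists2 plow : R, 0 < plow & forall x, S x -> plow <= p x.
Hypothesis q_le : exists2 qup : R, 0 < qup & forall x, S x -> q x <= qup.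
Hypothesis p_lip : elipschitz_on S p.
Hypothesis boundary : (ereal_sup [set (L `^ d%:R^-1)%R%:E *
           \int[Q]_(x in S) (expR (- (L * dist_compl S x ^+ d)))%R%:E
           | L in [set L : R | (0 < L)%R]] < +oo)%E.
Variable U : set E.
Hypotheses (convexU : @convex_set R E U) (SU : S `<=` U).
Variable H : E * (E * R) -> R.
Hypothesis mH : measurable_fun [set: E * (E * R)] H.
Hypothesis H_int : forall x u, (nu u).-integrable [set: R] (fun y => (H (x, (u, y)))%:E).
Hypothesis H_fin : (\int[Q]_x \int[joint_law P nu]_z `|(H (x, z))%:E| < +oo)%E.
Hypothesis H_S : forall x u y, ~ (S x /\ S u) -> H (x, (u, y)) = 0.
Hypothesis diag_lip : elipschitz_on S (fun x => fibre_mean nu H (x, x)).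
Variables (f : E -> E -> R) (M : R).
Hypothesis f_mean : forall x u, S x -> S u -> f x u = fibre_mean nu H (x, u).
Hypothesis f_C2 : forall x, S x -> C2_on U (f x).
Hypothesis f_M : forall x y, S x -> segments S y ->
  enorm (gradient (f x) y) + opnorm (hessian (f x) y) <= M.

Let D := fibre_mean nu H.

Let D_S x u : ~ (S x /\ S u) -> D (x, u) = 0.
Proof.
move=> nS; rewrite /D /fibre_mean -[RHS]/(fine 0%E); congr fine.
by apply: integral0_eq => y _; rewrite H_S.
Qed.

Let remainders x u : S x -> S u ->
  `|D (x, u) - D (x, x)| <= Num.max M 0 * enorm (u - x) /\
  (S (x + x - u) -> `|D (x, u) + D (x, x + x - u) - D (x, x) *+ 2| <=
     2 * Num.max M 0 * enorm (u - x) ^+ 2).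
Proof.
move=> Sx Su; have M0 y : segments S y -> enorm (gradient (f x) y) + opnorm (hessian (f x) y) <= Num.max M 0.
  by move=> yS; rewrite (le_trans (f_M Sx yS))// le_max lexx.
have [h1 h2] := C2_remainders convexU SU (f_C2 Sx) M0 Sx Su.
by split => [|Su']; rewrite /D -!f_mean//; exact: h2.
Qed.

Let max0 : 0 <= Num.max M 0. Proof. by rewrite le_max lexx orbT. Qed.

Let bD : bmeas D.
Proof.
split; first exact: (measurable_fibre_mean mH H_int).
have [Dm Dm0 S_diam] := compact_enorm_bounded cS.
have [g g0 g_lip] := elipschitz_ge0 diag_lip.
have [S0|/set0P[x0 Sx0]] := eqVneq S set0.
  by exists 0 => -[x u]; rewrite D_S ?normr0// S0 => -[].
exists (Num.max M 0 * Dm + (`|D (x0, x0)| + g * Dm)) => -[x u].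
have [[Sx Su]|nS] := pselect (S x /\ S u); last first.
  rewrite (D_S nS) normr0; apply: addr_ge0; first exact: mulr_ge0.
  by apply: addr_ge0 => //; exact: mulr_ge0.
rewrite -[D (x, u)](subrK (D (x, x))); apply: le_trans (ler_normD _ _) _.
apply: lerD.
  have [h _] := remainders Sx Su; apply: (le_trans h).
  by rewrite ler_wpM2l// S_diam.
rewrite -[D (x, x)](subrK (D (x0, x0))); apply: le_trans (ler_normD _ _) _.
rewrite addrC lerD2l; apply: (le_trans (g_lip _ _ Sx Sx0)).
by rewrite ler_wpM2l// S_diam.
Qed.

(** Common to the two estimators: only the integrand [H], averaged over the
    neighbours of the query points, distinguishes them. *)
Theorem conditional_bias_bound : exists C : R,
  forall (n m k : nat), (1 <= m)%N -> (1 <= k <= n)%N ->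
  forall (dT : measure_display) (T : measurableType dT) (Pr : probability T R)
    (X : 'I_n -> {RV Pr >-> E}) (Y : 'I_n -> {RV Pr >-> R}) (Xs : 'I_m -> {RV Pr >-> E}),
  is_sample P Q nu X Y Xs ->
  forall Z W : T -> R, is_cond_expectation Pr (sigma_X X) Z W ->
  (forall A, measurable A -> (\int[Pr]_(w in Xt X @^-1` A) (Z w)%:E =
     m%:R^-1%:E * \sum_(j < m) \sum_(i < n)
       \int[Pr]_w (knn_test k A i (Xt X w, Xs j w) * H (Xs j w, (X i w, Y i w)))%:E)%E) ->
  ('E_Pr[(fun w => (W w - \int[Q]_x D (x, x)) ^+ 2)%R]
     <= (C * (k%:R / n.+1%:R) `^ Num.min (4 / d%:R) 3)%R%:E)%E.
Proof.
pose F := bias_kernel nu H S.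
have F_S x u : ~ (S x /\ S u) -> F (x, u) = 0.
  move=> nS; rewrite /F /bias_kernel /= indicE.
  have [uS|_] := boolP (u \in S); last by rewrite mul0r.
  have nSx : ~ S x by move=> Sx; apply: nS; split => //; exact: set_mem.
  by rewrite -!/(D _) !D_S ?subrr ?mulr0//; tauto.
have FE x u : S u -> F (x, u) = D (x, u) - D (x, x).
  by move=> Su; rewrite /F /bias_kernel/= indicE mem_set// mul1r.
have mF : measurable_fun [set: E * E] F by case: (bmeas_bias_kernel bD mS).
have K0 : 0 <= 2 * Num.max M 0 by exact: mulr_ge0.
have F_lip x u : S x -> S u -> `|F (x, u)| <= 2 * Num.max M 0 * enorm (u - x).
  move=> Sx Su; rewrite FE//; have [h _] := remainders Sx Su; apply: (le_trans h).
  by rewrite ler_wpM2r ?enorm_ge0// mulr_natl mulr2n lerDl.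
have F_sym x u : S x -> S u -> S (x + x - u) ->
    `|F (x, u) + F (x, x + x - u)| <= 2 * Num.max M 0 * enorm (u - x) ^+ 2.
  move=> Sx Su Su'; rewrite !FE//; have [_ /(_ Su')] := remainders Sx Su.
  by rewrite addrACA -opprD -mulr2n.
have [C C0 CP] := knn_second_moment mS d_gt0 PS QS cS X2 Pp Qq p_ge q_le p_lip boundary
  mF K0 F_S F_lip F_sym.
exists (C * 2) => n m k m0 kn dT T Pr X Y Xs sampleP Z W ZW ZE.
rewrite (cond_second_moment sampleP d_gt0 mS PS Pp m0 kn mH H_int H_fin bD ZW ZE) lee_fin.
have /andP[k0 kn'] := kn.
have a01 : 0 < (k%:R / n.+1%:R : R) <= 1.
  by rewrite divr_gt0 ?ltr0n//= ler_pdivrMr ?ltr0n// mul1r ler_nat leqW.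
have [l0 lE lle] := rate_le d_gt0 a01.
have sc : scale_of d n k ((k%:R / n.+1%:R : R) `^ d%:R^-1) by split.
apply: (le_trans (CP n k _ (law_Xt X) (law_Xt_resamplable sampleP m0) sc)).
by rewrite -mulrA; apply: ler_wpM2l.
Qed.

End bound.

(** * The two estimators *)

Section extension.
Context (R : realType) (d : nat).
Local Notation E := 'rV[R]_d.
Variables (S : set E) (nu : R.-pker E ~> R) (h : E * R -> R).
Hypothesis mS : measurable S.
Hypothesis mh : measurable_fun (S `*` [set: R]) h.
Hypothesis h_int : forall x, S x -> (nu x).-integrable [set: R] (fun y => (h (x, y))%:E).

(** [h] is known on [S] only; extended by zero it is measurable everywhere. *)
Definition extend : E * R -> R := h \_ (S `*` [set: R]).

Lemma extendE x y : S x -> extend (x, y) = h (x, y).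
Proof. by move=> Sx; rewrite /extend patchE mem_set. Qed.

Lemma extend0 x y : ~ S x -> extend (x, y) = 0.
Proof. by move=> nSx; rewrite /extend patchE memNset// => -[]. Qed.

Let mD : measurable (S `*` [set: R]). Proof. exact: measurableX. Qed.

Lemma measurable_extend : measurable_fun [set: E * R] extend.
Proof. exact: (measurable_restrictT h mD).1. Qed.

Lemma extend_EFin : EFin \o extend = (EFin \o h) \_ (S `*` [set: R]).
Proof. by rewrite restrict_EFin. Qed.

Lemma integrable_extend x : (nu x).-integrable [set: R] (fun y => (extend (x, y))%:E).
Proof.
have [Sx|nSx] := pselect (S x).
  rewrite (_ : (fun y => _) = fun y => (h (x, y))%:E); first exact: h_int.
  by apply/funext => y; rewrite extendE.
rewrite (_ : (fun y => _) = cst 0%E); first exact: integrable0.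
by apply/funext => y; rewrite extend0.
Qed.

Lemma extend_mean (Q : probability E R) :
  (joint_law Q nu).-integrable (S `*` [set: R]) (EFin \o h) ->
  \int[joint_law Q nu]_(z in S `*` [set: R]) h z = \int[Q]_x \int[nu x]_y extend (x, y).
Proof.
move=> hQ; rewrite Rintegral_mkcond -/extend Rintegral_joint_law//.
- exact: measurable_extend.
- by rewrite extend_EFin; exact: (integrable_mkcond _ mD).1.
- exact: integrable_extend.
Qed.

Lemma mean_extend_diag x : S x -> \int[nu x]_y extend (x, y) = regression nu h x.
Proof. by move=> Sx; apply: eq_Rintegral => y _; rewrite extendE. Qed.

(** The label is averaged with the query point kept in the first argument. *)
Definition query_integrand (z : E * (E * R)) : R := \1_S z.2.1 * extend (z.1, z.2.2).

(** The label is averaged together with its own covariate. *)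
Definition sample_integrand (z : E * (E * R)) : R := \1_S z.1 * extend z.2.

Lemma measurable_query_integrand : measurable_fun [set: E * (E * R)] query_integrand.
Proof.
apply: measurable_funM.
  apply: (measurableT_comp (measurable_indic mS)).
  exact: (measurableT_comp measurable_fst measurable_snd).
apply: (measurableT_comp measurable_extend); apply: measurable_fun_pair => //.
exact: (measurableT_comp measurable_snd measurable_snd).
Qed.

Lemma measurable_sample_integrand : measurable_fun [set: E * (E * R)] sample_integrand.
Proof.
apply: measurable_funM.
  exact: (measurableT_comp (measurable_indic mS) measurable_fst).
exact: (measurableT_comp measurable_extend measurable_snd).
Qed.

Lemma query_integrandE x u y : S x -> S u -> query_integrand (x, (u, y)) = h (x, y).
Proof. by move=> Sx Su; rewrite /query_integrand indicE mem_set// mul1r extendE. Qed.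

Lemma sample_integrandE x u y : S x -> S u -> sample_integrand (x, (u, y)) = h (u, y).
Proof. by move=> Sx Su; rewrite /sample_integrand indicE mem_set// mul1r extendE. Qed.

Lemma query_integrand0 x u y : ~ (S x /\ S u) -> query_integrand (x, (u, y)) = 0.
Proof.
move=> nS; rewrite /query_integrand indicE/=.
have [Su|_] := boolP (u \in S); last by rewrite mul0r.
by rewrite extend0 ?mulr0// => Sx; apply: nS; split => //; exact: set_mem.
Qed.

Lemma sample_integrand0 x u y : ~ (S x /\ S u) -> sample_integrand (x, (u, y)) = 0.
Proof.
move=> nS; rewrite /sample_integrand indicE/=.
have [Sx|_] := boolP (x \in S); last by rewrite mul0r.
by rewrite extend0 ?mulr0// => Su; apply: nS; split => //; exact: set_mem.
Qed.

Lemma query_integrand_diag x y : query_integrand (x, (x, y)) = extend (x, y).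
Proof.
have [Sx|nSx] := pselect (S x); first by rewrite query_integrandE// extendE.
by rewrite query_integrand0 ?extend0//; tauto.
Qed.

Lemma sample_integrand_diag x y : sample_integrand (x, (x, y)) = extend (x, y).
Proof.
have [Sx|nSx] := pselect (S x); first by rewrite sample_integrandE// extendE.
by rewrite sample_integrand0 ?extend0//; tauto.
Qed.

Lemma query_integrand_int :
  (forall x u, S x -> S u -> (nu u).-integrable [set: R] (fun y => (h (x, y))%:E)) ->
  forall x u, (nu u).-integrable [set: R] (fun y => (query_integrand (x, (u, y)))%:E).
Proof.
move=> hxu x u; have [[Sx Su]|nS] := pselect (S x /\ S u).
  rewrite (_ : (fun y => _) = fun y => (h (x, y))%:E); first exact: hxu.
  by apply/funext => y; rewrite query_integrandE.
rewrite (_ : (fun y => _) = cst 0%E); first exact: integrable0.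
by apply/funext => y; rewrite query_integrand0.
Qed.

Lemma sample_integrand_int x u :
  (nu u).-integrable [set: R] (fun y => (sample_integrand (x, (u, y)))%:E).
Proof.
have [[Sx Su]|nS] := pselect (S x /\ S u).
  rewrite (_ : (fun y => _) = fun y => (h (u, y))%:E); first exact: h_int.
  by apply/funext => y; rewrite sample_integrandE.
rewrite (_ : (fun y => _) = cst 0%E); first exact: integrable0.
by apply/funext => y; rewrite sample_integrand0.
Qed.

Lemma query_integrand_fin (P Q : probability E R) :
  (\int[Q]_(x in S) \int[joint_law P nu]_(z in S `*` [set: R]) `|(h (x, z.2))%:E| < +oo)%E ->
  (\int[Q]_x \int[joint_law P nu]_z `|(query_integrand (x, z))%:E| < +oo)%E.
Proof.
apply: le_lt_trans; rewrite [leRHS]integral_mkcond; rewrite le_eqVlt; apply/orP; left; apply/eqP.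
apply: eq_integral => x _; rewrite patchE; case: ifPn => [/set_mem Sx|/negP nSx].
  rewrite [RHS]integral_mkcond; apply: eq_integral => -[u y] _.
  rewrite patchE; case: ifPn => [/set_mem[/= Su _]|/negP nSu].
    by rewrite query_integrandE.
  rewrite query_integrand0 ?abse0// => -[_ Su]; apply: nSu; exact/mem_set.
apply: integral0_eq => -[u y] _; rewrite query_integrand0 ?abse0// => -[Sx _].
by apply: nSx; exact/mem_set.
Qed.

Lemma sample_integrand_fin (P Q : probability E R) :
  (joint_law P nu).-integrable (S `*` [set: R]) (EFin \o h) ->
  (\int[Q]_x \int[joint_law P nu]_z `|(sample_integrand (x, z))%:E| < +oo)%E.
Proof.
move=> hP.
have /integrableP[mx foo] : (joint_law P nu).-integrable setT (EFin \o extend).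
  by rewrite extend_EFin; exact: (integrable_mkcond _ mD).1.
apply: (@le_lt_trans _ _ (\int[Q]_x (cst (\int[joint_law P nu]_z `|(EFin \o extend) z|) x))%E).
  apply: ge0_le_integral => //.
  - by move=> x _; exact: integral_ge0.
  - have mZ : measurable_fun [set: E * (E * R)] (fun z => `|(sample_integrand z)%:E|)%E.
      by apply: measurableT_comp => //; apply/measurable_EFinP; exact: measurable_sample_integrand.
    have Z0 z : (0 <= `|(sample_integrand z)%:E|)%E by exact: abse_ge0.
    exact: (@measurable_fun_fubini_tonelli_F _ _ _ _ _ (joint_law P nu) _ mZ Z0).
  move=> x _; apply: ge0_le_integral => //.
  - apply: measurableT_comp => //; apply/measurable_EFinP.
    by apply: (measurableT_comp measurable_sample_integrand); exact: measurable_pair1.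
  - exact: measurableT_comp.
  move=> z _; rewrite !abse_EFin lee_fin /sample_integrand normrM -[leRHS]mul1r.
  rewrite ler_wpM2r// indicE/=; case: (_ \in _); by rewrite ?normr1 ?normr0.
by rewrite integral_cst// [X in (_ * X)%E](@probability_setT _ _ _ Q) mule1.
Qed.

End extension.

Section estimator_events.
Context dT (T : measurableType dT) (R : realType) (d n m k : nat).
Local Notation E := 'rV[R]_d.
Variables (Pr : probability T R) (P Q : probability E R) (nu : R.-pker E ~> R).
Variables (X : 'I_n -> {RV Pr >-> E}) (Y : 'I_n -> {RV Pr >-> R}).
Variables (Xs : 'I_m -> {RV Pr >-> E}) (Ys : 'I_m -> {RV Pr >-> R}).
Variables (S : set E) (p : E -> R) (h : E * R -> R).
Hypothesis sampleP : is_sample P Q nu X Y Xs.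
Hypotheses (d0 : (0 < d)%N) (mS : measurable S) (PS : P S = 1%E) (Pp : has_density P p).
Hypotheses (m0 : (0 < m)%N) (kn : (0 < k <= n)%N).
Hypothesis mh : measurable_fun (S `*` [set: R]) h.
Hypotheses (XS : forall a w, S (X a w)) (XsS : forall j w, S (Xs j w)).
Variables (A : set (n.-tuple E)) (mA : measurable A).

(** [label_mean] replaces the drawn label by those of the neighbours. *)
Lemma estimator1_event :
  (forall x u, S x -> S u -> (nu u).-integrable [set: R] (fun y => (h (x, y))%:E)) ->
  (\int[Q]_(x in S) \int[joint_law P nu]_(z in S `*` [set: R]) `|(h (x, z.2))%:E| < +oo)%E ->
  resampled_labels X Y Xs Ys k ->
  (\int[Pr]_(w in Xt X @^-1` A) (estimator1 h (Xs ^~ w) (Ys ^~ w))%:E =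
   m%:R^-1%:E * \sum_(j < m) \sum_(i < n) \int[Pr]_w (knn_test k A i (Xt X w, Xs j w) *
     query_integrand S h (Xs j w, (X i w, Y i w)))%:E)%E.
Proof.
move=> hint hfin labelsP.
have mg := measurable_extend mS mh.
have gE j (Z : T -> R) w : h (Xs j w, Z w) = extend S h (Xs j w, Z w) by rewrite extendE.
have g_int j i : Pr.-integrable [set: T] (fun w => (extend S h (Xs j w, Y i w))%:E).
  have := sample_H_integrable sampleP (measurable_query_integrand mS mh)
    (query_integrand_fin hfin) i j.
  congr (_.-integrable _ _); apply/funext => w /=.
  by rewrite query_integrandE// extendE.
have label j := label_mean sampleP labelsP d0 mS PS Pp m0 kn mg (g_int j) mA.
rewrite /estimator1.
under eq_integral do under eq_bigr do rewrite gE.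
rewrite (integral_event_average X mA (fun j => (label j).1)).
congr (_ * _)%E; apply: eq_bigr => j _; have [_ ->] := label j.
apply: eq_bigr => i _; apply: eq_integral => w _.
by rewrite query_integrandE// extendE.
Qed.

(** [estimator2E] writes the estimator as an average over the query points. *)
Lemma estimator2_event :
  (joint_law P nu).-integrable (S `*` [set: R]) (EFin \o h) ->
  (\int[Pr]_(w in Xt X @^-1` A) (estimator2 k h (X ^~ w) (Y ^~ w) (Xs ^~ w))%:E =
   m%:R^-1%:E * \sum_(j < m) \sum_(i < n) \int[Pr]_w (knn_test k A i (Xt X w, Xs j w) *
     sample_integrand S h (Xs j w, (X i w, Y i w)))%:E)%E.
Proof.
move=> hP.
pose z (j : 'I_m) w := \sum_(i < n) knn_test k setT i (Xt X w, Xs j w) *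
  sample_integrand S h (Xs j w, (X i w, Y i w)).
have term_int B i j : measurable B -> Pr.-integrable [set: T]
    (fun w => (knn_test k B i (Xt X w, Xs j w) *
       sample_integrand S h (Xs j w, (X i w, Y i w)))%:E).
  move=> mB; have [mt _] := bmeas_knn_test k i mB.
  exact: (weighted_H_integrable sampleP (measurable_sample_integrand mS mh)
    (sample_integrand_fin mS mh Q hP) mt (knn_test_ge0_le1 kn B i)).
have zE w : estimator2 k h (X ^~ w) (Y ^~ w) (Xs ^~ w) = m%:R^-1 * \sum_(j < m) z j w.
  rewrite (estimator2E X kn)//; congr (_ * _); apply: eq_bigr => j _; apply: eq_bigr => i _.
  by rewrite (knn_weightE X kn) /knn_test/= indicT mul1r sample_integrandE.
under eq_integral do rewrite zE.
rewrite integral_event_average//; last first.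
  move=> j; rewrite (_ : EFin \o z j = fun w => (\sum_(i < n)
      (knn_test k setT i (Xt X w, Xs j w) * sample_integrand S h (Xs j w, (X i w, Y i w)))%:E)%E).
    by apply: integrable_sum => // i _; exact: term_int.
  by apply/funext => w; rewrite /= sumEFin.
congr (_ * _)%E; apply: eq_bigr => j _.
under eq_integral do rewrite mulr_sumr -sumEFin.
rewrite (@integral_sum _ _ _ Pr setT measurableT _
  (fun i w => (\1_A (Xt X w) * (knn_test k setT i (Xt X w, Xs j w) *
     sample_integrand S h (Xs j w, (X i w, Y i w))))%:E)).
  apply: eq_bigr => i _; apply: eq_integral => w _.
  by rewrite mulrA; congr (_ * _)%:E; rewrite /knn_test/= indicT mul1r.
move=> i; rewrite (_ : (fun w => _) = fun w => (knn_test k A i (Xt X w, Xs j w) *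
       sample_integrand S h (Xs j w, (X i w, Y i w)))%:E); first exact: term_int.
by apply/funext => w; rewrite mulrA; congr (_ * _)%:E; rewrite /knn_test/= indicT mul1r.
Qed.

End estimator_events.

Theorem theorem1 (R : realType) (d : nat) (d_gt0 : (0 < d)%N)
  (S : set 'rV[R]_d) (mS : measurable S)
  (P Q : probability 'rV[R]_d R) (PS : P S = 1%E) (QS : Q S = 1%E)
  (nu : R.-pker 'rV[R]_d ~> R)
  (h : 'rV[R]_d * R -> R)
  (mh : measurable_fun (S `*` [set: R]) h)
  (h_intP : (joint_law P nu).-integrable (S `*` [set: R]) (EFin \o h))
  (h_intQ : (joint_law Q nu).-integrable (S `*` [set: R]) (EFin \o h))
  (h_int : forall x, S x ->
     (nu x).-integrable [set: R] (fun y => (h (x, y))%:E))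
  (i : nat) (i12 : i = 1%N \/ i = 2%N)
  (X1 : compact S)
  (X2 : exists2 c : R, 0 < c &
     forall (x : 'rV[R]_d) (r : R), S x -> 0 <= r <= ediam S ->
       (c%:E * lebesgue_rV R d (ecball x r)
         <= lebesgue_rV R d (ecball x r `&` S))%E)
  (p q : 'rV[R]_d -> R)
  (X3P : has_density P p) (X3Q : has_density Q q)
  (X3p : exists2 plow : R, 0 < plow & forall x, S x -> plow <= p x)
  (X3q : exists2 qup : R, 0 < qup & forall x, S x -> q x <= qup)
  (X4 : elipschitz_on S (regression nu h))
  (X5 : elipschitz_on S p)
  (HA : (ereal_sup [set (L `^ d%:R^-1)%R%:E *
           \int[Q]_(x in S) (expR (- (L * dist_compl S x ^+ d)))%R%:E
           | L in [set L : R | (0 < L)%R]] < +oo)%E)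
  (U : set 'rV[R]_d) (openU : open U)
  (convexU : @convex_set R 'rV[R]_d U) (boundedU : bounded_set U)
  (SU : S `<=` U)
  (H1 : i = 1%N ->
     [/\ forall x u, S x -> S u ->
           (nu u).-integrable [set: R] (fun y => (h (x, y))%:E),
         (\int[Q]_(x in S) \int[joint_law P nu]_(z in S `*` [set: R])
            `|(h (x, z.2))%:E| < +oo)%E
       & exists D : 'rV[R]_d -> 'rV[R]_d -> R,
         [/\ forall x u, S x -> S u -> D x u = Delta nu h x u,
             forall x, S x -> C2_on U (D x)
           & (ereal_sup [set (enorm (gradient (D z.1) z.2)
                              + opnorm (hessian (D z.1) z.2))%R%:E
                        | z in S `*` conv_hull S] < +oo)%E]])
  (H2 : i = 2%N ->
     exists G : 'rV[R]_d -> R,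
       (forall x, S x -> G x = regression nu h x) /\ C2_on U G) :
  let eh : R := \int[joint_law Q nu]_(z in S `*` [set: R]) h z in
  exists C : R,
    forall (n m k : nat), (1 <= n)%N -> (1 <= m)%N -> (1 <= k <= n)%N ->
    forall (dT : measure_display) (T : measurableType dT)
      (Pr : probability T R)
      (X : 'I_n -> {RV Pr >-> 'rV[R]_d}) (Y : 'I_n -> {RV Pr >-> R})
      (Xs : 'I_m -> {RV Pr >-> 'rV[R]_d}) (Ys : 'I_m -> {RV Pr >-> R}),
    (forall a w, S (X a w)) -> (forall j w, S (Xs j w)) ->
    is_sample P Q nu X Y Xs ->
    (i = 1%N -> resampled_labels X Y Xs Ys k) ->
    forall W : T -> R,
    is_cond_expectation Pr (sigma_X X)
      (fun w => if i == 1%N then estimator1 h (Xs ^~ w) (Ys ^~ w)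
                else estimator2 k h (X ^~ w) (Y ^~ w) (Xs ^~ w)) W ->
    ('E_Pr[(fun w => (W w - eh) ^+ 2)%R]
      <= (C * (k%:R / n.+1%:R) `^ Num.min (4 / d%:R) 3)%R%:E)%E.
Proof.
move=> eh.
(* what the two estimators share: an integrand [H], a smooth extension [f] of
   its average over the label with a bound [M] for the derivatives, and the
   mean of the estimator on the events of the covariates *)
have [H [f [M [mH [H_int [H_fin [H_S [diagE [f_mean [f_C2 [f_M events]]]]]]]]]]] :
  exists (H : 'rV[R]_d * ('rV[R]_d * R) -> R) (f : 'rV[R]_d -> 'rV[R]_d -> R) (M : R),
    measurable_fun [set: 'rV[R]_d * ('rV[R]_d * R)] H /\
    (forall x u, (nu u).-integrable [set: R] (fun y => (H (x, (u, y)))%:E)) /\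
    (\int[Q]_x \int[joint_law P nu]_z `|(H (x, z))%:E| < +oo)%E /\
    (forall x u y, ~ (S x /\ S u) -> H (x, (u, y)) = 0) /\
    (forall x y, H (x, (x, y)) = extend S h (x, y)) /\
    (forall x u, S x -> S u -> f x u = fibre_mean nu H (x, u)) /\
    (forall x, S x -> C2_on U (f x)) /\
    (forall x y, S x -> segments S y ->
       enorm (gradient (f x) y) + opnorm (hessian (f x) y) <= M) /\
    forall n m k (dT : measure_display) (T : measurableType dT) (Pr : probability T R)
      (X : 'I_n -> {RV Pr >-> 'rV[R]_d}) (Y : 'I_n -> {RV Pr >-> R})
      (Xs : 'I_m -> {RV Pr >-> 'rV[R]_d}) (Ys : 'I_m -> {RV Pr >-> R}),
      (0 < m)%N -> (0 < k <= n)%N ->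
      (forall a w, S (X a w)) -> (forall j w, S (Xs j w)) ->
      is_sample P Q nu X Y Xs -> (i = 1%N -> resampled_labels X Y Xs Ys k) ->
      forall A, measurable A ->
      (\int[Pr]_(w in Xt X @^-1` A) (if i == 1%N then estimator1 h (Xs ^~ w) (Ys ^~ w)
                else estimator2 k h (X ^~ w) (Y ^~ w) (Xs ^~ w))%:E =
       m%:R^-1%:E * \sum_(j < m) \sum_(l < n) \int[Pr]_w (knn_test k A l (Xt X w, Xs j w) *
         H (Xs j w, (X l w, Y l w)))%:E)%E.
  case: i12 => i_eq; subst i.
  - have [h_xu h_fin [D [DE DC2 Dsup]]] := H1 erefl.
    set s := ereal_sup _ in Dsup.
    exists (query_integrand S h), D, (fine s).
    split; first exact: measurable_query_integrand.
    split; first exact: query_integrand_int.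
    split; first exact: query_integrand_fin.
    split; first by move=> x u y; exact: query_integrand0.
    split; first exact: query_integrand_diag.
    split.
      move=> x u Sx Su; rewrite DE//; apply: eq_Rintegral => y _.
      by rewrite query_integrandE.
    split; first exact: DC2.
    split.
      move=> x y Sx yS.
      have : ((enorm (gradient (D x) y) + opnorm (hessian (D x) y))%:E <= s)%E.
        apply: ereal_sup_ubound; exists (x, y) => //; split => //.
        exact: segments_conv_hull.
      by case: s Dsup => [r| |]//=; rewrite lee_fin.
    move=> n m k dT T Pr X Y Xs Ys m0 kn XS XsS sampleP labelsP A mA /=.
    exact: (estimator1_event sampleP d_gt0 mS PS X3P m0 kn mh XS XsS mA h_xu h_fin (labelsP erefl)).
  - have [G [GE GC2]] := H2 erefl.
    have [M GM] := C2_bounded_on_segments X1 convexU SU GC2.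
    exists (sample_integrand S h), (fun=> G), M.
    split; first exact: measurable_sample_integrand.
    split; first exact: sample_integrand_int.
    split; first exact: sample_integrand_fin.
    split; first by move=> x u y; exact: sample_integrand0.
    split; first exact: sample_integrand_diag.
    split.
      move=> x u Sx Su; rewrite GE//; apply: eq_Rintegral => y _.
      by rewrite sample_integrandE.
    split; first by move=> x _.
    split; first by move=> x y _; exact: GM.
    move=> n m k dT T Pr X Y Xs Ys m0 kn XS XsS sampleP _ A mA /=.
    exact: (estimator2_event sampleP mS m0 kn mh XS XsS mA h_intP).
have diag_mean x : fibre_mean nu H (x, x) = \int[nu x]_y extend S h (x, y).
  by apply: eq_Rintegral => y _; exact: diagE.
have diag_lip : elipschitz_on S (fun x => fibre_mean nu H (x, x)).
  have [K gK] := X4; exists K => x y Sx Sy.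
  by rewrite !diag_mean !mean_extend_diag//; exact: gK.
have ehE : eh = \int[Q]_x fibre_mean nu H (x, x).
  by rewrite /eh extend_mean//; apply: eq_Rintegral => x _.
have [C CP] := conditional_bias_bound d_gt0 mS PS QS X1 X2 X3P X3Q X3p X3q X5 HA
  convexU SU mH H_int H_fin H_S diag_lip f_mean f_C2 f_M.
exists C => n m k n0 m0 kn dT T Pr X Y Xs Ys XS XsS sampleP labelsP W WP.
rewrite ehE; apply: (CP n m k m0 kn dT T Pr X Y Xs sampleP _ W WP) => A mA.
exact: events.
Qed.
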